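(* Let $n\ge2$, let $(M,g)$ be an oriented Lorentzian $(n+1)$-manifold, let $U\subset\mathbb{R}^n$ be a domain and $F:U\to M$ an immersion. Assume one of the following: (i) $M$ and $F$ are real analytic, $F$ has constant mean curvature $c\neq0$, and $F$ admits a light-like point; or (ii) $M$ is of class $C^r$ with $r\ge4$, $F$ is of class $C^4$, $F$ has zero mean curvature, and $F$ admits a degenerate light-like point. Then the hypersurface (the image of $F$) contains a light-like geodesic segment of $M$ consisting of images under $F$ of degenerate light-like points.
   Context: The signature of $g$ is $(-,+,\dots,+)$. ''$M$ of class $C^r$'' means that the underlying manifold is taken real analytic and $g$ is of class $C^r$. $D$ is the Levi-Civita connection and $\Omega$ the Lorentzian volume form. Let $(u_1,\dots,u_n)$ be the coordinates on $U$ and $F_{u_i}=dF(\partial/\partial u_i)$. $S_F=(s_{i,j})_{i,j=1}^n$ with $s_{i,j}=g(F_{u_i},F_{u_j})$, and $B_F=\det S_F$. Points of $\Sigma_F=\{B_F=0\}$ are light-like points; a light-like point $p$ is degenerate if $dB_F(p)=0$. The normal field $\tilde\nu$ along $F$ is defined by $g(\tilde\nu,w)=\Omega(F_{u_1},\dots,F_{u_n},w)$ for all $w$; it satisfies $g(\tilde\nu,\tilde\nu)=-B_F$. Let $\tilde h_{i,j}=g(D_{\partial/\partial u_i}F_{u_j},\tilde\nu)$, let $(\tilde s^{i,j})$ be the cofactor matrix of $S_F$, and $A_F=\sum_{i,j}\tilde s^{i,j}\tilde h_{i,j}$. $F$ has constant mean curvature $c$ if $A_F-nc|B_F|^{3/2}$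 vanishes identically on $U$; for $c=0$ (i.e. $A_F\equiv0$) it has zero mean curvature. A light-like geodesic segment is the image of a geodesic $\sigma$ defined on a nonempty open interval with $\sigma'\ne0$ and $g(\sigma',\sigma')=0$. *)

(* Defs.v *)
From HB Require Import structures.
From mathcomp Require Import all_boot all_order all_algebra.
From mathcomp Require Import all_classical all_reals all_analysis.

Set Implicit Arguments.
Unset Strict Implicit.
Unset Printing Implicit Defensive.

Import Order.TTheory GRing.Theory Num.Theory.
Import numFieldNormedType.Exports.

Local Open Scope classical_set_scope.
Local Open Scope ring_scope.

(* f is k times continuously differentiable on O; meant for O open in a
   finite-dimensional V, where it is enough to test directional derivatives. *)
Fixpoint Ck (R : realType) (V W : normedModType R) (k : nat) (O : set V)
    (f : V -> W) : Prop :=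
  match k with
  | 0%N => {within O, continuous f}
  | k'.+1 => (forall x, O x -> differentiable f x) /\
             (forall v, Ck k' O ('D_v f))
  end.

(* The family (f x)_x is absolutely summable with sum s. *)
Definition has_sum (R : realType) (T : choiceType) (f : T -> R) (s : R) : Prop :=
  summable [set: T] (EFin \o f) /\
  (\esum_(x in [set: T]) ((EFin \o f)^\+ x) -
   \esum_(x in [set: T]) ((EFin \o f)^\- x) = s%:E)%E.

(* On O open: around each point of O, f is the sum of a power series that
   converges absolutely on a polydisc; al ranges over multi-indices. *)
Definition analytic_on (R : realType) (m : nat) (O : set 'rV[R]_m)
    (f : 'rV[R]_m -> R) : Prop :=
  forall x, O x ->
  exists (coef : {ffun 'I_m -> nat} -> R) (rho : R), 0 < rho /\
    forall y : 'rV[R]_m, (forall i, `|y 0 i - x 0 i| < rho) ->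
      has_sum (fun al : {ffun 'I_m -> nat} =>
                 coef al * \prod_(i < m) (y 0 i - x 0 i) ^+ al i)
              (f y).

(* A homeomorphism from an open subset of M onto an open subset of R^d, given
   by a pair of total functions whose values off these sets are irrelevant. *)
Record chart (R : realType) (d : nat) (M : topologicalType) := Chart {
  cdom : set M ;
  cmap : M -> 'rV[R]_d ;
  cinv : 'rV[R]_d -> M ;
  cdom_open : open cdom ;
  cimg_open : open (cmap @` cdom) ;
  cmapK : forall p, cdom p -> cinv (cmap p) = p ;
  cmap_continuous : {within cdom, continuous cmap} ;
  cinv_continuous : {within cmap @` cdom, continuous cinv} }.

Definition cimg (R : realType) (d : nat) (M : topologicalType)
  (a : chart R d M) : set 'rV[R]_d := cmap a @` cdom a.

Definition transition (R : realType) (d : nat) (M : topologicalType)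
  (a b : chart R d M) : 'rV[R]_d -> 'rV[R]_d := cmap b \o cinv a.

Definition transition_dom (R : realType) (d : nat) (M : topologicalType)
  (a b : chart R d M) : set 'rV[R]_d := cmap a @` (cdom a `&` cdom b).

Definition minkowski_mx (R : realType) (d : nat) : 'M[R]_d :=
  diag_mx (\row_(i < d) if (i == 0%N :> nat) then -1 else 1).

(* The symmetric bilinear form with matrix G has signature (-,+,...,+). *)
Definition lorentzian_mx (R : realType) (d : nat) (G : 'M[R]_d) : Prop :=
  exists2 P : 'M[R]_d, P \in unitmx & G = P *m minkowski_mx R d *m P^T.

(* A real analytic d-manifold with an oriented atlas (its charts are the
   positively oriented ones) and a Lorentzian metric, given by its components
   in each chart.  No regularity of the metric is included here.  Coordinate
   vectors are rows, hence the side on which 'J acts in [metricJ].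
   [chart_at p] is a chosen chart around p. *)
Record oriented_lorentz_manifold (R : realType) (d : nat) (M : topologicalType)
    := OrientedLorentzManifold {
  olm_hausdorff : hausdorff_space M ;
  olm_second_countable : @second_countable M ;
  chart_index : Type ;
  charts : chart_index -> chart R d M ;
  chart_at : M -> chart_index ;
  chart_atP : forall p, cdom (charts (chart_at p)) p ;
  transition_analytic : forall a b (k : 'I_d),
    analytic_on (transition_dom (charts a) (charts b))
      (fun x => transition (charts a) (charts b) x 0 k) ;
  transition_oriented : forall a b x,
    transition_dom (charts a) (charts b) x ->
    0 < \det ('J (transition (charts a) (charts b)) x) ;
  metric : chart_index -> 'rV[R]_d -> 'M[R]_d ;
  metric_lorentzian : forall a x,
    cimg (charts a) x -> lorentzian_mx (metric a x) ;
  metricJ : forall a b x, transition_dom (charts a) (charts b) x ->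
    metric a x = 'J (transition (charts a) (charts b)) x
      *m metric b (transition (charts a) (charts b) x)
      *m ('J (transition (charts a) (charts b)) x)^T }.

Section Geometry.
Context (R : realType) (d : nat) (M : topologicalType).
Context (X : oriented_lorentz_manifold R d M).

Definition metric_Ck (r : nat) : Prop :=
  forall a : chart_index X, Ck r (cimg (charts a)) (metric a).

Definition metric_analytic : Prop :=
  forall (a : chart_index X) (i j : 'I_d),
    analytic_on (cimg (charts a)) (fun x => metric a x i j).

Definition Ck_map (V : normedModType R) (k : nat) (O : set V) (f : V -> M) :
    Prop :=
  {within O, continuous f} /\
  forall a : chart_index X,
    Ck k (O `&` f @^-1` cdom (charts a)) (cmap (charts a) \o f).

Definition analytic_map (m : nat) (O : set 'rV[R]_m) (f : 'rV[R]_m -> M) :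
    Prop :=
  {within O, continuous f} /\
  forall (a : chart_index X) (k : 'I_d),
    analytic_on (O `&` f @^-1` cdom (charts a))
      (fun u => cmap (charts a) (f u) 0 k).

(* A tangent vector at q is represented by its row of components in the chart
   [chart_at X q]; the functions below that return scalars do not depend on
   that choice of chart. *)

Definition gram_at (q : M) : 'M[R]_d :=
  metric (chart_at X q) (cmap (charts (chart_at X q)) q).

Definition metric_at (q : M) (v w : 'rV[R]_d) : R :=
  (v *m gram_at q *m w^T) 0 0.

Definition volume_at (q : M) (e : 'I_d -> 'rV[R]_d) : R :=
  Num.sqrt `|\det (gram_at q)| * \det (\matrix_(i < d) e i).

(* Christoffel symbols Gamma^k_{pq} of the Levi-Civita connection at the point
   with coordinates x in the chart a. *)
Definition christoffel (a : chart_index X) (x : 'rV[R]_d) (k p q : 'I_d) : R :=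
  2^-1 * \sum_(l < d) invmx (metric a x) k l *
    ('D_(delta_mx 0 p) (fun y => metric a y q l) x +
     'D_(delta_mx 0 q) (fun y => metric a y p l) x -
     'D_(delta_mx 0 l) (fun y => metric a y p q) x).

(* The vector df(v) at f x. *)
Definition tangent (V : normedModType R) (f : V -> M) (v x : V) : 'rV[R]_d :=
  'D_v (cmap (charts (chart_at X (f x))) \o f) x.

(* D_v (df(w)) at x: the covariant derivative, in the direction v, of the
   vector field df(w) along f. *)
Definition cov_deriv (V : normedModType R) (f : V -> M) (v w x : V) :
    'rV[R]_d :=
  let a := chart_at X (f x) in
  let y := cmap (charts a) \o f in
  'D_v ('D_w y) x +
  \row_(k < d) \sum_(p < d) \sum_(q < d)
     christoffel a (y x) k p q * ('D_v y x) 0 p * ('D_w y x) 0 q.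

Definition geodesic (J : set R) (sigma : R^o -> M) : Prop :=
  Ck_map 2 (J : set R^o) sigma /\
  forall t, J t -> cov_deriv sigma 1 1 t = 0.

Definition lightlike_geodesic_segment (L : set M) : Prop :=
  exists (J : set R) (sigma : R^o -> M),
    [/\ is_interval J, open J & J !=set0] /\
    [/\ geodesic J sigma,
        forall t, J t -> tangent sigma 1 t != 0,
        forall t, J t ->
          metric_at (sigma t) (tangent sigma 1 t) (tangent sigma 1 t) = 0 &
        L = sigma @` J].

End Geometry.

Definition domain (R : realType) (n : nat) (U : set 'rV[R]_n) : Prop :=
  [/\ open U, connected U & U !=set0].

Section Hypersurface.
Context (R : realType) (n : nat) (M : topologicalType).
Context (X : oriented_lorentz_manifold R n.+1 M) (F : 'rV[R]_n -> M).

Definition pd (i : 'I_n) (u : 'rV[R]_n) : 'rV[R]_n.+1 :=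
  tangent X F (delta_mx 0 i) u.

Definition immersion (U : set 'rV[R]_n) : Prop :=
  Ck_map X 1 U F /\
  forall u, U u -> row_free (\matrix_(i < n) pd i u).

Definition SF (u : 'rV[R]_n) : 'M[R]_n :=
  \matrix_(i < n, j < n) metric_at X (F u) (pd i u) (pd j u).

Definition BF (u : 'rV[R]_n) : R := \det (SF u).

(* The (n+1)-tuple (F_{u_1}, ..., F_{u_n}, w). *)
Definition frame (u : 'rV[R]_n) (w : 'rV[R]_n.+1) (k : 'I_n.+1) :
    'rV[R]_n.+1 :=
  if unlift ord_max k is Some i then pd i u else w.

Definition is_normal (u : 'rV[R]_n) (nu : 'rV[R]_n.+1) : Prop :=
  forall w, metric_at X (F u) nu w = volume_at X (F u) (frame u w).

(* The unique vector satisfying [is_normal]. *)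
Definition normal (u : 'rV[R]_n) : 'rV[R]_n.+1 := xget 0 (is_normal u).

Definition hF (u : 'rV[R]_n) (i j : 'I_n) : R :=
  metric_at X (F u) (cov_deriv X F (delta_mx 0 i) (delta_mx 0 j) u) (normal u).

Definition AF (u : 'rV[R]_n) : R :=
  \sum_(i < n) \sum_(j < n) cofactor (SF u) i j * hF u i j.

Definition constant_mean_curvature (U : set 'rV[R]_n) (c : R) : Prop :=
  forall u, U u -> AF u - n%:R * c * (`|BF u| `^ (3 / 2)) = 0.

Definition zero_mean_curvature (U : set 'rV[R]_n) : Prop :=
  constant_mean_curvature U 0.

Definition lightlike_point (U : set 'rV[R]_n) (p : 'rV[R]_n) : Prop :=
  U p /\ BF p = 0.

Definition degenerate_point (U : set 'rV[R]_n) (p : 'rV[R]_n) : Prop :=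
  lightlike_point U p /\
  (differentiable BF p /\ 'd BF p = 0 :> ('rV[R]_n -> R)).

Lemma normalP (u : 'rV[R]_n) :
  is_normal u (normal u) /\ forall nu, is_normal u nu -> nu = normal u.
Proof.
set G := gram_at X (F u).
have Gu : G \in unitmx.
  rewrite /G /gram_at.
  have [|P Pu ->] := @metric_lorentzian _ _ _ X (chart_at X (F u))
    (cmap (charts (chart_at X (F u))) (F u)).
    by exists (F u) => //; exact: chart_atP.
  rewrite !unitmx_mul Pu unitmx_tr Pu andbT /= unitmxE det_diag unitfE.
  by apply/prodf_neq0 => i _; rewrite mxE; case: ifP; rewrite ?oppr_eq0 oner_neq0.
have uniq nu nu' : is_normal u nu -> is_normal u nu' -> nu = nu'.
  move=> h h'; suff: nu *m G = nu' *m G.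
    by move/(congr1 (mulmx^~ (invmx G))); rewrite !mulmxK.
  apply/rowP => k; have := h (delta_mx 0 k); rewrite -h' /metric_at -/G.
  by rewrite !trmx_delta -!colE !mxE.
suff ex : exists nu, is_normal u nu.
  have Nu : is_normal u (normal u) by case: ex => nu; exact: xgetI.
  by split => // nu /uniq; apply.
pose om w := volume_at X (F u) (frame u w).
exists ((\row_k om (delta_mx 0 k)) *m invmx G) => w.
rewrite /metric_at -/G mulmxKV// mxE -/(om w).
have omE v : om v = \sum_k v 0 k *
    (Num.sqrt `|\det G| * cofactor (\matrix_i frame u 0 i) ord_max k).
  rewrite /om /volume_at -/G [X in _ * X](expand_det_row _ ord_max).
  rewrite mulr_sumr.
  apply: eq_bigr => k _; rewrite mxE /frame unlift_none mulrCA.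
  congr (_ * (_ * (_ * \det _))).
  by apply/matrixP => i j; rewrite !mxE /frame; rewrite liftK.
rewrite [RHS]omE; apply: eq_bigr => k _; rewrite !mxE mulrC; congr (_ * _).
rewrite omE (bigD1 k)//= big1 ?mxE ?eqxx ?mul1r ?addr0// => l /negPf lk.
by rewrite mxE lk andbF mul0r.
Qed.

End Hypersurface.

(* Main.v *)
From HB Require Import structures.
Require Import Defs.
From mathcomp Require Import all_boot all_order all_algebra.
From mathcomp Require Import all_classical all_reals all_analysis.
From mathcomp Require Import ring lra.

Set Implicit Arguments.
Unset Strict Implicit.
Unset Printing Implicit Defensive.

Import Order.TTheory GRing.Theory Num.Theory.
Import numFieldNormedType.Exports.

Local Open Scope classical_set_scope.
Local Open Scope ring_scope.

(** A degenerate light-like point spreads along a null geodesic because, on a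
    hypersurface of constant mean curvature, the function [B] satisfies a
    linear differential inequality along the tangential part of the normal.

    Near the given point, work in one chart of the manifold and complete
    [F_{u_1}, ..., F_{u_n}] by a constant vector [N] to a frame, with volume
    [omega] and Gram matrix [K]. The normal decomposes in this frame as
    [nu = \sum_i V_i F_{u_i} - (B / omega) N] ([chart_nu_coord]), so at
    light-like points [nu] is the image of the vector field [V] and is a null
    vector, [g(nu, nu)] being [- B].

    Two facts compute the derivative of [B] along [V] ([BF_along_nu]). First,
    Jacobi's complementary minor identity ([jacobi_minor]) shows that the
    cofactor matrix of [S] is [B H + V^T V] for a block [H] of [K^-1], hence
    [A = B tr(H h) + h(V, V)]. Second, compatibility of the connection with
    the metric gives [h(V, .) = dB / 2 - (B / omega) q] for a certain covector
    [q] ([nu_tan_hF]). Together they give [V(B) = 2 A + k B] with [k]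
    continuous. In both cases of the theorem [A^2 = c^2 |B|^3] for some [c],
    so [|A|] is at most a multiple of [|B|] where [|B|] is bounded by one, and
    [|V(B)| <= C |B|] locally ([BF_along_nu_bound]).

    Now follow [V] from a degenerate point ([null_curve]). Gronwall's lemma
    yields [B = 0] along the curve. At such zeros the inequality may be
    differentiated: it bounds the derivatives along [V] of the partial
    derivatives of [B] linearly by these partial derivatives
    ([gradient_dominated]), and a second application of Gronwall's lemma
    yields [dB = 0] along the curve. At points where [B] and [dB] vanish,
    [h(V, .) = 0], which means that [D_V nu = lambda nu] ([nu_autoparallel]).
    Hence if the curve is parametrized by [g' = s V(g)] with
    [s' = - lambda(g) s^2], then [F o g] has velocity [s nu] and acceleration
    zero: it is a null geodesic, all of whose points are images of degenerate
    points ([chart_null_geodesic]). The existence of [g] and [s] is the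
    Picard-Lindeloef theorem ([Picard_Lindelof], [local_flow]).

    If the mean curvature is not zero, every light-like point is degenerate
    ([cmc_critical]). Otherwise, on a line through the point along which [B]
    has nonzero derivative, [|B|^3] is of order [t^3]; but [A] is of class
    [C^2] and vanishes with its first derivative, [|A|] being small against
    [|B|], so [A^2] is of order [t^4].

    It remains to pass between the analytic hypotheses, the chart and the
    intrinsic quantities. Power series are differentiated term by term
    ([power_series_derive]), whence analytic maps are of class [C^k]
    ([analytic_Ck]). Tangent vectors at a point are represented in a chart
    chosen at that point; covariant derivatives transform correctly under a
    change of chart because Koszul's formula ([Koszul]) expresses them by the
    metric alone ([nabla_change]). *)

(** * Directional derivatives *)

Section DirectionalDerivatives.
Context {R : realType} {V : normedModType R}.

Lemma derive_mxE m n (f : V -> 'M[R]_(m, n)) v x i j :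
  differentiable f x -> ('D_v f x) i j = 'D_v (fun y => f y i j) x.
Proof. by move=> df; rewrite derive_mx ?mxE//; exact: diff_derivable. Qed.

Lemma differentiable_entry m n (f : V -> 'M[R]_(m, n)) x i j :
  differentiable f x -> differentiable (fun y => f y i j) x.
Proof. by move=> df; exact: (differentiable_comp df (differentiable_coord _ i j)). Qed.

Lemma differentiable_mx m n (f : V -> 'M[R]_(m, n)) x :
  (forall i j, differentiable (fun y => f y i j) x) -> differentiable f x.
Proof.
move=> df.
rewrite (_ : f = \sum_(i < m) \sum_(j < n)
    (fun y => f y i j *: delta_mx i j : 'M[R]_(m, n))).
  apply: differentiable_sum => i; apply: differentiable_sum => j.
  exact: differentiableZl.
apply/funext => y; rewrite [LHS]matrix_sum_delta fct_sumE.
by apply: eq_bigr => i _; rewrite fct_sumE.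
Qed.

Lemma deriveZv (W : normedModType R) (f : V -> W) x a v :
  differentiable f x -> 'D_(a *: v) f x = a *: 'D_v f x.
Proof. by move=> df; rewrite !deriveE// linearZ. Qed.

Lemma derive_row d (W : normedModType R) (f : 'rV[R]_d -> W) x v :
  differentiable f x -> 'D_v f x = \sum_i v 0 i *: 'D_(delta_mx 0 i) f x.
Proof.
move=> df; rewrite deriveE// [in LHS](row_sum_delta v) linear_sum.
by apply: eq_bigr => i _; rewrite linearZ deriveE.
Qed.

Lemma derive_chain (U W : normedModType R) (f : V -> U) (g : U -> W) x v :
  differentiable f x -> differentiable g (f x) ->
  'D_v (g \o f) x = 'D_('D_v f x) g (f x).
Proof.
move=> df dg; rewrite deriveE; last exact: differentiable_comp.
by rewrite diff_comp// deriveE// deriveE.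
Qed.

Lemma derive_chain_row d (W : normedModType R) (f : V -> 'rV[R]_d)
    (g : 'rV[R]_d -> W) x v :
  differentiable f x -> differentiable g (f x) ->
  'D_v (g \o f) x = \sum_i ('D_v f x) 0 i *: 'D_(delta_mx 0 i) g (f x).
Proof. by move=> df dg; rewrite derive_chain// derive_row. Qed.

(** The first-order expansion of [f] at [x] is also one of [g], and its linear
    part is then the differential of [g] by uniqueness. *)
Lemma near_eq_differentiable (W : normedModType R) (f g : V -> W) x :
  (\near x, f x = g x) -> differentiable f x -> differentiable g x.
Proof.
move=> fg df; have [cf Ef] := (diff_locallyP x f).1 df.
have Eg : g \o shift x = cst (g x) + 'd f x +o_ 0 id.
  apply/eqaddoP => _ /posnumP[e].
  have /eqaddoP/(_ _ [gt0 of e%:num]) := Ef.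
  have : \forall y \near 0, f (y + x) = g (y + x).
    by move: fg; rewrite (near_shift 0 x) subr0.
  apply: filterS2 => y /= Ey.
  rewrite -![(_ + _ : _ -> _) _]/(_ + _) -![(- _ : _ -> _) _]/(- _) /=.
  by rewrite Ey /cst (nbhs_singleton fg).
have E : 'd g x = 'd f x :> (V -> W) by exact: diff_unique.
by apply/diff_locallyP; rewrite E.
Qed.

End DirectionalDerivatives.

(** * Operations on functions of class C^k *)

Section CkClosure.
Context {R : realType} {V : normedModType R}.
Implicit Types (W : normedModType R) (O : set V).

Lemma open_near O (P : V -> Prop) x :
  open O -> O x -> (forall y, O y -> P y) -> \near x, P x.
Proof. by move=> oO Ox h; apply: filterS (open_nbhs_nbhs (conj oO Ox)). Qed.

Lemma Ck_continuous W k O (f : V -> W) : open O -> Ck k O f ->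
  forall x, O x -> {for x, continuous f}.
Proof.
move=> oO; case: k => [|k] /=.
  by rewrite continuous_open_subspace// => h x Ox; apply: h; rewrite inE.
by case=> + _ x Ox => /(_ x Ox) /differentiable_continuous.
Qed.

Lemma Ck0P W O (f : V -> W) : open O ->
  (forall x, O x -> {for x, continuous f}) -> Ck 0 O f.
Proof. by move=> oO h /=; rewrite continuous_open_subspace// => x /set_mem/h. Qed.

Lemma eq_Ck W k O (f g : V -> W) : open O -> (forall x, O x -> f x = g x) ->
  Ck k O f -> Ck k O g.
Proof.
move=> oO; elim: k f g => [|k IH] f g fg Cf.
  apply: Ck0P => // x Ox; have := Ck_continuous oO Cf Ox.
  rewrite /prop_for /continuous_at -fg//; apply: cvg_trans.
  by apply: near_eq_cvg; apply: (open_near oO Ox) => y Oy; rewrite fg.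
case: Cf => df Cf; split.
  move=> x Ox; apply: near_eq_differentiable (df x Ox).
  exact: (open_near oO Ox).
move=> v; apply: IH (Cf v) => x Ox; apply: near_eq_derive.
exact: (open_near oO Ox).
Qed.

Lemma Ck_sub W k O O' (f : V -> W) : open O' -> open O -> O' `<=` O ->
  Ck k O f -> Ck k O' f.
Proof.
move=> oO' oO s; elim: k f => [|k IH] f Cf.
  by apply: Ck0P => // x /s Ox; exact: (Ck_continuous oO Cf).
by case: Cf => df Cf; split => [x /s/df//|v]; exact: IH (Cf v).
Qed.

Lemma CkS W k O (f : V -> W) : open O -> Ck k.+1 O f -> Ck k O f.
Proof.
move=> oO; elim: k f => [|k IH] f Cf.
  by apply: Ck0P => // x Ox; exact: (Ck_continuous oO Cf).
by case: Cf => df Cf; split => // v; exact: IH (Cf v).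
Qed.

Lemma Ck_le W k l O (f : V -> W) : open O -> (l <= k)%N -> Ck k O f -> Ck l O f.
Proof.
move=> oO /subnK <-; elim: (k - l)%N => [//|m IH]; rewrite addSn => Cf.
by apply: IH; exact: CkS.
Qed.

Lemma Ck_diff W k O (f : V -> W) x : Ck k.+1 O f -> O x -> differentiable f x.
Proof. by case=> df _ /df. Qed.

Lemma Ck_derive W k O (f : V -> W) v : Ck k.+1 O f -> Ck k O ('D_v f).
Proof. by case=> _; apply. Qed.

Lemma Ck_cst W k O (c : W) : open O -> Ck k O (fun=> c).
Proof.
move=> oO; elim: k c => [|k IH] c.
  by apply: Ck0P => // x _; exact: cst_continuous.
split=> [x _|v]; first exact: differentiable_cst.
by apply: eq_Ck (IH 0) => // x _; rewrite derive_cst.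
Qed.

Lemma CkD W k O (f g : V -> W) : open O -> Ck k O f -> Ck k O g ->
  Ck k O (fun x => f x + g x).
Proof.
move=> oO; elim: k f g => [|k IH] f g Cf Cg.
  by apply: Ck0P => // x Ox; apply: continuousD;
    [exact: (Ck_continuous oO Cf)|exact: (Ck_continuous oO Cg)].
split=> [x Ox|v].
  by apply: differentiableD; [exact: Ck_diff Cf _|exact: Ck_diff Cg _].
apply: eq_Ck (IH _ _ (Ck_derive v Cf) (Ck_derive v Cg)) => // x Ox.
by rewrite deriveD//; apply: diff_derivable; [exact: Ck_diff Cf _|exact: Ck_diff Cg _].
Qed.

Lemma Ck_sum W (I : Type) (r : seq I) (P : pred I) k O (f : I -> V -> W) :
  open O -> (forall i, Ck k O (f i)) -> Ck k O (fun x => \sum_(i <- r | P i) f i x).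
Proof.
move=> oO Cf; elim: r => [|i r IH].
  by apply: eq_Ck (Ck_cst k 0 oO) => // x _; rewrite big_nil.
case Pi: (P i).
  by apply: eq_Ck (CkD oO (Cf i) IH) => // x _; rewrite big_cons Pi.
by apply: eq_Ck IH => // x _; rewrite big_cons Pi.
Qed.

(** As for inverses, square roots and composites below, the induction closes
    because the derivative of the result is an expression of the same kind in
    functions of class C^k. *)
Lemma CkM k O (f g : V -> R) : open O -> Ck k O f -> Ck k O g ->
  Ck k O (fun x => f x * g x).
Proof.
move=> oO; elim: k f g => [|k IH] f g Cf Cg.
  by apply: Ck0P => // x Ox; apply: continuousM;
    [exact: (Ck_continuous oO Cf)|exact: (Ck_continuous oO Cg)].
split=> [x Ox|v].
  by apply: differentiableM; [exact: Ck_diff Cf _|exact: Ck_diff Cg _].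
have := CkD oO (IH _ _ (CkS oO Cf) (Ck_derive v Cg))
    (IH _ _ (CkS oO Cg) (Ck_derive v Cf)).
apply: eq_Ck => // x Ox.
by rewrite deriveM//; apply: diff_derivable; [exact: Ck_diff Cf _|exact: Ck_diff Cg _].
Qed.

Lemma CkN k O (f : V -> R) : open O -> Ck k O f -> Ck k O (fun x => - f x).
Proof.
move=> oO Cf; apply: eq_Ck (CkM oO (Ck_cst k (-1 : R) oO) Cf) => // x _.
by rewrite mulN1r.
Qed.

Lemma CkB k O (f g : V -> R) : open O -> Ck k O f -> Ck k O g ->
  Ck k O (fun x => f x - g x).
Proof. by move=> oO Cf Cg; apply: CkD => //; exact: CkN. Qed.

Lemma Ck_prod (I : Type) (r : seq I) (P : pred I) k O (f : I -> V -> R) :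
  open O -> (forall i, Ck k O (f i)) -> Ck k O (fun x => \prod_(i <- r | P i) f i x).
Proof.
move=> oO Cf; elim: r => [|i r IH].
  by apply: eq_Ck (Ck_cst k (1 : R) oO) => // x _; rewrite big_nil.
case Pi: (P i).
  by apply: eq_Ck (CkM oO (Cf i) IH) => // x _; rewrite big_cons Pi.
by apply: eq_Ck IH => // x _; rewrite big_cons Pi.
Qed.

Lemma CkV k O (f : V -> R) : open O -> (forall x, O x -> f x != 0) ->
  Ck k O f -> Ck k O (fun x => (f x)^-1).
Proof.
move=> oO f0; elim: k => [|k IH] Cf.
  by apply: Ck0P => // x Ox; apply: continuousV;
    [exact: f0|exact: (Ck_continuous oO Cf)].
split=> [x Ox|v].
  by apply: differentiableV; [exact: Ck_diff Cf _|exact: f0].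
have IH' := IH (CkS oO Cf).
have := CkN oO (CkM oO (CkM oO IH' IH') (Ck_derive v Cf)).
apply: eq_Ck => // x Ox.
rewrite deriveV ?f0//; last by apply: diff_derivable; exact: Ck_diff Cf _.
by rewrite -exprVn expr2 scaleNr.
Qed.

(** The norm of a matrix is the largest absolute value of its entries, so that
    continuity and differentiability can be tested entrywise. *)
Lemma Ck_mxP m n k O (f : V -> 'M[R]_(m, n)) : open O ->
  Ck k O f <-> forall i j, Ck k O (fun x => f x i j).
Proof.
move=> oO; elim: k f => [|k IH] f.
  split => [Cf i j|Cf].
    apply: Ck0P => // x Ox.
    apply: (@continuous_comp _ _ _ f (fun M : 'M[R]_(m, n) => M i j)).
      exact: (Ck_continuous oO Cf).
    exact: coord_continuous.
  apply: Ck0P => // x Ox; apply/cvgrPdist_le => /= e e0.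
  have H : \forall t \near x, forall ij : 'I_m * 'I_n,
      `|f x ij.1 ij.2 - f t ij.1 ij.2| <= e.
    apply: filter_forall => -[i j] /=.
    by have /cvgrPdist_le/(_ _ e0) := Ck_continuous oO (Cf i j) Ox.
  apply: filterS H => t H.
  rewrite /Num.Def.normr/= mx_normrE (bigmax_le _ (ltW e0))//= => i _.
  by rewrite !mxE.
split=> [Cf i j|Cf].
  split=> [x Ox|v]; first by apply: differentiable_entry; exact: Ck_diff Cf _.
  have := (IH _).1 (Ck_derive v Cf) i j; apply: eq_Ck => // x Ox.
  by rewrite derive_mxE//; exact: Ck_diff Cf _.
have df x : O x -> differentiable f x.
  by move=> Ox; apply: differentiable_mx => i j; exact: Ck_diff (Cf i j) _.
split=> // v; apply/IH => i j.
apply: eq_Ck (Ck_derive v (Cf i j)) => // x Ox.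
by rewrite derive_mxE//; exact: df.
Qed.

Lemma Ck_det n k O (f : V -> 'M[R]_n) : open O -> Ck k O f ->
  Ck k O (fun x => \det (f x)).
Proof.
move=> oO /(Ck_mxP _ _ oO) Cf; rewrite /determinant.
by apply: Ck_sum => // s; apply: CkM; [|exact: Ck_cst|exact: Ck_prod].
Qed.

Lemma Ck_mulmx m n p k O (f : V -> 'M[R]_(m, n)) (g : V -> 'M[R]_(n, p)) :
  open O -> Ck k O f -> Ck k O g -> Ck k O (fun x => f x *m g x).
Proof.
move=> oO /(Ck_mxP _ _ oO) Cf /(Ck_mxP _ _ oO) Cg; apply/Ck_mxP => // i j.
apply: (@eq_Ck _ _ _ (fun x => \sum_l f x i l * g x l j)) => //.
  by move=> x _; rewrite mxE.
by apply: Ck_sum => // l; exact: CkM.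
Qed.

Lemma Ck_trmx m n k O (f : V -> 'M[R]_(m, n)) :
  open O -> Ck k O f -> Ck k O (fun x => (f x)^T).
Proof.
move=> oO /(Ck_mxP _ _ oO) Cf; apply/Ck_mxP => // i j.
by apply: eq_Ck (Cf j i) => // x _; rewrite mxE.
Qed.

Lemma Ck_cofactor n k O (f : V -> 'M[R]_n) i j :
  open O -> Ck k O f -> Ck k O (fun x => cofactor (f x) i j).
Proof.
move=> oO Cf; apply: CkM => //; first exact: Ck_cst.
apply: Ck_det => //; apply/Ck_mxP => // a b.
apply: eq_Ck ((Ck_mxP _ _ oO).1 Cf (lift i a) (lift j b)) => // x _.
by rewrite !mxE.
Qed.

Lemma Ck_invmx n k O (f : V -> 'M[R]_n) : open O ->
  (forall x, O x -> f x \in unitmx) -> Ck k O f -> Ck k O (fun x => invmx (f x)).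
Proof.
move=> oO fu Cf; apply/Ck_mxP => // i j.
apply: (@eq_Ck _ _ _ (fun x => (\det (f x))^-1 * cofactor (f x) j i)) => //.
  by move=> x Ox; rewrite /invmx fu// !mxE.
apply: CkM => //; last exact: Ck_cofactor.
apply: CkV => //; last exact: Ck_det.
by move=> x /fu; rewrite unitmxE unitfE.
Qed.

Lemma Ck_sqrt k O (f : V -> R) : open O -> (forall x, O x -> 0 < f x) ->
  Ck k O f -> Ck k O (fun x => Num.sqrt (f x)).
Proof.
move=> oO f0; elim: k => [|k IH] Cf.
  apply: Ck0P => // x Ox; apply: (@continuous_comp _ _ _ f Num.sqrt).
    exact: (Ck_continuous oO Cf).
  exact: sqrt_continuous.
have IH' := IH (CkS oO Cf).
have ds (x : V) : O x -> is_derive (f x) 1 (@Num.sqrt R) (2 * Num.sqrt (f x))^-1.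
  by move=> Ox; exact: is_derive1_sqrt (f0 _ Ox).
have dsd x : O x -> differentiable (@Num.sqrt R) (f x).
  by move=> /ds h; apply/derivable1_diffP; exact: (@ex_derive _ _ _ _ _ _ _ h).
split=> [x Ox|v].
  by apply: (differentiable_comp (Ck_diff Cf Ox)); exact: dsd.
apply: (@eq_Ck _ _ _ (fun x => (2 * Num.sqrt (f x))^-1 * 'D_v f x)) => //.
  move=> x Ox.
  rewrite [RHS](derive_chain v (Ck_diff Cf Ox) (dsd _ Ox)).
  rewrite -[X in 'D_X Num.sqrt _]mulr1 deriveZv; last exact: dsd.
  by rewrite (@derive_val _ _ _ _ _ _ _ (ds _ Ox)) mulrC.
apply: CkM => //; last exact: Ck_derive.
apply: CkV => //; last by apply: CkM => //; exact: Ck_cst.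
by move=> x Ox; rewrite mulf_neq0// gt_eqF// sqrtr_gt0 f0.
Qed.

End CkClosure.

Lemma Ck_comp (R : realType) (V : normedModType R) d k (O : set V)
    (O' : set 'rV[R]_d) (f : V -> 'rV[R]_d) (g : 'rV[R]_d -> R) :
  open O -> open O' -> (forall x, O x -> O' (f x)) ->
  Ck k O f -> Ck k O' g -> Ck k O (g \o f).
Proof.
move=> oO oO' OO'; elim: k g => [|k IH] g Cf Cg.
  apply: Ck0P => // x Ox; apply: continuous_comp.
    exact: (Ck_continuous oO Cf).
  by apply: (Ck_continuous oO' Cg); exact: OO'.
split=> [x Ox|v].
  by apply: differentiable_comp; [exact: Ck_diff Cf _|exact: Ck_diff Cg (OO' _ Ox)].
apply: (@eq_Ck _ _ _ _ _
  (fun x => \sum_i ('D_v f x) 0 i * ('D_(delta_mx 0 i) g \o f) x)) => //.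
  move=> x Ox; rewrite derive_chain_row//; first exact: Ck_diff Cf _.
  exact: Ck_diff Cg (OO' _ Ox).
apply: Ck_sum => // i; apply: CkM => //.
  by have /Ck_mxP := Ck_derive v Cf; exact.
by apply: IH; [exact: CkS|exact: Ck_derive].
Qed.

(** * Mean value theorem and symmetry of second derivatives *)

Section MeanValue.
Context {R : realType} {V : normedModType R}.

Lemma is_derive_line (W : normedModType R) (g : V -> W) y v t :
  differentiable g (y + t *: v) ->
  is_derive t 1 (fun t : R => g (y + t *: v)) ('D_v g (y + t *: v)).
Proof.
move=> dg.
have dl : is_diff t (fun t : R => y + t *: v) (fun t => 0 + t *: v).
  exact: is_diffD.
have Dl : 'D_1 (fun t : R => y + t *: v) t = v.
  by rewrite deriveE ?diff_val ?add0r ?scale1r//; exact: ex_diff.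
split; first by apply/diff_derivable/differentiable_comp => //; exact: ex_diff.
have := derive_chain (1 : R) (@ex_diff _ _ _ _ _ _ _ dl) dg; by rewrite Dl.
Qed.

Lemma mvt_line (g : V -> R) y v (h : R) : 0 < h ->
  (forall t, 0 <= t <= h -> differentiable g (y + t *: v)) ->
  exists2 s, 0 < s < h & g (y + h *: v) - g y = h * 'D_v g (y + s *: v).
Proof.
move=> h0 dg.
have H t : 0 <= t <= h ->
    is_derive t 1 (fun t : R => g (y + t *: v)) ('D_v g (y + t *: v)).
  by move=> /dg; exact: is_derive_line.
have [||s sh E] := @MVT _ (fun t : R => g (y + t *: v))
    (fun t => 'D_v g (y + t *: v)) 0 h h0.
- by move=> t; rewrite in_itv/= => /andP[t0 th]; apply: H; rewrite !ltW.
- apply: continuous_in_subspaceT => t; rewrite inE/= in_itv/= => /H h1.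
  apply/differentiable_continuous/derivable1_diffP; exact: ex_derive.
exists s; first by move: sh; rewrite in_itv.
by move: E; rewrite scale0r addr0 subr0 mulrC.
Qed.

(** The mean value theorem is applied to [z |-> f (z + h *: w) - f z] in the
    direction [v], and then to ['D_v f] in the direction [w]. The left-hand
    side is symmetric in [v] and [w], which is the reason why mixed
    derivatives are. *)
Lemma rectangle_mvt (f : V -> R) y v w (h : R) : 0 < h ->
  (forall s t, 0 <= s <= h -> 0 <= t <= h ->
     differentiable f (y + s *: v + t *: w) /\
     differentiable ('D_v f) (y + s *: v + t *: w)) ->
  exists st : R * R, [/\ 0 < st.1 < h, 0 < st.2 < h &
    f (y + h *: v + h *: w) - f (y + h *: v) - (f (y + h *: w) - f y) =
    h * (h * 'D_w ('D_v f) (y + st.1 *: v + st.2 *: w))].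
Proof.
move=> h0 df.
have hh : 0 <= h <= h by rewrite lexx ltW.
have h00 : (0 : R) <= 0 <= h by rewrite lexx ltW.
pose g z := f (z + h *: w) - f z.
have dg1 s : 0 <= s <= h -> differentiable (fun z => f (z + h *: w)) (y + s *: v).
  move=> sh; apply: (@differentiable_comp _ _ _ _ (fun z => z + h *: w) f).
    exact: differentiableD.
  by have [] := df s h sh hh.
have dg2 s : 0 <= s <= h -> differentiable f (y + s *: v).
  by move=> sh; have [] := df s 0 sh h00; rewrite scale0r addr0.
have [|s sh E1] := @mvt_line g y v h h0.
  by move=> s sh; apply: differentiableB; [exact: dg1|exact: dg2].
have sh' : 0 <= s <= h by case/andP: sh => a b; rewrite !ltW.
have [|t th E2] := @mvt_line ('D_v f) (y + s *: v) w h h0.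
  by move=> t th; have [] := df s t sh' th.
exists (s, t); split => //=.
rewrite -[RHS]/(h * _) -E2 /=.
have dD : 'D_v g (y + s *: v) =
    'D_v f (y + s *: v + h *: w) - 'D_v f (y + s *: v).
  rewrite deriveB; [|by apply/diff_derivable/dg1|by apply/diff_derivable/dg2].
  congr (_ - _).
  have dt : is_diff (y + s *: v) (fun z => z + h *: w) (fun z => z + 0).
    exact: is_diffD.
  have := derive_chain v (@ex_diff _ _ _ _ _ _ _ dt) (df s h sh' hh).1.
  have -> : 'D_v (fun z : V => z + h *: w) (y + s *: v) = v.
    rewrite deriveE; last exact: (@ex_diff _ _ _ _ _ _ _ dt).
    by rewrite (@diff_val _ _ _ _ _ _ _ dt) addr0.
  by [].
by rewrite -dD -E1 /g; ring.
Qed.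

(** Fitted to [Schwarz], where the mean value theorem produces two different
    intermediate points, one for each order of derivation. *)
Lemma eq_from_near (f g : V -> R) x :
  {for x, continuous f} -> {for x, continuous g} ->
  (forall r : R, 0 < r -> exists z z', [/\ ball x r z, ball x r z' & f z = g z']) ->
  f x = g x.
Proof.
move=> cf cg H; apply/eqP; rewrite -subr_eq0 -normr_le0.
apply/ler_addgt0Pr => e e0; rewrite add0r.
have e2 : 0 < e / 2 by rewrite divr_gt0.
move/cvgrPdist_lt/(_ _ e2) : cf => cf; move/cvgrPdist_lt/(_ _ e2) : cg => cg.
have N : nbhs x ((fun t => `|f x - f t| < e / 2) `&`
    (fun t => `|g x - g t| < e / 2)) by exact: filterI.
have [r /= r0 Hr] := (nbhs_ballP _ _).1 N.
have [z [z' [/Hr[Bf _] /Hr[_ Bg] E]]] := H r r0.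
rewrite -(subrKA (f z)) (le_trans (ler_normD _ _))// (splitr e) lerD// ltW//.
by rewrite E distrC.
Qed.

Lemma Schwarz (f : V -> R) (O : set V) x v w : open O -> Ck 2 O f -> O x ->
  'D_v ('D_w f) x = 'D_w ('D_v f) x.
Proof.
move=> oO Cf Ox; apply: (@eq_from_near ('D_v ('D_w f)) ('D_w ('D_v f))).
- exact: (Ck_continuous oO (Ck_derive v (Ck_derive w Cf)) Ox).
- exact: (Ck_continuous oO (Ck_derive w (Ck_derive v Cf)) Ox).
move=> r1 r10.
have [r2 /= r20 Hr2] := (nbhs_ballP _ _).1 (open_nbhs_nbhs (conj oO Ox)).
pose r := Num.min r1 r2; have r0 : 0 < r by rewrite lt_min r10 r20.
have Hr z : ball x r z -> O z.
  by move=> xz; apply: Hr2; apply: le_ball xz; rewrite ge_min lexx orbT.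
have Hr1 z : ball x r z -> ball x r1 z.
  by move=> xz; apply: le_ball xz; rewrite ge_min lexx.
(* The parallelogram with edges [h *: v] and [h *: w] lies in the ball. *)
pose h := r / (2 * (1 + `|v| + `|w|)).
have vw0 : 0 < 1 + `|v| + `|w| by rewrite -addrA ltr_pwDl// addr_ge0.
have h0 : 0 < h by rewrite divr_gt0// mulr_gt0.
have inb s t : 0 <= s <= h -> 0 <= t <= h -> ball x r (x + s *: v + t *: w).
  move=> /andP[s0 sh] /andP[t0 th];
      rewrite -ball_normE /ball_/= -addrA opprD addNKr normrN.
  apply: (@le_lt_trans _ _ (h * (`|v| + `|w|))).
    rewrite (le_trans (ler_normD _ _))// !normrZ !ger0_norm// mulrDr lerD//;
      exact: ler_wpM2r.
  rewrite /h -mulrA -[ltRHS]mulr1 ltr_pM2l// mulrC ltr_pdivrMr ?mulr_gt0// mul1r.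
  have := normr_ge0 v; have := normr_ge0 w; lra.
have inO s t : 0 <= s <= h -> 0 <= t <= h -> O (x + s *: v + t *: w).
  by move=> sh th; exact: Hr (inb s t sh th).
have dfl u s t : 0 <= s <= h -> 0 <= t <= h ->
    differentiable f (x + s *: v + t *: w) /\
    differentiable ('D_u f) (x + s *: v + t *: w).
  move=> sh th; split; first exact: Ck_diff Cf (inO s t sh th).
  exact: Ck_diff (Ck_derive u Cf) (inO s t sh th).
have lw (z : R) : 0 < z < h -> 0 <= z <= h by case/andP => *; rewrite !ltW.
have [[s t] /= [/lw sh /lw th E1]] := rectangle_mvt h0 (dfl v).
have [|[t' s'] /= [/lw th' /lw sh' E2]] := @rectangle_mvt f x w v h h0.
  by move=> s' t' s'h t'h; rewrite addrAC; exact: dfl.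
exists (x + t' *: w + s' *: v), (x + s *: v + t *: w); split.
- by apply: Hr1; rewrite addrAC; exact: inb.
- by apply: Hr1; exact: inb.
apply: (mulfI (lt0r_neq0 h0)); apply: (mulfI (lt0r_neq0 h0)).
rewrite -[LHS]E2 -[RHS]E1 [x + h *: w + _]addrAC.
have aux (p q r' u : R) : p - q - (r' - u) = p - r' - (q - u) by ring.
exact: aux.
Qed.

End MeanValue.

(** * A Gronwall lemma *)

Section Gronwall.
Context {R : realType}.

(** The function [w t * expR (- K * t)] is nonincreasing and starts from 0. *)
Lemma Gronwall_eq0 (w : R -> R) (d K : R) :
  (forall t, -d < t < d -> derivable w t 1) ->
  (forall t, 0 <= w t) -> w 0 = 0 ->
  (forall t, 0 <= t < d -> 'D_1 w t <= K * w t) ->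
  forall t, 0 <= t < d -> w t = 0.
Proof.
move=> dw w0 w00 Kw t /andP[t0 td].
pose g s := w s * expR (- K * s).
have de (s : R) : is_derive s 1 (fun s => expR (- K * s)) (- K * expR (- K * s)).
  have -> : (fun s => expR (- K * s)) = expR \o ( *%R (- K)) by [].
  apply: is_derive_eq.
  by rewrite !scaler1 /GRing.scale /= ?mulr1 mulrC.
have dg s : 0 <= s < d -> is_derive s 1 g (('D_1 w s - K * w s) * expR (- K * s)).
  move=> /andP[s0 sd].
  have dws : is_derive s 1 w ('D_1 w s).
    by apply: derivableP; apply: dw;
        rewrite sd andbT (lt_le_trans _ s0)// oppr_lt0 (le_lt_trans s0).
  apply: is_derive_eq; rewrite /GRing.scale /=; ring.
have [t_eq0|tn0] := eqVneq t 0; first by rewrite t_eq0.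
have tgt0 : 0 < t by rewrite lt_neqAle eq_sym tn0.
have [||c ct E] := @MVT _ g (fun s => ('D_1 w s - K * w s) * expR (- K * s)) 0 t tgt0.
- by move=> s; rewrite in_itv/= => /andP[s0 st]; apply: dg;
    rewrite ltW//= (lt_trans st).
- apply: continuous_in_subspaceT => s; rewrite inE/= in_itv/= => /andP[s0 st].
  apply/differentiable_continuous/derivable1_diffP.
  by have [] := dg s; rewrite ?s0 ?(le_lt_trans st).
have : g t <= 0.
  move: ct; rewrite in_itv/= => /andP[c0 ct].
  have -> : g t = g t - g 0 by rewrite /g w00 mul0r subr0.
  rewrite E subr0 -mulrA mulr_le0_ge0// ?mulr_ge0 ?expR_ge0//.
  by rewrite subr_le0 Kw// ltW//= (lt_trans ct).
rewrite /g pmulr_lle0 ?expR_gt0// => wt; apply/eqP.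
by rewrite eq_le wt w0.
Qed.

End Gronwall.

(** * The Picard-Lindeloef theorem *)

Section Picard.
Context {R : realType}.

Lemma rV_norm_leP m (x : 'rV[R]_m) e : 0 <= e ->
  (`|x| <= e) <-> (forall j, `|x 0 j| <= e).
Proof.
move=> e0; split=> [xe j|xe].
  by apply: le_trans xe; rewrite [leRHS]/Num.Def.normr/= mx_normrE;
      exact: (le_bigmax _ _ (0, j)).
rewrite /Num.Def.normr/= mx_normrE (bigmax_le _ e0)//= => -[i j] _ /=.
by rewrite (ord1 i).
Qed.

Lemma rV_entry_le m (h : 'rV[R]_m) i : `|h 0 i| <= `|h|.
Proof. by have /(rV_norm_leP _ (normr_ge0 h))/(_ i) := lexx `|h|. Qed.

(** The integral starts at -1, so that the primitive is differentiable on both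
    sides of the initial time 0 of a differential equation. Continuity is
    assumed inside the conclusion to allow a primitive to be chosen for all
    functions at once. *)
Lemma primitive_exists (g : R -> R) : exists G : R -> R, continuous g ->
  G 0 = 0 /\ forall t : R, -1 < t -> is_derive t 1 G (g t).
Proof.
have [cg|] := pselect (continuous g); last by exists (cst 0).
pose F (y : R) : R := (\int[lebesgue_measure]_(t in [set` `[-1, y]]) (g t))%R.
have dF (t : R) : -1 < t -> is_derive t 1 F (g t).
  move=> t1; have tt : t < t + 1 by rewrite ltrDl.
  have ig : lebesgue_measure.-integrable `[-1, t + 1] (EFin \o g).
    apply: continuous_compact_integrable; first exact: segment_compact.
    exact: continuous_subspaceT.
  have [dF EF] := continuous_FTC1_closed tt ig t1 (cg t).
  by apply: DeriveDef; [exact: dF|rewrite -derive1E].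
exists (fun t => F t - F 0) => _; split; first by rewrite subrr.
move=> t /dF dFt; rewrite -[g t]subr0; exact: is_deriveB.
Qed.

(** The segments of centre [u k] and radius [2 * C / 2 ^+ k] are nested; the
    supremum of their left ends lies in all of them. *)
Lemma geometric_limit (u : nat -> R) (C : R) :
  (forall k, `|u k.+1 - u k| <= C / 2 ^+ k) ->
  exists l, forall k, `|l - u k| <= 2 * C / 2 ^+ k.
Proof.
move=> uC.
pose a k := u k - 2 * C / 2 ^+ k; pose b k := u k + 2 * C / 2 ^+ k.
have p2 k : 0 < (2 : R) ^+ k by rewrite exprn_gt0.
have C0 : 0 <= C by have := uC 0%N; rewrite expr0 divr1; exact: le_trans.
have hS k : 2 * C / 2 ^+ k.+1 = C / 2 ^+ k.
  by rewrite exprS invfM mulrA [2 * C]mulrC mulfK.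
have twoS k : 2 * C / 2 ^+ k = C / 2 ^+ k + C / 2 ^+ k.
  by rewrite -mulrA mulr_natl mulr2n.
have aS k : a k <= a k.+1.
  by have := uC k; rewrite /a hS twoS ler_norml; lra.
have bS k : b k.+1 <= b k.
  by have := uC k; rewrite /b hS twoS ler_norml; lra.
have am i j : (i <= j)%N -> a i <= a j.
  by move=> /subnK <-; elim: (j - i)%N => // m IH; rewrite addSn (le_trans IH).
have bm i j : (i <= j)%N -> b j <= b i.
  by move=> /subnK <-; elim: (j - i)%N => // m IH; rewrite addSn (le_trans _ IH).
have ab i j : a i <= b j.
  apply: (@le_trans _ _ (a (maxn i j))); first by rewrite am// leq_maxl.
  apply: (@le_trans _ _ (b (maxn i j))); last by rewrite bm// leq_maxr.
  rewrite /a /b; have : 0 <= 2 * C / 2 ^+ maxn i j by rewrite !mulr_ge0// invr_ge0 ltW.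
  lra.
exists (sup (range a)) => k.
have au : a k <= sup (range a).
  by apply: sup_upper_bound;
      [split; [exists (a 0%N), 0%N|exists (b 0%N) => _ [j _ <-]]|exists k].
have ub : sup (range a) <= b k.
  by apply: ge_sup => [|_ [j _ <-]]; [exists (a 0%N), 0%N|].
by rewrite ler_norml; move: au ub; rewrite /a /b; lra.
Qed.

(** The retraction of the line onto the segment [[a, b]]. It is 1-Lipschitz,
    so composing with it extends to the whole space what is only given or only
    controlled on a segment or a box. *)
Definition clip (a b t : R) := Num.max a (Num.min b t).

Lemma clip_in a b t : a <= b -> a <= clip a b t <= b.
Proof.
by move=> ab; rewrite /clip le_max lexx /= ge_max ab /= ge_min lexx.
Qed.

Lemma clip_id a b t : a <= t <= b -> clip a b t = t.
Proof. by move=> /andP[at_ tb]; rewrite /clip min_r// max_r. Qed.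

Lemma clip_lip a b s t : `|clip a b s - clip a b t| <= `|s - t|.
Proof.
rewrite /clip /Num.max /Num.min.
have h1 := ler_norm (s - t).
have h3 : t - s <= `|s - t| by rewrite distrC ler_norm.
by repeat case: ifPn; rewrite -?leNgt => *; rewrite ler_norml; apply/andP; split; lra.
Qed.

Lemma clip_continuous a b : continuous (clip a b).
Proof.
move=> t; apply/cvgrPdist_lt => e e0; near=> s.
apply: le_lt_trans (clip_lip _ _ _ _) _.
by near: s; apply: cvgr_dist_lt.
Unshelve. all: by end_near. Qed.

(** The estimate of an integral over a segment of length at most [d], which
    makes the Picard operator a contraction. *)
Lemma clip_primitive_le (d e : R) (h dh : R -> R) : 0 <= d < 1 ->
  h 0 = 0 -> (forall t : R, -1 < t -> is_derive t 1 h (dh t)) ->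
  (forall t, `|dh t| <= e) -> forall t, `|h (clip (- d) d t)| <= d * e.
Proof.
move=> /andP[d0 d1] h0 Dh dhe t.
have /andP[ct0 ct1] := clip_in t (ge0_cp d0).2.
set c := clip _ _ t in ct0 ct1 *.
have cont a b : -1 < a -> {within `[a, b], continuous h}.
  move=> a1; apply: continuous_in_subspaceT => s; rewrite inE/= in_itv/= => /andP[sa _].
  apply/differentiable_continuous/derivable1_diffP.
  by have [] := Dh s (lt_le_trans a1 sa).
have e0 : 0 <= e by exact: le_trans (dhe 0).
have [c0|c0] := leP 0 c.
  have [||x _] := @MVT_segment _ h dh 0 c c0; last first.
  - rewrite h0 !subr0 => ->; rewrite normrM mulrC ler_pM//.
    by rewrite ger0_norm.
  - by apply: cont; rewrite oppr_lt0.
  - by move=> x; rewrite in_itv/= => /andP[x0 _]; apply: Dh;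
      rewrite (lt_trans _ x0)// oppr_lt0.
have [||x _] := @MVT_segment _ h dh c 0 (ltW c0); last first.
- rewrite h0 !sub0r mulrN => /oppr_inj ->; rewrite normrM mulrC ler_pM//.
  by rewrite ler0_norm ?(ltW c0)// lerNl.
- by apply: cont; rewrite (lt_le_trans _ ct0)// ltrN2.
- move=> x; rewrite in_itv/= => /andP[x0 _]; apply: Dh.
  by rewrite (lt_trans _ x0)// (lt_le_trans _ ct0)// ltrN2.
Qed.

Lemma lipschitz_bound_continuous (V W : normedModType R) (f : V -> W) L :
  0 < L -> (forall x y, `|f x - f y| <= L * `|x - y|) -> continuous f.
Proof.
move=> L0 fL x; apply/cvgrPdist_lt => e e0.
apply: filterS (nbhsx_ballx x _ (divr_gt0 e0 L0)) => y.
rewrite -ball_normE /= => xy.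
by rewrite (le_lt_trans (fL _ _))// mulrC -ltr_pdivlMr.
Qed.

Lemma continuous_entry (T : topologicalType) m n (f : T -> 'M[R]_(m, n)) i j t :
  {for t, continuous f} -> {for t, continuous (fun s => f s i j)}.
Proof.
by move=> cf; exact: (continuous_comp cf (@coord_continuous R m n i j (f t))).
Qed.

(** Picard iteration on [[- d, d]], where [d * L <= 1 / 2] makes the integral
    operator halve uniform distances. Time is clipped to this segment, so that
    all iterates are functions continuous on the whole line; their limit is
    taken entry by entry. *)
Theorem Picard_Lindelof m (f : 'rV[R]_m -> 'rV[R]_m) (L : R) (x0 : 'rV[R]_m) :
  0 < L -> (forall x y, `|f x - f y| <= L * `|x - y|) ->
  exists2 d : R, 0 < d & exists2 X : R -> 'rV[R]_m, X 0 = x0 &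
    forall t : R, - d < t < d -> is_derive t 1 X (f (X t)).
Proof.
move=> L0 fL.
have [P HP] := choice primitive_exists.
have P0 (g : R -> R) : continuous g -> P g 0 = 0 by move=> /HP[].
have dP (g : R -> R) (t : R) : continuous g -> -1 < t -> is_derive t 1 (P g) (g t).
  by move=> /HP[_]; apply.
(* The first bound keeps [- d] above -1, where the primitives are defined; the
   second gives the contraction factor 1/2. *)
pose d := Num.min 2^-1 ((2 * L)^-1).
have d0 : 0 < d by rewrite lt_min !invr_gt0 ltr0n /= mulr_gt0.
have d1 : 0 <= d < 1.
  rewrite ltW//= gt_min; apply/orP; left.
  by rewrite invf_lt1// ltr1n.
have dL : d * L <= 2^-1.
  have : d <= (2 * L)^-1 by rewrite ge_min lexx orbT.
  by rewrite -(ler_pM2r L0) invfM mulfVK ?gt_eqF.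
pose c := clip (- d) d.
have cd t : -1 < c t.
  have /andP[+ _] := clip_in t (ge0_cp (ltW d0)).2.
  by apply: lt_le_trans; rewrite ltrN2; case/andP: d1.
pose Phi (X : R -> 'rV[R]_m) t := x0 + \row_j P (fun s => f (X s) 0 j) (c t).
have fc : continuous f by exact: lipschitz_bound_continuous L0 fL.
have gc (X : R -> 'rV[R]_m) j : continuous X -> continuous (fun s => f (X s) 0 j).
  move=> cX t.
  have h := (@continuous_comp _ _ _ X f t (cX t) (fc (X t))).
  exact (@continuous_entry _ _ _ _ 0 j _ h).
have PhiB (X : R -> 'rV[R]_m) e : continuous X -> 0 <= e ->
    (forall t, `|f (X t)| <= e) ->
    forall t, `|Phi X t - x0| <= d * e.
  move=> cX e0 Xe t; rewrite /Phi addrC addKr.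
  apply/rV_norm_leP; first by rewrite mulr_ge0// ltW.
  move=> j; rewrite mxE; apply: (@clip_primitive_le d e (P (fun s => f (X s) 0 j))
      (fun s => f (X s) 0 j)) => //.
  - exact/P0/gc.
  - by move=> s s1; apply: dP => //; exact: gc.
  - by move=> s; have /(rV_norm_leP _ e0)/(_ j) := Xe s.
have PhiL (X Y : R -> 'rV[R]_m) e : continuous X -> continuous Y -> 0 <= e ->
    (forall t, `|X t - Y t| <= e) -> forall t, `|Phi X t - Phi Y t| <= e / 2.
  move=> cX cY e0 XYe t.
  apply: (@le_trans _ _ (d * (L * e))); last first.
    by rewrite mulrA mulrC ler_wpM2l.
  rewrite /Phi opprD addrACA subrr add0r.
  apply/rV_norm_leP; first by rewrite !mulr_ge0// ltW.
  move=> j; rewrite !mxE.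
  apply: (@clip_primitive_le d (L * e)
      (P (fun s => f (X s) 0 j) \- P (fun s => f (Y s) 0 j))
      (fun s => f (X s) 0 j - f (Y s) 0 j)) => //.
  - by rewrite /= !P0 ?subrr//; exact: gc.
  - by move=> s s1; apply: is_deriveB; apply: dP => //; exact: gc.
  - have Le0 : 0 <= L * e by rewrite mulr_ge0// ltW.
    move=> s; have := le_trans (fL (X s) (Y s)) (ler_wpM2l (ltW L0) (XYe s)).
    by move=> /(rV_norm_leP _ Le0)/(_ j); rewrite !mxE.
have cPhi (X : R -> 'rV[R]_m) : continuous X -> continuous (Phi X).
  move=> cX t; apply/cvgrPdist_le => e e0.
  have : \forall s \near t, forall j : 'I_m,
     `|P (fun s => f (X s) 0 j) (c t) - P (fun s => f (X s) 0 j) (c s)| <= e.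
    apply: (@filter_forall R _ (fun j s =>
      `|P (fun s => f (X s) 0 j) (c t) - P (fun s => f (X s) 0 j) (c s)| <= e)
      (nbhs t)) => j.
    have : {for t, continuous (P (fun s => f (X s) 0 j) \o c)}.
      apply: continuous_comp; first exact: clip_continuous.
      apply/differentiable_continuous/derivable1_diffP.
      by have [] := dP _ _ (gc X j cX) (cd t).
    by move=> /cvgrPdist_le/(_ _ e0).
  apply: filterS => s H; rewrite /Phi opprD addrACA subrr add0r.
  by apply/(rV_norm_leP _ (ltW e0)) => j; rewrite !mxE; exact: H.
pose Xk k := iter k Phi (cst x0).
have cXk k : continuous (Xk k).
  by elim: k => [|k IH]; [exact: cst_continuous|exact: cPhi].
pose C := d * `|f x0|.
have C0 : 0 <= C by rewrite mulr_ge0// ltW.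
have geo_ge0 k : 0 <= 2 * C / 2 ^+ k.
  by apply: divr_ge0; [exact: mulr_ge0|exact: exprn_ge0].
have dXk k t : `|Xk k.+1 t - Xk k t| <= C / 2 ^+ k.
  elim: k t => [|k IH] t.
    by rewrite expr0 divr1; apply: (PhiB (cst x0)) => //; exact: cst_continuous.
  rewrite exprSr invfM mulrA; apply: (PhiL (Xk k.+1) (Xk k));
      [exact: cXk|exact: cXk| |exact: IH].
  by rewrite divr_ge0// exprn_ge0.
have lims t j : exists l, forall k, `|l - Xk k t 0 j| <= 2 * C / 2 ^+ k.
  apply: geometric_limit => k;
      have Ck0 : 0 <= C / 2 ^+ k by rewrite divr_ge0// exprn_ge0.
  by have /(rV_norm_leP _ Ck0)/(_ j) := dXk k t; rewrite !mxE.
have [X0 HX0] := choice (fun tj : R * 'I_m => lims tj.1 tj.2).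
pose X t := \row_j X0 (t, j) : 'rV[R]_m.
have Xlim k t : `|X t - Xk k t| <= 2 * C / 2 ^+ k.
  have h := geo_ge0 k.
  by apply/(rV_norm_leP _ h) => j; rewrite !mxE; exact: (HX0 (t, j)).
have small (e : R) : 0 < e -> exists k, 2 * C / 2 ^+ k < e.
  move=> e0.
  have h : geometric (2 * C) (2^-1 : R) @ \oo --> 0.
    by apply: cvg_geometric; rewrite ger0_norm ?invr_ge0// invf_lt1 ?ltr1n.
  have /cvgrPdist_lt/(_ _ e0)[N _ /(_ N (leqnn N))] := h.
  rewrite /= sub0r normrN exprVn ger0_norm; last exact: geo_ge0.
  by move=> hN; exists N.
have cX : continuous X.
  move=> t; apply/cvgrPdist_lt => e e0.
  have e3 : 0 < e / 3 by rewrite divr_gt0.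
  have [k hk] := small _ e3.
  have := cXk k t; move=> /cvgrPdist_lt/(_ _ e3); apply: filterS => s hs.
  have h1 := le_lt_trans (Xlim k t) hk.
  have h2 := le_lt_trans (Xlim k s) hk; rewrite distrC in h2.
  rewrite -(subrKA (Xk k t)) (le_lt_trans (ler_normD _ _))//.
  rewrite -(subrKA (Xk k s) (Xk k t)).
  have := ler_normD (Xk k t - Xk k s) (Xk k s - X s); lra.
have XPhi t : X t = Phi X t.
  apply/eqP; rewrite -subr_eq0 -normr_le0; apply/ler_addgt0Pr => e e0; rewrite add0r.
  have e2 : 0 < e / 2 by rewrite divr_gt0.
  have [k hk] := small _ e2.
  have h1 := Xlim k.+1 t.
  have h2 := @PhiL X (Xk k) _ cX (cXk k) _ (Xlim k) t.
  rewrite -(subrKA (Xk k.+1 t)) (le_trans (ler_normD _ _))//.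
  have {}h2 : `|Xk k.+1 t - Phi X t| <= 2 * C / 2 ^+ k / 2.
    by rewrite distrC h2//; exact: geo_ge0.
  have h3 : 2 * C / 2 ^+ k.+1 = 2 * C / 2 ^+ k / 2 by rewrite exprSr invfM mulrA.
  rewrite h3 in h1; set q := 2 * C / 2 ^+ k in hk h1 h2; lra.
exists d => //; exists X.
  rewrite XPhi /Phi /c clip_id; last by rewrite oppr_le0 ltW.
  by apply/rowP => j; rewrite !mxE P0 ?addr0//; exact: gc.
move=> t /andP[td1 td2].
have near_id : \near t, (fun t => x0 + \row_j P (fun s => f (X s) 0 j) t) t = X t.
  have : \forall s \near t, s \in `]-d, d[.
    by apply: near_in_itvoo; rewrite in_itv/= td1.
  apply: filterS => s; rewrite in_itv/= => /andP[s1 s2].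
  by rewrite XPhi /Phi /c clip_id// !ltW.
apply: (near_eq_is_derive near_id).
have t1 : -1 < t by rewrite (lt_trans _ td1)// ltrN2; case/andP: d1.
have DP j := dP _ t (gc X j cX) t1.
have dR : derivable (fun t => \row_j P (fun s => f (X s) 0 j) t : 'rV[R]_m) t 1.
  apply/derivable_mxP => i j.
  rewrite (_ : (fun _ => _) = P (fun s => f (X s) 0 j)); last first.
    by apply/funext => s; rewrite mxE.
  exact: (@ex_derive _ _ _ _ _ _ _ (DP j)).
rewrite -[f (X t)]add0r; apply: is_deriveD; apply: DeriveDef => //.
rewrite derive_mx//; apply/rowP => j; rewrite mxE.
rewrite (_ : (fun _ => _) = P (fun s => f (X s) 0 j)); last first.
  by apply/funext => s; rewrite mxE.
exact: (@derive_val _ _ _ _ _ _ _ (DP j)).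
Qed.

End Picard.

(** * Unconditional sums *)

Section UnconditionalSums.
Context {R : realType} {T : choiceType}.
Implicit Types (f g p : T -> R) (J : seq T).

Definition abs_bounded f (C : R) :=
  forall J, uniq J -> \sum_(x <- J) `|f x| <= C.

(** Convergence along the finite subfamilies ordered by inclusion. Unlike the
    difference of two extended sums in [has_sum], it is visibly linear; for
    absolutely bounded families the two notions agree ([has_sumP],
    [usum_has_sum]). *)
Definition usum f (s : R) := forall e : R, 0 < e -> exists2 J0 : seq T, uniq J0 &
  forall J, uniq J -> {subset J0 <= J} -> `|\sum_(x <- J) f x - s| <= e.

Lemma sum_subset_le p J0 J : (forall x, 0 <= p x) -> uniq J0 -> uniq J ->
  {subset J0 <= J} -> \sum_(x <- J0) p x <= \sum_(x <- J) p x.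
Proof.
move=> p0 u0 u s; rewrite [leRHS](bigID (mem J0))/=.
rewrite -[leLHS]addr0 lerD ?sumr_ge0// -[in leRHS]big_filter.
rewrite (perm_big [seq x <- J | x \in J0])//; apply: uniq_perm => //.
  exact: filter_uniq.
by move=> x; rewrite mem_filter; case xJ : (x \in J0) => //=; rewrite (s _ xJ).
Qed.

Lemma esum_seq_ub p S : (forall x, 0 <= p x) ->
  (\esum_(x in [set: T]) (p x)%:E <= S%:E)%E <->
  forall J, uniq J -> \sum_(x <- J) p x <= S.
Proof.
move=> p0; split=> [h J uJ|h].
  rewrite -lee_fin; apply: le_trans h; apply: esum_ge.
  exists [set` J]; first by split => //; exact: finite_seq.
  by rewrite -fsbig_seq// sumEFin.
apply: ge_ereal_sup => _ [A [fA _] <-].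
by rewrite fsbig_finite//= sumEFin lee_fin h.
Qed.

Lemma nonneg_sum p C : (forall x, 0 <= p x) ->
  (forall J, uniq J -> \sum_(x <- J) p x <= C) ->
  exists2 S, (\esum_(x in [set: T]) (p x)%:E = S%:E)%E & usum p S.
Proof.
move=> p0 pC; have eC := (esum_seq_ub C p0).2 pC.
have e0 : (0 <= \esum_(x in [set: T]) (p x)%:E)%E.
  by apply: esum_ge0 => x _; rewrite lee_fin.
have [S ES] : exists S, (\esum_(x in [set: T]) (p x)%:E = S%:E)%E.
  exists (fine (\esum_(x in [set: T]) (p x)%:E)); rewrite fineK//.
  by rewrite fin_numElt (lt_le_trans _ e0)// (le_lt_trans eC)// ltry.
exists S => // e egt0.
have [J0 uJ0 hJ0] : exists2 J0, uniq J0 & S - e <= \sum_(x <- J0) p x.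
  apply: contrapT => h.
  have : (\esum_(x in [set: T]) (p x)%:E <= (S - e)%:E)%E.
    apply/esum_seq_ub => // J uJ; rewrite leNgt; apply/negP => lt.
    by apply: h; exists J => //; exact: ltW.
  by rewrite ES lee_fin; lra.
exists J0 => // J uJ sJ; have := (esum_seq_ub S p0).1 _ J uJ.
rewrite ES lexx => /(_ isT) JS.
by have := sum_subset_le p0 uJ0 uJ sJ; rewrite ler_norml; lra.
Qed.

Lemma usumD f g s t : usum f s -> usum g t -> usum (fun x => f x + g x) (s + t).
Proof.
move=> fs gt e e0; have e2 : 0 < e / 2 by rewrite divr_gt0.
have [J1 u1 h1] := fs _ e2; have [J2 u2 h2] := gt _ e2.
exists (undup (J1 ++ J2)); first exact: undup_uniq.
move=> J uJ sJ; rewrite big_split/= opprD addrACA (le_trans (ler_normD _ _))//.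
by rewrite (splitr e) lerD//; [apply: h1|apply: h2] => // x xJ; apply: sJ;
  rewrite mem_undup mem_cat xJ ?orbT.
Qed.

Lemma usumZ f s a : usum f s -> usum (fun x => a * f x) (a * s).
Proof.
move=> fs e e0; have a1 : 0 < `|a| + 1 by rewrite ltr_wpDl.
have [J0 u0 h0] := fs (e / (`|a| + 1)) (divr_gt0 e0 a1).
exists J0 => // J uJ sJ; rewrite -mulr_sumr -mulrBr normrM.
apply: (@le_trans _ _ ((`|a| + 1) * (e / (`|a| + 1)))).
  by apply: ler_pM => //; [rewrite lerDl|exact: h0].
by rewrite mulrC divfK ?gt_eqF.
Qed.

Lemma usumB f g s t : usum f s -> usum g t -> usum (fun x => f x - g x) (s - t).
Proof.
move=> fs /(@usumZ _ _ (-1)) gt; have := usumD fs gt.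
by rewrite mulN1r; under [X in usum X]eq_fun do rewrite mulN1r.
Qed.

Lemma usum_bigsum (I : Type) (r : seq I) (F : I -> T -> R) (s : I -> R) :
  (forall i, usum (F i) (s i)) ->
  usum (fun x => \sum_(i <- r) F i x) (\sum_(i <- r) s i).
Proof.
move=> Fs; elim: r => [|i r IH].
  under [X in usum X]eq_fun do rewrite big_nil.
  rewrite big_nil => e e0; exists [::] => // J _ _.
  by rewrite big1// subr0 normr0 ltW.
under [X in usum X]eq_fun do rewrite big_cons.
by rewrite big_cons; exact: usumD.
Qed.

Lemma usum_unique f s t : usum f s -> usum f t -> s = t.
Proof.
move=> fs ft; apply/eqP; rewrite -subr_eq0 -normr_le0.
apply/ler_addgt0Pr => e e0; rewrite add0r; have e2 : 0 < e / 2 by rewrite divr_gt0.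
have [J1 u1 h1] := fs _ e2; have [J2 u2 h2] := ft _ e2.
pose J := undup (J1 ++ J2).
have uJ : uniq J by exact: undup_uniq.
have {}h1 : `|\sum_(x <- J) f x - s| <= e / 2.
  by apply: h1 => // x xJ; rewrite mem_undup mem_cat xJ.
have {}h2 : `|\sum_(x <- J) f x - t| <= e / 2.
  by apply: h2 => // x xJ; rewrite mem_undup mem_cat xJ orbT.
rewrite distrC in h1.
rewrite -(subrKA (\sum_(x <- J) f x)) (le_trans (ler_normD _ _))//.
by rewrite (splitr e) lerD.
Qed.

Lemma usum_le f s C : usum f s -> abs_bounded f C -> `|s| <= C.
Proof.
move=> fs fC; apply/ler_addgt0Pr => e e0; have [J uJ h] := fs _ e0.
have {}h := h J uJ (fun _ => id); rewrite distrC in h.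
rewrite -(subrK (\sum_(x <- J) f x) s) addrC (le_trans (ler_normD _ _))//.
by rewrite lerD// (le_trans (ler_norm_sum _ _ _))// fC.
Qed.

(** Positive and negative parts are summed separately. *)
Lemma has_sum_exists f C : abs_bounded f C -> exists2 s, has_sum f s & usum f s.
Proof.
move=> fC.
pose p x := Num.max (f x) 0; pose q x := Num.max (- f x) 0.
have p0 x : 0 <= p x by rewrite le_max lexx orbT.
have q0 x : 0 <= q x by rewrite le_max lexx orbT.
have pf x : p x <= `|f x| by rewrite ge_max normr_ge0 ler_norm.
have qf x : q x <= `|f x| by rewrite ge_max normr_ge0 -normrN ler_norm.
have pq : f = (fun x => p x - q x).
  apply/funext => x; rewrite /p /q /Num.max.
  by repeat case: ifPn; rewrite -?leNgt; lra.
have [S ES Sp] : exists2 S, (\esum_(x in [set: T]) (p x)%:E = S%:E)%E & usum p S.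
  by apply: (@nonneg_sum _ C) => // J /fC; apply: le_trans; exact: ler_sum.
have [S' ES' Sq] : exists2 S, (\esum_(x in [set: T]) (q x)%:E = S%:E)%E & usum q S.
  by apply: (@nonneg_sum _ C) => // J /fC; apply: le_trans; exact: ler_sum.
exists (S - S'); last by rewrite pq; exact: usumB.
split.
  rewrite /summable; apply: (@le_lt_trans _ _ C%:E); last exact: ltry.
  by apply/(esum_seq_ub C (fun x => normr_ge0 (f x))).
rewrite EFinB -ES -ES'; congr (_ - _)%E; apply: eq_esum => x _.
  by rewrite funeposE /= /p EFin_max.
by rewrite funenegE /= /q EFin_max.
Qed.

Lemma has_sumP f s : has_sum f s -> (exists C, abs_bounded f C) /\ usum f s.
Proof.
move=> [fsum Es].
have [C fC] : exists C, abs_bounded f C.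
  move: fsum; rewrite summableE => /fineK E.
  exists (fine (\esum_(x in [set: T]) `|(EFin \o f) x|)%E) => J uJ.
  by move: J uJ; apply/(esum_seq_ub _ (fun x => normr_ge0 (f x))); rewrite E.
split; first by exists C.
have [s' [_ Es'] us'] := has_sum_exists fC.
by suff -> : s = s' by []; apply: EFin_inj; rewrite -Es -Es'.
Qed.

Lemma usum_has_sum f s C : abs_bounded f C -> usum f s -> has_sum f s.
Proof.
by move=> fC fs; have [s' h /usum_unique /(_ fs) <-] := has_sum_exists fC.
Qed.

Lemma abs_bounded_le f g C : (forall x, `|f x| <= g x) ->
  (forall J, uniq J -> \sum_(x <- J) g x <= C) -> abs_bounded f C.
Proof. by move=> fg gC J /gC; apply: le_trans; exact: ler_sum. Qed.

(** The support of [f] lies in the range of [h]. For power series [h] raises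
    one exponent, and misses exactly the terms killed by the corresponding
    derivative. *)
Lemma usum_reindex f s (h k : T -> T) : cancel h k ->
  (forall x, h (k x) != x -> f x = 0) -> usum f s -> usum (f \o h) s.
Proof.
move=> hk f0 fs e e0; have [J0 u0 h0] := fs _ e0.
exists (undup [seq k x | x <- J0]); first exact: undup_uniq.
move=> J uJ sJ; rewrite (_ : \sum_(x <- J) (f \o h) x = \sum_(x <- map h J) f x);
    last by rewrite big_map.
have uhJ : uniq (map h J) by rewrite map_inj_uniq//; exact: can_inj hk.
pose J1 := map h J ++ [seq x <- J0 | x \notin map h J].
have uJ1 : uniq J1.
  rewrite cat_uniq uhJ filter_uniq// andbT; apply/hasPn => x.
  by rewrite mem_filter => /andP[].
rewrite (_ : \sum_(x <- map h J) f x = \sum_(x <- J1) f x).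
  apply: h0 => // x xJ0; rewrite mem_cat mem_filter xJ0 andbT.
  by case: (x \in _).
rewrite big_cat/= [X in _ = _ + X]big_seq_cond [X in _ = _ + X]big1 ?addr0// => x.
rewrite mem_filter andbT => /andP[xh xJ0]; apply: f0; apply: contra xh => /eqP <-.
by apply: map_f; apply: sJ; rewrite mem_undup; exact: map_f.
Qed.

End UnconditionalSums.

(** * First-order expansion of monomials *)

Section Monomials.
Context {R : realType}.

(** A first-order expansion with bounds on its three terms: [A] is the value
    at a point, [A'] the value at a point displaced by a distance proportional
    to [t], and [dA] the linear part of the difference. The sum [a + b + g] of
    the three bounds is what multiplies under products ([taylor1M]); so the
    remainder for a monomial is bounded by a monomial, with no factor growing
    with the degree. *)
Definition taylor1 (t c A A' dA : R) := exists a b g : R,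
  [/\ [/\ 0 <= a, 0 <= b & 0 <= g], `|A| <= a, `|dA| <= t * b,
      `|A' - A - dA| <= t ^+ 2 * g & a + b + g <= c].

Lemma taylor1_1 t : taylor1 t 1 1 1 0.
Proof.
exists 1, 0, 0; split=> //; rewrite ?normr1 ?normr0 ?mulr0 ?addr0//.
by rewrite !subr0 subrr normr0.
Qed.

Lemma taylor1_linear t r d y h : 0 <= d -> `|y| <= r - d -> `|h| <= t * d ->
  taylor1 t r y (y + h) h.
Proof.
move=> d0 yr ht; exists `|y|, d, 0; split=> //.
- by rewrite [y + h]addrC addrK subrr normr0 mulr0.
- by rewrite addr0; move: yr; lra.
Qed.

(** In the product of the two expansions the terms of order 0 and 1 are
    bounded by [a1 * a2] and [t * (a1 * b2 + b1 * a2)]. As [t <= 1], all the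
    others are bounded by [t ^+ 2] times the remaining terms of
    [(a1 + b1 + g1) * (a2 + b2 + g2)]. *)
Lemma taylor1M t c1 c2 A A' dA B B' dB : 0 <= t <= 1 ->
  taylor1 t c1 A A' dA -> taylor1 t c2 B B' dB ->
  taylor1 t (c1 * c2) (A * B) (A' * B') (dA * B + A * dB).
Proof.
move=> /andP[t0 t1] [a1 [b1 [g1 [[a10 b10 g10] Aa dAb Rg1 s1]]]]
  [a2 [b2 [g2 [[a20 b20 g20] Ba dBb Rg2 s2]]]].
have t2t : t ^+ 2 <= t by rewrite expr2 ler_piMr.
have t21 : t ^+ 2 <= 1 by exact: le_trans t1.
have t20 : 0 <= t ^+ 2 by exact: sqr_ge0.
exists (a1 * a2), (a1 * b2 + b1 * a2),
  (b1 * b2 + g1 * (a2 + b2 + g2) + (a1 + b1) * g2); split.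
- by split; rewrite ?addr_ge0 ?mulr_ge0 ?addr_ge0.
- by rewrite normrM ler_pM.
- apply: (le_trans (ler_normD _ _)); rewrite !normrM mulrDr [leRHS]addrC lerD//.
    by rewrite mulrA ler_pM.
  by rewrite mulrCA ler_pM.
- have -> : A' * B' - A * B - (dA * B + A * dB) =
     dA * dB + (A' - A - dA) * B' + (A + dA) * (B' - B - dB) by ring.
  have B'b : `|B'| <= a2 + b2 + g2.
    have -> : B' = B + dB + (B' - B - dB) by ring.
    rewrite (le_trans (ler_normD _ _))// lerD//.
      rewrite (le_trans (ler_normD _ _))// lerD// (le_trans dBb)//.
      by rewrite ler_piMl.
    by rewrite (le_trans Rg2)// ler_piMl.
  rewrite (le_trans (ler_normD _ _))// [leRHS]mulrDr lerD//.
    rewrite (le_trans (ler_normD _ _))// [leRHS]mulrDr lerD//.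
      by rewrite normrM expr2 mulrACA ler_pM.
    by rewrite normrM mulrA ler_pM.
  rewrite normrM mulrCA ler_pM//.
  rewrite (le_trans (ler_normD _ _))// lerD// (le_trans dAb)//.
  by rewrite ler_piMl.
- have -> : a1 * a2 + (a1 * b2 + b1 * a2) +
    (b1 * b2 + g1 * (a2 + b2 + g2) + (a1 + b1) * g2) =
    (a1 + b1 + g1) * (a2 + b2 + g2) by ring.
  by rewrite ler_pM ?addr_ge0.
Qed.

Lemma taylor1X t r d y h k : 0 <= t <= 1 -> 0 <= d -> `|y| <= r - d -> `|h| <= t * d ->
  taylor1 t (r ^+ k) (y ^+ k) ((y + h) ^+ k) (h * (k%:R * y ^+ k.-1)).
Proof.
move=> t01 d0 yr ht; elim: k => [|k IH].
  by rewrite !expr0 !mul0r mulr0; exact: taylor1_1.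
rewrite !exprS; have := taylor1M t01 (taylor1_linear d0 yr ht) IH.
congr (taylor1 _ _ _ _ _); case: k {IH} => [|k].
  by rewrite !mul0r !mulr0 addr0 mul1r.
by rewrite /= exprS -[k.+2]addn1 natrD; ring.
Qed.

Lemma taylor1_prod (I : eqType) (r : seq I) t (c A A' dA : I -> R) :
  0 <= t <= 1 -> uniq r ->
  (forall i, taylor1 t (c i) (A i) (A' i) (dA i)) ->
  taylor1 t (\prod_(i <- r) c i) (\prod_(i <- r) A i) (\prod_(i <- r) A' i)
    (\sum_(i <- r) dA i * \prod_(j <- r | j != i) A j).
Proof.
move=> t01 + H; elim: r => [_|i r IH /andP[ir ur]].
  by rewrite !big_nil; exact: taylor1_1.
have := taylor1M t01 (H i) (IH ur); rewrite !big_cons eqxx /=.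
congr (taylor1 _ _ _ _ _); congr (_ * _ + _).
  rewrite big_seq [RHS]big_seq_cond; apply: eq_bigl => j.
  by case jr : (j \in r) => //=; apply/esym/eqP => ji; rewrite -ji jr in ir.
rewrite mulr_sumr; apply: eq_big_seq => j jr.
rewrite big_cons; have -> : i != j by apply/eqP => ij; rewrite ij jr in ir.
by rewrite mulrCA.
Qed.

Variable m : nat.
Implicit Types (al be : {ffun 'I_m -> nat}) (y h : 'rV[R]_m).

Definition monomial al y : R := \prod_(i < m) y 0 i ^+ al i.

Definition shift_up (i : 'I_m) al : {ffun 'I_m -> nat} :=
    [ffun j => (al j + (j == i))%N].
Definition shift_down (i : 'I_m) al : {ffun 'I_m -> nat} :=
    [ffun j => (al j - (j == i))%N].

Definition monomial_pd i al y : R := (al i)%:R * monomial (shift_down i al) y.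

Lemma shift_upK i : cancel (shift_up i) (shift_down i).
Proof. by move=> al; apply/ffunP => j; rewrite !ffunE addnK. Qed.

Lemma monomial_taylor t (r d : R) al y h : 0 <= t <= 1 -> 0 <= d ->
  (forall i, `|y 0 i| <= r - d) -> (forall i, `|h 0 i| <= t * d) ->
  taylor1 t (\prod_(i < m) r ^+ al i) (monomial al y) (monomial al (y + h))
    (\sum_i h 0 i * monomial_pd i al y).
Proof.
move=> t01 d0 yr hr.
have := @taylor1_prod _ (index_enum 'I_m) t (fun i => r ^+ al i)
  (fun i => y 0 i ^+ al i) (fun i => (y 0 i + h 0 i) ^+ al i)
  (fun i => h 0 i * ((al i)%:R * y 0 i ^+ (al i).-1)) t01 (index_enum_uniq _).
move=> /(_ (fun i => taylor1X (al i) t01 d0 (yr i) (hr i))).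
congr (taylor1 _ _ _ _ _); rewrite /monomial.
  by apply: eq_bigr => i _; rewrite mxE.
apply: eq_bigr => i _; rewrite -!mulrA; congr (_ * (_ * _)).
rewrite [RHS](bigD1 i)//= ffunE eqxx subn1; congr (_ * _).
by apply: eq_bigr => j /negPf ji; rewrite ffunE ji subn0.
Qed.

End Monomials.

(** * Analytic functions are smooth *)

Section AnalyticSmooth.
Context {R : realType} {m : nat}.

Lemma diff_quadratic (V W : normedModType R) (f : V -> W) a
    (L : {linear V -> W}) (C d : R) : continuous L -> 0 < d -> 0 <= C ->
  (forall h, `|h| <= d -> `|f (h + a) - f a - L h| <= C * `|h| ^+ 2) ->
  differentiable f a /\ 'd f a = L :> (V -> W).
Proof.
move=> cL d0 C0 H.
have E : f \o shift a = cst (f a) + L +o_ 0 id.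
  apply/eqaddoP => e e0; near=> h.
  rewrite -![(_ + _ : _ -> _) _]/(_ + _) -![(- _ : _ -> _) _]/(- _) /= opprD addrA.
  have hd : `|h| <= d by near: h; apply: nbhs0_le.
  apply: (le_trans (H h hd)).
  have he : `|h| <= e / (C + 1).
    by near: h; apply: nbhs0_le; rewrite divr_gt0// ltr_wpDl.
  rewrite expr2 mulrA ler_wpM2r// (le_trans (ler_wpM2l C0 he))//.
  by rewrite mulrCA ler_piMr ?(ltW e0)// ler_pdivrMr ?ltr_wpDl// mul1r lerDl.
have dE : 'd f a = L :> (_ -> _) by exact: diff_unique.
by split=> //; apply/diff_locallyP; rewrite dE.
Unshelve. all: by end_near. Qed.

Lemma differentiable_quadratic (f : 'rV[R]_m -> R) (a : 'rV[R]_m) (g : 'I_m -> R)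
    (C d : R) :
  0 < d -> 0 <= C ->
  (forall h : 'rV[R]_m, `|h| <= d ->
      `|f (h + a) - f a - \sum_i h 0 i * g i| <= C * `|h| ^+ 2) ->
  differentiable f a /\ forall v, 'D_v f a = \sum_i v 0 i * g i.
Proof.
move=> d0 C0 H.
pose L (h : 'rV[R]_m) : R := \sum_i h 0 i * g i.
have Llin : linear L.
  move=> u v w; rewrite /L scaler_sumr -big_split; apply: eq_bigr => i _ /=.
  by rewrite !mxE mulrDl -mulrA.
pose LM := GRing.isLinear.Build _ _ _ _ _ Llin.
pose LL : {linear 'rV[R]_m -> R} := HB.pack L LM.
have cL : continuous LL.
  move=> x; apply: differentiable_continuous.
  rewrite (_ : LL = \sum_i (fun h : 'rV[R]_m => h 0 i * g i) :> ('rV[R]_m -> R)).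
    by apply: differentiable_sum => i; apply: differentiableM;
        [exact: differentiable_coord|exact: differentiable_cst].
  by apply/funext => h; rewrite fct_sumE.
have [df dE] := diff_quadratic cL d0 C0 H.
by split=> // v; rewrite deriveE// dE.
Qed.

Implicit Types (f : 'rV[R]_m -> R) (O : set 'rV[R]_m).

(** Absolute convergence at the corner [x + (r, ..., r)] of a smaller polydisc
    makes the family [`|c al| * r ^ al] summable. By [monomial_taylor], for a
    displacement of relative size [t] the first-order remainder of the term of
    index [al] is at most [t ^+ 2] times this family, so the remainder of the
    sum is quadratic. *)
Lemma power_series_derive (c : {ffun 'I_m -> nat} -> R) (x : 'rV[R]_m) (rho : R) f :
  0 < rho ->
  (forall y : 'rV[R]_m, (forall i, `|y 0 i - x 0 i| < rho) ->
      has_sum (fun al => c al * \prod_(i < m) (y 0 i - x 0 i) ^+ al i) (f y)) ->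
  exists2 d : R, 0 < d & forall y : 'rV[R]_m, (forall i, `|y 0 i - x 0 i| < d) ->
    differentiable f y /\ forall v : 'rV[R]_m, exists C,
      abs_bounded (fun al => c al * \sum_i v 0 i * monomial_pd i al (y - x)) C /\
      usum (fun al => c al * \sum_i v 0 i * monomial_pd i al (y - x)) ('D_v f y).
Proof.
move=> rho0 Hf.
(* The coordinates of [y - x] have absolute value less than [d = r - d], which
   leaves room for displacements of size [d] within the polydisc of radius
   [r]. *)
pose r := rho / 2; pose d := r / 2.
have r0 : 0 < r by rewrite divr_gt0.
have d0 : 0 < d by rewrite divr_gt0.
have rd : r - d = d by rewrite /d [X in X - _](splitr r) addrK.
have drho : d + d < rho by rewrite /d -splitr /r ltr_pdivrMr// ltr_pMr// ltr1n.
have rrho : r < rho by rewrite ltr_pdivrMr// ltr_pMr// ltr1n.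
pose Rr al := \prod_(i < m) r ^+ (al : {ffun 'I_m -> nat}) i.
have Rr0 al : 0 <= Rr al by apply: prodr_ge0 => i _; rewrite exprn_ge0// ltW.
have [C HC] : exists C, forall J, uniq J -> \sum_(al <- J) `|c al| * Rr al <= C.
  have [|[C HC] _] := has_sumP (Hf (\row_i (x 0 i + r)) _).
    by move=> i; rewrite mxE addrAC subrr add0r ger0_norm ?ltW.
  exists C => J /HC; apply: le_trans; rewrite le_eqVlt; apply/orP; left; apply/eqP.
  apply: eq_bigr => al _; rewrite normrM; congr (_ * _).
  rewrite ger0_norm; last by apply: prodr_ge0 => i _;
      rewrite mxE addrAC subrr add0r exprn_ge0// ltW.
  by apply: eq_bigr => i _; rewrite mxE addrAC subrr add0r.
have C0 : 0 <= C by have := HC [::] isT; rewrite big_nil.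
exists d => // y yx.
have fy (z : 'rV[R]_m) : (forall i, `|z 0 i| <= d) ->
    usum (fun al => c al * monomial al (y - x + z)) (f (z + y)).
  move=> zd; have [|_ ] := has_sumP (Hf (z + y) _).
    move=> i; rewrite mxE -addrA (le_lt_trans (ler_normD _ _))//.
    by rewrite (lt_trans _ drho)// ler_ltD.
  congr usum; apply/funext => al; congr (_ * _); apply: eq_bigr => i _.
  by rewrite !mxE addrAC [z 0 i + _]addrC addrAC.
have fy0 : usum (fun al => c al * monomial al (y - x)) (f y).
  have := fy 0; rewrite addr0 add0r; apply => i; rewrite mxE normr0 ltW//.
have tay (t : R) (h : 'rV[R]_m) al : 0 <= t <= 1 -> (forall i, `|h 0 i| <= t * d) ->
  taylor1 t (Rr al) (monomial al (y - x)) (monomial al (y - x + h))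
    (\sum_i h 0 i * monomial_pd i al (y - x)).
  move=> t01 hd; apply: monomial_taylor (ltW d0) _ hd => // i.
  by rewrite rd !mxE ltW.
have bnd (v : 'rV[R]_m) :
    exists C, abs_bounded (fun al => c al * \sum_i v 0 i * monomial_pd i al (y - x)) C.
  pose k := (`|v| + 1) / d.
  have v1 : 0 < `|v| + 1 by rewrite ltr_wpDl.
  have k0 : 0 < k by rewrite divr_gt0.
  exists (k * C); apply: (@abs_bounded_le _ _ _ (fun al => k * (`|c al| * Rr al))) =>
      [al|J uJ].
    rewrite normrM mulrCA ler_wpM2l//.
    have [||a [b [g [[a0 b0 g0] _ + _ s]]]] := @tay 1 (k^-1 *: v) al.
    - by rewrite ler01 lexx.
    - move=> i; rewrite mxE mul1r normrM ger0_norm ?invr_ge0 ?(ltW k0)//.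
      rewrite ler_pdivrMl// /k mulfVK ?gt_eqF// (le_trans (rV_entry_le _ _))//.
      by rewrite lerDl.
    rewrite mul1r => h; have {}h :
        `|\sum_i (k^-1 *: v) 0 i * monomial_pd i al (y - x)| <= Rr al.
      by apply: (le_trans h); lra.
    rewrite -ler_pdivrMl//; apply: le_trans h.
    rewrite -[X in X * _ <= _](ger0_norm (ltW _)) ?invr_gt0// -normrM mulr_sumr.
    rewrite le_eqVlt; apply/orP; left; apply/eqP; congr `|_|.
    by apply: eq_bigr => i _; rewrite mxE mulrA.
  by rewrite -mulr_sumr ler_wpM2l ?(ltW k0) ?HC.
have Hi i : exists s, usum (fun al => c al * monomial_pd i al (y - x)) s.
  have [C' HC'] := bnd (delta_mx 0 i).
  have [s _ hs] := has_sum_exists HC'; exists s.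
  move: hs; congr usum; apply/funext => al; congr (_ * _).
  rewrite (bigD1 i)//= mxE !eqxx mul1r big1 ?addr0// => j /negPf ji.
  by rewrite mxE ji andbF mul0r.
have [g Hg] := choice Hi.
have Hv (v : 'rV[R]_m) : usum
    (fun al => c al * \sum_i v 0 i * monomial_pd i al (y - x)) (\sum_i v 0 i * g i).
  have := usum_bigsum (index_enum 'I_m) (fun i => usumZ (v 0 i) (Hg i)).
  congr usum; apply/funext => al; rewrite mulr_sumr; apply: eq_bigr => i _.
  by rewrite mulrCA.
have [|||df Df] := @differentiable_quadratic f y g (C / d ^+ 2) d.
- by [].
- by rewrite divr_ge0// exprn_ge0// ltW.
- move=> h hd; pose t := `|h| / d.
  have t01 : 0 <= t <= 1 by rewrite divr_ge0 ?(ltW d0)//= ler_pdivrMr// mul1r.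
  have hi i : `|h 0 i| <= t * d by rewrite /t divfK ?gt_eqF// rV_entry_le.
  have hi' i : `|h 0 i| <= d by exact: le_trans (rV_entry_le _ _) hd.
  have := usumB (usumB (fy h hi') fy0) (Hv h).
  move=> /usum_le; apply.
  rewrite mulrAC -mulrA -expr_div_n -/t mulrC.
  apply: (@abs_bounded_le _ _ _ (fun al => t ^+ 2 * (`|c al| * Rr al))) => [al|J uJ].
    rewrite -!mulrBr normrM mulrCA ler_wpM2l//.
    have [a [b [g' [[a0 b0 g0] _ _ h1 s]]]] := tay t h al t01 hi.
    by apply: (le_trans h1); rewrite ler_wpM2l ?sqr_ge0//; lra.
  by rewrite -mulr_sumr ler_wpM2l ?sqr_ge0 ?HC.
split=> // v; have [C' HC'] := bnd v; exists C'; split => //.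
by rewrite Df; exact: Hv.
Qed.

Lemma abs_bounded_sum (T : choiceType) (I : Type) (s : seq I) (F : I -> T -> R)
    (B : I -> R) :
  (forall i, abs_bounded (F i) (B i)) ->
  abs_bounded (fun x => \sum_(i <- s) F i x) (\sum_(i <- s) B i).
Proof.
move=> FB J uJ; apply: (@le_trans _ _ (\sum_(x <- J) \sum_(i <- s) `|F i x|)).
  by apply: ler_sum => x _; exact: ler_norm_sum.
by rewrite exchange_big/=; apply: ler_sum => i _; exact: FB.
Qed.

Lemma analytic_differentiable O f x : analytic_on O f -> O x -> differentiable f x.
Proof.
move=> Hf /Hf[c [rho [rho0 H]]].
have [d d0 /(_ x)[|//]] := power_series_derive rho0 H.
by move=> i; rewrite subrr normr0.
Qed.

(** The series of derivatives becomes a power series when the term of index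
    [al] is moved to the index [al - e_i]: the coefficient of index [be] of
    the i-th partial derivative is [(be i + 1) * c (be + e_i)]. *)
Lemma analytic_derive O f v : analytic_on O f -> analytic_on O ('D_v f).
Proof.
move=> Hf x /Hf[c [rho [rho0 H]]].
have [d d0 {}H] := power_series_derive rho0 H.
exists (fun be : {ffun 'I_m -> nat} =>
    \sum_i v 0 i * ((be i).+1%:R * c (shift_up i be))), d; split=> // y yx.
have [_ Hv] := H y yx.
pose F i (be : {ffun 'I_m -> nat}) :=
    c (shift_up i be) * monomial_pd i (shift_up i be) (y - x).
have FE i be : F i be = (be i).+1%:R * c (shift_up i be) * monomial be (y - x).
  by rewrite /F /monomial_pd shift_upK ffunE eqxx addn1 mulrCA mulrA.
have HF i : exists2 C, abs_bounded (F i) C & usum (F i) ('D_(delta_mx 0 i) f y).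
  have [C []] := Hv (delta_mx 0 i).
  rewrite (_ : (fun _ => _) = (fun al => c al * monomial_pd i al (y - x))); last first.
    apply/funext => al; congr (_ * _).
    rewrite (bigD1 i)//= mxE !eqxx mul1r big1 ?addr0// => j /negPf ji.
    by rewrite mxE ji andbF mul0r.
  move=> HC Hs; exists C.
    move=> J uJ; have := HC (map (shift_up i) J).
    by rewrite map_inj_uniq ?big_map; [exact|exact: can_inj (@shift_upK m i)].
  apply: (usum_reindex (@shift_upK m i) _ Hs) => al; rewrite /monomial_pd.
  case E : (al i) => [|k]; first by rewrite mul0r mulr0.
  move=> /eqP; case; apply/ffunP => j; rewrite !ffunE.
  by have [->|] := eqVneq j i; rewrite ?E ?subn1 ?addn1// subn0 addn0.
have HB' i : exists C, abs_bounded (F i) C by have [C] := HF i; exists C.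
have HU i : usum (F i) ('D_(delta_mx 0 i) f y) by have [] := HF i.
have [B HB] := choice HB'.
have Dv : 'D_v f y = \sum_i v 0 i * 'D_(delta_mx 0 i) f y.
  by rewrite derive_row//; have [] := H y yx.
rewrite Dv.
have us := usum_bigsum (index_enum 'I_m) (fun i => usumZ (v 0 i) (HU i)).
have FB i : abs_bounded (fun x => v 0 i * F i x) (`|v 0 i| * B i).
  move=> J uJ; under eq_bigr do rewrite normrM.
  by rewrite -mulr_sumr ler_wpM2l// HB.
have := usum_has_sum (abs_bounded_sum (index_enum 'I_m) FB) us.
congr has_sum; apply/funext => be; rewrite mulr_suml; apply: eq_bigr => i _.
rewrite FE -!mulrA; congr (_ * (_ * (_ * _))).
by apply: eq_bigr => j _; rewrite !mxE.
Qed.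

Lemma analytic_Ck k O f : open O -> analytic_on O f -> Ck k O f.
Proof.
move=> oO; elim: k f => [|k IH] f Hf.
  apply: Ck0P => // x Ox; apply: differentiable_continuous.
  exact: analytic_differentiable Hf Ox.
split=> [x|v]; first exact: analytic_differentiable.
by apply: IH; exact: analytic_derive.
Qed.

End AnalyticSmooth.

(** * Local flow of a C^1 vector field *)

Section LocalFlow.
Context {R : realType}.

Lemma nbhs_and (T : topologicalType) (x : T) (P Q : set T) :
  nbhs x P -> nbhs x Q -> nbhs x (P `&` Q).
Proof. exact: filterI. Qed.

Lemma nbhs_forall (T : topologicalType) (x : T) (I : finType) (P : I -> set T) :
  (forall i, nbhs x (P i)) -> nbhs x (fun y => forall i, P i y).
Proof. exact: filter_forall. Qed.

Lemma continuous_near_bounded (T : topologicalType) (g : T -> R) x :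
  {for x, continuous g} -> \forall y \near x, `|g y| <= `|g x| + 1.
Proof.
move=> /cvgrPdist_le/(_ _ ltr01); apply: filterS => y h.
rewrite -[g y](subrKC (g x)) (le_trans (ler_normD _ _))// lerD2l.
by rewrite distrC.
Qed.

Lemma le_sum2 n m (a : 'I_n -> 'I_m -> R) i j : (forall i j, 0 <= a i j) ->
  a i j <= \sum_(k < n) \sum_(l < m) a k l.
Proof.
move=> a0; rewrite (bigD1 i)//= (bigD1 j)//=; apply: ler_wpDr.
  by rewrite sumr_ge0// => i' _; rewrite sumr_ge0.
by apply: ler_wpDr => //; rewrite sumr_ge0.
Qed.

(** The mean value theorem on segments, with the partial derivatives bounded
    by continuity. *)
Lemma C1_locally_lipschitz n m (O : set 'rV[R]_n) (f : 'rV[R]_n -> 'rV[R]_m) x0 :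
  open O -> Ck 1 O f -> O x0 -> exists rL : R * R,
  [/\ 0 < rL.1, 0 < rL.2, ball x0 rL.1 `<=` O &
    forall x y, ball x0 rL.1 x -> ball x0 rL.1 y -> `|f x - f y| <= rL.2 * `|x - y|].
Proof.
move=> oO Cf Ox0.
pose M := \sum_(i < n) \sum_(j < m) (`|('D_(delta_mx 0 i) f x0) 0 j| + 1).
have M0 : 0 <= M by apply: sumr_ge0 => i _; apply: sumr_ge0 => j _; rewrite addr_ge0.
have N : \forall y \near x0, forall ij : 'I_n * 'I_m,
    `|('D_(delta_mx 0 ij.1) f y) 0 ij.2| <= `|('D_(delta_mx 0 ij.1) f x0) 0 ij.2| + 1.
  apply: (@nbhs_forall _ x0 _ (fun (ij : 'I_n * 'I_m) y =>
    `|('D_(delta_mx 0 ij.1) f y) 0 ij.2| <= `|('D_(delta_mx 0 ij.1) f x0) 0 ij.2| + 1)).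
  move=> [i j]; apply: (@continuous_near_bounded
      _ (fun y => ('D_(delta_mx 0 i) f y) 0 j)).
  apply: continuous_entry.
  exact: (Ck_continuous oO (Ck_derive _ Cf)).
have {}N := nbhs_and (open_nbhs_nbhs (conj oO Ox0)) N.
have [r /= r0 Hr] := (nbhs_ballP _ _).1 N.
exists (r, M * n%:R + 1); split => //=; first by rewrite ltr_wpDl// mulr_ge0.
  by move=> y /Hr[].
move=> x y xr yr.
have seg (t : R) : 0 <= t <= 1 -> ball x0 r (y + t *: (x - y)).
  move=> /andP[t0 t1]; move: xr yr; rewrite -!ball_normE /= => xr yr.
  have -> : x0 - (y + t *: (x - y)) = t *: (x0 - x) + (1 - t) *: (x0 - y).
    by rewrite !scalerBr !scalerBl scale1r; apply/rowP => j; rewrite !mxE; ring.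
  rewrite (le_lt_trans (ler_normD _ _))// !normrZ !ger0_norm ?subr_ge0//.
  have -> : r = t * r + (1 - t) * r by rewrite -mulrDl addrC subrK mul1r.
  have [->|tn0] := eqVneq t 0; first by rewrite !mul0r !add0r subr0 !mul1r.
  have tgt0 : 0 < t by rewrite lt_neqAle eq_sym tn0.
  apply: ltr_leD; first by rewrite ltr_pM2l.
  by apply: ler_wpM2l; [rewrite subr_ge0|exact: ltW].
have L0 : 0 <= (M * n%:R + 1) * `|x -
    y| by rewrite mulr_ge0// ltW// ltr_wpDl// mulr_ge0.
apply/(rV_norm_leP _ L0) => j.
have [|s /andP[s0 s1] E] := @mvt_line R _ (fun z => f z 0 j) y (x - y) 1 ltr01.
  move=> t t01; apply: differentiable_entry; apply: Ck_diff Cf _.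
  by have [] := Hr _ (seg t t01).
have s01 : 0 <= s <= 1 by rewrite !ltW.
have [Os bs] := Hr _ (seg s s01).
rewrite scale1r subrKC mul1r in E; rewrite !mxE E -derive_mxE;
    last exact: Ck_diff Cf Os.
rewrite derive_row; last exact: Ck_diff Cf Os.
rewrite summxE (le_trans (ler_norm_sum _ _ _))//.
apply: (@le_trans _ _ (\sum_(i < n) (M * `|x - y|))).
  apply: ler_sum => i _; rewrite mxE normrM mulrC ler_pM//; last first.
    exact: rV_entry_le.
  apply: (le_trans (bs (i, j))) => /=.
  apply: (@le_sum2 _ _ (fun i j => `|('D_(delta_mx 0 i) f x0) 0 j| + 1)).
  by move=> i' j'; rewrite addr_ge0.
by rewrite sumr_const card_ord -[_ *+ n]mulr_natr mulrAC mulrDl lerDl mul1r.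
Qed.

(** [Picard_Lindelof] asks for a globally Lipschitz field: [f] is composed
    with the retraction onto a box around [x0], which the solution does not
    leave for a short time. *)
Lemma local_flow m (O : set 'rV[R]_m) (f : 'rV[R]_m -> 'rV[R]_m) x0 :
  open O -> Ck 1 O f -> O x0 -> exists2 d : R, 0 < d &
  exists2 X : R -> 'rV[R]_m, X 0 = x0 &
    forall t : R, - d < t < d -> O (X t) /\ is_derive t 1 X (f (X t)).
Proof.
move=> oO Cf Ox0; have [[r L] /= [r0 L0 rO fL]] := C1_locally_lipschitz oO Cf Ox0.
pose rho (y : 'rV[R]_m) := \row_j clip (x0 0 j - r / 2) (x0 0 j + r / 2) (y 0 j).
have r2 : 0 < r / 2 by rewrite divr_gt0.
have rhob y : ball x0 r (rho y).
  rewrite -ball_normE /=; apply: (@le_lt_trans _ _ (r / 2)).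
    apply/(rV_norm_leP _ (ltW r2)) => j; rewrite !mxE.
    have /andP[] : x0 0 j - r / 2 <= clip (x0 0 j - r / 2) (x0 0 j + r / 2) (y 0 j) <=
        x0 0 j + r / 2.
      by apply: clip_in; lra.
    by rewrite ler_norml; lra.
  by rewrite ltr_pdivrMr// ltr_pMr// ltr1n.
have rhoid y : ball x0 (r / 2) y -> rho y = y.
  rewrite -ball_normE /= => /ltW/(rV_norm_leP _ (ltW r2)) h.
  apply/rowP => j; rewrite mxE clip_id//.
  by have := h j; rewrite !mxE ler_norml; lra.
have rhoL x y : `|rho x - rho y| <= `|x - y|.
  apply/(rV_norm_leP _ (normr_ge0 _)) => j; rewrite !mxE.
  by apply: le_trans (clip_lip _ _ _ _) _; have := rV_entry_le (x - y) j; rewrite !mxE.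
have [|d d0 [X X0 dX]] := @Picard_Lindelof R m (f \o rho) L x0 L0.
  move=> x y; apply: le_trans (fL _ _ (rhob x) (rhob y)) _.
  by rewrite ler_wpM2l// ltW.
have cX : {for (0 : R), continuous X}.
  apply/differentiable_continuous/derivable1_diffP.
  by have [] := dX 0; rewrite ?oppr_lt0 ?d0.
have [e /= e0 He] : nbhs_ball (0 : R) (fun t => ball x0 (r / 2) (X t)).
  by apply/nbhs_ballP; move/cvg_ballP: cX => /(_ _ r2); rewrite X0.
exists (Num.min d e); first by rewrite lt_min d0 e0.
exists X => // t /andP[t1 t2].
have td : - d < t < d.
  by move: t1 t2; rewrite lt_min ltrNl lt_min ltrNl; case/andP=> -> _ /andP[->].
have Xb : ball x0 (r / 2) (X t).
  apply: He; rewrite -ball_normE /= sub0r normrN ltr_norml.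
  by move: t1 t2; rewrite lt_min ltrNl lt_min [- t < e]ltrNl; case/andP=> _ ->
      /andP[_ ->].
split; last by have := dX t td; rewrite /= rhoid.
by rewrite -[X t]rhoid//; exact: rO.
Qed.

(** Both functions vanish at [q], so the inequality holds between difference
    quotients and passes to the limit. *)
Lemma derive_dominated (V : normedModType R) (f g : V -> R) q v (K : R) :
  derivable f q v -> derivable g q v -> f q = 0 -> g q = 0 ->
  (\forall x \near q, `|f x| <= K * `|g x|) -> `|'D_v f q| <= K * `|'D_v g q|.
Proof.
move=> df dg f0 g0 fg.
have cf : (fun h : R => `|h^-1 *: ((f \o shift q) (h *: v) - f q)|) @ 0^' -->
    `|'D_v f q|.
  exact: cvg_norm.
have cg : (fun h : R => K * `|h^-1 *: ((g \o shift q) (h *: v) - g q)|) @ 0^' -->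
    K * `|'D_v g q|.
  by apply: cvgM; [exact: cvg_cst|exact: cvg_norm].
rewrite -(cvg_lim _ cf)// -(cvg_lim _ cg)//.
apply: ler_lim; [by apply/cvg_ex; eexists; exact: cf|by apply/cvg_ex; eexists;
    exact: cg|].
have N : \forall h \near (0 : R)^', `|f (h *: v + q)| <= K * `|g (h *: v + q)|.
  apply: nbhs_dnbhs.
  have : {for (0 : R), continuous (fun h : R => h *: v + q)}.
    apply: cvgD; last exact: cvg_cst.
    by apply: scalel_continuous.
  by rewrite /prop_for /continuous_at scale0r add0r => /(_ _ fg).
apply: filterS N => h h1 /=; rewrite f0 g0 !subr0 !normrZ mulrCA ler_wpM2l//.
Qed.

End LocalFlow.

(** * Integral curves along which a function and its differential vanish *)

Section NullCurve.
Context {R : realType}.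

Lemma Ck_id (V : normedModType R) k (O : set V) : open O -> Ck k O (@id V).
Proof.
move=> oO; case: k => [|k]; first by apply: Ck0P => // x _; exact: cvg_id.
split=> [x _|v]; first exact: ex_diff.
by apply: eq_Ck (Ck_cst k v oO) => // x _; rewrite derive_id.
Qed.

Lemma Ck_comp_row (V : normedModType R) d m k (O : set V) (O' : set 'rV[R]_d)
    (f : V -> 'rV[R]_d) (g : 'rV[R]_d -> 'rV[R]_m) :
  open O -> open O' -> (forall x, O x -> O' (f x)) ->
  Ck k O f -> Ck k O' g -> Ck k O (g \o f).
Proof.
move=> oO oO' OO' Cf Cg; apply/Ck_mxP => // i j.
exact: (@Ck_comp _ _ _ _ O O' f (fun x => g x i j)) OO' Cf ((Ck_mxP _ _ oO').1 Cg i j).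
Qed.

Variables (n : nat) (O : set 'rV[R]_n) (V : 'rV[R]_n -> 'rV[R]_n).
Variables (lam B : 'rV[R]_n -> R) (K : R) (p : 'rV[R]_n).
Hypotheses (oO : open O) (Op : O p) (CV : Ck 1 O V) (Cl : Ck 1 O lam) (CB : Ck 2 O B).
Hypothesis VB : forall x, O x -> `|'D_(V x) B x| <= K * `|B x|.

(** The factor [s] turns integral curves of [V] into affinely parametrized
    geodesics when [lam] is the factor in [D_V nu = lam nu]. Both equations
    form one autonomous system for [row_mx g s]. *)
Lemma rescaled_flow : exists2 d : R, 0 < d &
  exists gs : (R -> 'rV[R]_n) * (R -> R), gs.1 0 = p /\
  forall t : R, - d < t < d ->
  [/\ O (gs.1 t), 2^-1 < gs.2 t < 2,
     is_derive t 1 gs.1 (gs.2 t *: V (gs.1 t)) &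
     is_derive t 1 gs.2 (- (lam (gs.1 t) * gs.2 t ^+ 2))].
Proof.
pose sc (z : 'rV[R]_(n + 1)) := z 0 (rshift n ord0).
pose O1 : set 'rV[R]_(n + 1) := [set z | O (lsubmx z) /\ ball (1 : R) 2^-1 (sc z)].
have Cpr k : Ck k [set: 'rV[R]_(n + 1)] (fun z : 'rV[R]_(n + 1) => lsubmx z : 'rV[R]_n).
  apply/Ck_mxP => [|i j]; first exact: openT.
  have := (Ck_mxP _ _ openT).1 (Ck_id k (@openT 'rV[R]_(n + 1))) i (lshift 1 j).
  by apply: eq_Ck => [|z _]; [exact: openT|rewrite !mxE].
have Csc k : Ck k [set: 'rV[R]_(n + 1)] sc.
  exact: ((Ck_mxP _ _ openT).1 (Ck_id k (@openT 'rV[R]_(n + 1))) 0 (rshift n ord0)).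
have oO1 : open O1.
  apply: openI; apply: open_comp.
  - by move=> z _; exact: (Ck_continuous openT (Cpr 0%N)).
  - exact: oO.
  - by move=> z _; exact: (Ck_continuous openT (Csc 0%N)).
  - exact: ball_open.
(* The last coordinate of [z] is the factor [s]; as [s] starts from 1, it
   stays between 1/2 and 2 on [O1]. *)
pose f (z : 'rV[R]_(n + 1)) : 'rV[R]_(n + 1) := row_mx (sc z *: V (lsubmx z))
  (\row_(_ < 1) (- (lam (lsubmx z) * sc z ^+ 2))).
have Cpr1 : Ck 1 O1 (fun z : 'rV[R]_(n + 1) => lsubmx z : 'rV[R]_n).
  by apply: (Ck_sub oO1 (@openT _)) => //.
have Csc1 : Ck 1 O1 sc by apply: (Ck_sub oO1 (@openT _)) => //.
have CV1 := Ck_comp_row oO1 oO (fun z => @proj1 _ _) Cpr1 CV.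
have Cl1 := Ck_comp oO1 oO (fun z => @proj1 _ _) Cpr1 Cl.
have Cf : Ck 1 O1 f.
  apply/(Ck_mxP _ _ oO1) => i j; rewrite (ord1 i).
  case: (splitP j) => [k jk|k jk].
    have -> : j = lshift 1 k by exact: val_inj.
    have := CkM oO1 Csc1 ((Ck_mxP _ _ oO1).1 CV1 0 k).
    by apply: eq_Ck => // z _; rewrite /f row_mxEl mxE.
  have -> : j = rshift n k by exact: val_inj.
  have := CkN oO1 (CkM oO1 Cl1 (CkM oO1 Csc1 Csc1)).
  by apply: eq_Ck => // z _; rewrite /f row_mxEr mxE expr2.
have O1p : O1 (row_mx p (\row_(_ < 1) 1)).
  split=> /=; first by rewrite row_mxKl.
  by rewrite /sc row_mxEr mxE; exact: ballxx.
have [d d0 [X X0 HX]] := local_flow oO1 Cf O1p.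
exists d => //; exists ((fun t => lsubmx (X t)), (fun t => sc (X t))).
split=> /=; first by rewrite X0 row_mxKl.
move=> t td; have [[OX sX] dX] := HX t td.
have diffX : differentiable X t by apply/derivable1_diffP; exact: ex_derive.
have E j : 'D_1 (fun t => X t 0 j) t = f (X t) 0 j.
  by rewrite -derive_mxE// derive_val.
split => //.
- by move: sX; rewrite -ball_normE /= ltr_norml; lra.
- have dl : differentiable (fun t => lsubmx (X t)) t.
    apply: differentiable_mx => i j.
    rewrite (_ : (fun _ => _) = fun t => X t i (lshift 1 j)).
      exact: differentiable_entry.
    by apply/funext => s; rewrite mxE.
  apply: DeriveDef; first exact: diff_derivable.
  apply/rowP => j; rewrite derive_mxE//.
  rewrite (_ : (fun _ => _) = fun t => X t 0 (lshift 1 j)).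
    by rewrite E /f row_mxEl.
  by apply/funext => s; rewrite mxE.
- apply: DeriveDef; first exact/diff_derivable/differentiable_entry.
  by rewrite /sc E /f row_mxEr mxE.
Qed.

Hypotheses (B0 : B p = 0) (dB0 : forall v, 'D_v B p = 0).

(** The function [V(B)] vanishes at [q] and is dominated by [K * `|B|] nearby,
    hence so are its partial derivatives by those of [B] ([derive_dominated]).
    Since mixed derivatives commute, the i-th one is
    [V(d_i B) + \sum_j (d_i V_j) * d_j B]. *)
Lemma gradient_dominated q : O q -> B q = 0 -> forall i : 'I_n,
  `|'D_(V q) ('D_(delta_mx 0 i) B) q| <=
    K * `|'D_(delta_mx 0 i) B q| +
    \sum_j `|('D_(delta_mx 0 i) V q) 0 j| * `|'D_(delta_mx 0 j) B q|.
Proof.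
move=> Oq Bq i.
have dB x : O x -> differentiable B x by exact: Ck_diff CB.
pose psi x := \sum_j V x 0 j * 'D_(delta_mx 0 j) B x.
have psiE x : O x -> psi x = 'D_(V x) B x by move=> Ox; rewrite derive_row//; exact: dB.
have dV j : differentiable (fun x => V x 0 j) q.
  by apply: differentiable_entry; exact: Ck_diff CV Oq.
have dD j : differentiable ('D_(delta_mx 0 j) B) q by exact: Ck_diff (Ck_derive _ CB)
    Oq.
have dp : psi = \sum_j (fun x => V x 0 j * 'D_(delta_mx 0 j) B x).
  by apply/funext => x; rewrite fct_sumE.
have dpsi : differentiable psi q.
  by rewrite dp; apply: differentiable_sum => j; apply: differentiableM.
have K1 : `|'D_(delta_mx 0 i) psi q| <= K * `|'D_(delta_mx 0 i) B q|.
  apply: derive_dominated => //.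
  - exact: diff_derivable.
  - exact/diff_derivable/dB.
  - by apply/normr0_eq0/eqP;
      rewrite psiE// -normr_le0 normr_id (le_trans (VB Oq))// Bq normr0 mulr0.
  - by apply: (open_near oO Oq) => x Ox; rewrite psiE//; exact: VB.
have Dpsi : 'D_(delta_mx 0 i) psi q =
    'D_(V q) ('D_(delta_mx 0 i) B) q +
    \sum_j ('D_(delta_mx 0 i) V q) 0 j * 'D_(delta_mx 0 j) B q.
  rewrite dp derive_sum; last first.
    by move=> j; apply: diff_derivable; apply: differentiableM.
  rewrite [X in _ = X + _]derive_row// -big_split/=; apply: eq_bigr => j _.
  rewrite deriveM; [|exact: diff_derivable|exact: diff_derivable].
  rewrite -derive_mxE; last exact: Ck_diff CV Oq.
  by rewrite (Schwarz _ _ oO CB Oq) /GRing.scale /= [X in _ + X]mulrC.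
have -> : 'D_(V q) ('D_(delta_mx 0 i) B) q = 'D_(delta_mx 0 i) psi q -
    \sum_j ('D_(delta_mx 0 i) V q) 0 j * 'D_(delta_mx 0 j) B q.
  by rewrite Dpsi addrK.
rewrite (le_trans (ler_normB _ _))// lerD// (le_trans (ler_norm_sum _ _ _))//.
by apply: ler_sum => j _; rewrite normrM lexx.
Qed.

Lemma is_derive_along (g : R -> 'rV[R]_n) (f : 'rV[R]_n -> R) (t : R) (v : 'rV[R]_n) :
  is_derive t 1 g v -> differentiable f (g t) ->
  is_derive t 1 (f \o g) ('D_v f (g t)).
Proof.
move=> dg df.
have dg' : differentiable g t by apply/derivable1_diffP; exact: ex_derive.
apply: DeriveDef; first exact/diff_derivable/differentiable_comp.
by rewrite derive_chain// derive_val.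
Qed.

Lemma sum_sqr_bound (a : 'I_n -> R) (i : 'I_n) :
  `|a i| * \sum_j `|a j| <= n%:R * \sum_j a j ^+ 2.
Proof.
rewrite mulr_natl -[X in _ *+ X]card_ord -sumr_const mulr_sumr.
apply: ler_sum => j _.
have sq k : a k ^+ 2 <= \sum_j a j ^+ 2.
  by rewrite (bigD1 k)//= lerDl sumr_ge0// => l _; exact: sqr_ge0.
have h1 := sq i; have h2 := sq j.
rewrite -(real_normK (num_real (a i))) in h1;
    rewrite -(real_normK (num_real (a j))) in h2.
have : 0 <= (`|a i| - `|a j|) ^+ 2 by exact: sqr_ge0.
set x := `|a i| in h1 *; set y := `|a j| in h2 *; set S := \sum_j _ in h1 h2 *.
nra.
Qed.

(** [Gronwall_eq0] is applied to [B ^+ 2] and then, [B] being zero along the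
    curve, to the sum of the squares of the partial derivatives of [B]. *)
Lemma null_curve_bounded (M : R) : 0 <= K -> 0 <= M ->
  (forall x i j, O x -> `|('D_(delta_mx 0 i) V x) 0 j| <= M) ->
  exists2 d : R, 0 < d & exists gs : (R -> 'rV[R]_n) * (R -> R),
  forall t : R, 0 < t < d ->
  [/\ O (gs.1 t) /\ gs.2 t != 0,
      is_derive t 1 gs.1 (gs.2 t *: V (gs.1 t)),
      is_derive t 1 gs.2 (- (lam (gs.1 t) * gs.2 t ^+ 2)),
      B (gs.1 t) = 0 & forall v, 'D_v B (gs.1 t) = 0].
Proof.
move=> K0 M0 HM; have [d d0 [[g s] /= [g0 H]]] := rescaled_flow.
have dB x : O x -> differentiable B x by exact: Ck_diff CB.
have dDB i x : O x -> differentiable ('D_(delta_mx 0 i) B) x.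
  exact: Ck_diff (Ck_derive _ CB).
have dgf (f : 'rV[R]_n -> R) (t : R) : - d < t < d -> differentiable f (g t) ->
    is_derive t 1 (f \o g) (s t * 'D_(V (g t)) f (g t)).
  move=> td df; have [Og _ dg _] := H t td.
  by rewrite -[_ * _]/(_ *: _) -deriveZv//; exact: is_derive_along.
have lt0 t : 0 <= t < d -> - d < t < d.
  by move=> /andP[t0 ->]; rewrite andbT (lt_le_trans _ t0)// oppr_lt0.
have Bg t : 0 <= t < d -> B (g t) = 0.
  move=> t0d; apply/eqP; rewrite -sqrf_eq0; apply/eqP.
  apply: (@Gronwall_eq0 R (fun t => B (g t) ^+ 2) d (4 * K)) t t0d.
  - move=> t td; have [Og _ _ _] := H t td; have h := dgf B t td (dB _ Og).
    have -> : (fun t => B (g t) ^+ 2) = (B \o g) ^+ 2 by [].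
    by apply: derivableX; exact: (@ex_derive _ _ _ _ _ _ _ h).
  - by move=> t; exact: sqr_ge0.
  - by rewrite g0 B0 expr0n.
  - move=> t /lt0 td; have [Og /andP[s1 s2] _ _] := H t td.
    have h := dgf B t td (dB _ Og).
    have hd := @ex_derive _ _ _ _ _ _ _ h.
    have -> : 'D_1 (fun t => B (g t) ^+ 2) t =
        2 * (B (g t) * (s t * 'D_(V (g t)) B (g t))).
      rewrite -[LHS]/('D_1 ((B \o g) * (B \o g)) t).
      rewrite deriveM// (@derive_val _ _ _ _ _ _ _ h) /GRing.scale /= mulr_natl mulr2n.
      reflexivity.
    have hB := VB Og.
    have h1 : B (g t) * (s t * 'D_(V (g t)) B (g t)) <=
        `|B (g t)| * (2 * (K * `|B (g t)|)).
      rewrite (le_trans (ler_norm _))// !normrM ler_wpM2l// ler_pM//.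
      by rewrite ger0_norm ltW// (lt_trans _ s1).
    rewrite -(real_normK (num_real (B (g t)))).
    set x := `|B (g t)| in h1 *; set y := B (g t) * _ in h1.
    rewrite -/y; have : 2 * y <= 2 * (x * (2 * (K * x))) by rewrite ler_pM2l.
    by have -> : 4 * K * x ^+ 2 = 2 * (x * (2 * (K * x))) by ring.
have sumD (f : 'I_n -> R -> R) : (fun t => \sum_i f i t ^+ 2) = \sum_i (f i ^+ 2).
  by apply/funext => t; rewrite fct_sumE; apply: eq_bigr => i _; rewrite exprfctE.
pose b i t := 'D_(delta_mx 0 i) B (g t).
pose w t := \sum_i b i t ^+ 2.
have db i (t : R) : - d < t < d ->
    is_derive t 1 (b i) (s t * 'D_(V (g t)) ('D_(delta_mx 0 i) B) (g t)).
  by move=> td; have [Og _ _ _] := H t td; exact: dgf (dDB i _ Og).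
have w0 t : 0 <= w t by apply: sumr_ge0 => i _; exact: sqr_ge0.
have dbX i (t : R) : - d < t < d -> derivable (b i ^+ 2) t 1.
  by move=> /(db i) h; apply: derivableX; exact: (@ex_derive _ _ _ _ _ _ _ h).
have wg : forall t, 0 <= t < d -> w t = 0.
  apply: (@Gronwall_eq0 R w d (n%:R * (4 * (K + M) * n%:R))) => //.
  - by move=> t td; rewrite /w sumD; apply: derivable_sum => i; exact: dbX.
  - by rewrite /w big1// => i _; rewrite /b g0 dB0 expr0n.
  move=> t t0d; have td := lt0 t t0d; have [Og /andP[s1 s2] _ _] := H t td.
  rewrite {1}/w sumD derive_sum; last by move=> i; exact: dbX.
  pose S := \sum_j `|b j t|.
  have S0 : 0 <= S by exact: sumr_ge0.
  have bS i : `|b i t| <= S by rewrite /S (bigD1 i)//= lerDl sumr_ge0.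
  have T1 i : 'D_1 (b i ^+ 2) t <= 4 * (K + M) * (n%:R * w t).
    have h := db i t td; have hd := @ex_derive _ _ _ _ _ _ _ h.
    have -> : 'D_1 (b i ^+ 2) t =
        2 * (b i t * (s t * 'D_(V (g t)) ('D_(delta_mx 0 i) B) (g t))).
      rewrite -[LHS]/('D_1 (b i * b i) t).
      rewrite deriveM// (@derive_val _ _ _ _ _ _ _ h) /GRing.scale /= mulr_natl mulr2n.
      reflexivity.
    set y := 'D_(V _) _ _ in h *.
    have hy : `|y| <= (K + M) * S.
      rewrite mulrDl (le_trans (gradient_dominated Og (Bg t t0d) i))// lerD//.
        by rewrite ler_wpM2l// bS.
      by rewrite mulr_sumr; apply: ler_sum => j _; rewrite ler_wpM2r// HM.
    have h1 : b i t * (s t * y) <= `|b i t| * (2 * ((K + M) * S)).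
      rewrite (le_trans (ler_norm _))// !normrM ler_wpM2l// ler_pM//.
      by rewrite ger0_norm ltW// (lt_trans _ s1).
    have h2 := sum_sqr_bound (b ^~ t) i; rewrite -/S -/(w t) in h2.
    have h3 : (K + M) * (`|b i t| * S) <= (K + M) * (n%:R * w t).
      by rewrite ler_wpM2l// addr_ge0.
    set z := b i t * (s t * y) in h1 *; lra.
  apply: (@le_trans _ _ (\sum_(i < n) 4 * (K + M) * (n%:R * w t))).
    by apply: ler_sum => i _; exact: T1.
  by rewrite sumr_const card_ord -[_ *+ n]mulr_natl !mulrA.
exists d => //; exists (g, s) => t /andP[t0 td] /=.
have t0d : 0 <= t < d by rewrite ltW.
have [Og /andP[s1 s2] dg ds] := H t (lt0 t t0d); split => //.
- by split=> //; rewrite gt_eqF// (lt_trans _ s1).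
- exact: Bg.
move=> v; rewrite derive_row; last exact: dB.
rewrite big1// => i _; suff -> : 'D_(delta_mx 0 i) B (g t) = 0 by rewrite scaler0.
apply/eqP; rewrite -sqrf_eq0; apply/eqP.
by have /psumr_eq0P := wg t t0d; apply => // j _; exact: sqr_ge0.
Qed.

End NullCurve.

(** The derivatives of [V] are bounded near [p], where [null_curve_bounded]
    applies. *)
Theorem null_curve (R : realType) n (O : set 'rV[R]_n)
    (V : 'rV[R]_n -> 'rV[R]_n) (lam B : 'rV[R]_n -> R) (K : R) (p : 'rV[R]_n) :
  open O -> O p -> Ck 1 O V -> Ck 1 O lam -> Ck 2 O B ->
  (forall x, O x -> `|'D_(V x) B x| <= K * `|B x|) ->
  B p = 0 -> (forall v, 'D_v B p = 0) ->
  exists2 d : R, 0 < d & exists gs : (R -> 'rV[R]_n) * (R -> R),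
  forall t : R, 0 < t < d ->
  [/\ O (gs.1 t) /\ gs.2 t != 0,
      is_derive t 1 gs.1 (gs.2 t *: V (gs.1 t)),
      is_derive t 1 gs.2 (- (lam (gs.1 t) * gs.2 t ^+ 2)),
      B (gs.1 t) = 0 & forall v, 'D_v B (gs.1 t) = 0].
Proof.
move=> oO Op CV Cl CB VB B0 dB0.
pose a i j := `|('D_(delta_mx 0 i) V p) 0 j| + 1.
have a0 i j : 0 <= a i j by rewrite addr_ge0.
pose M := \sum_(i < n) \sum_(j < n) a i j.
have N : \forall y \near p, forall ij : 'I_n * 'I_n,
    `|('D_(delta_mx 0 ij.1) V y) 0 ij.2| <= a ij.1 ij.2.
  apply: (@nbhs_forall _ p _ (fun (ij : 'I_n * 'I_n) y =>
    `|('D_(delta_mx 0 ij.1) V y) 0 ij.2| <= a ij.1 ij.2)).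
  move=> [i j]; apply: (@continuous_near_bounded
      _ _ (fun y => ('D_(delta_mx 0 i) V y) 0 j)).
  apply: continuous_entry.
  exact: (Ck_continuous oO (Ck_derive _ CV)).
have {}N := nbhs_and (open_nbhs_nbhs (conj oO Op)) N.
have [r /= r0 Hr] := (nbhs_ballP _ _).1 N.
pose O' := ball p r.
have oO' : open O' by exact: ball_open.
have sO : O' `<=` O by move=> x /Hr[].
have [||||||||||d d0 [gs H]] :=
    @null_curve_bounded R n O' V lam B `|K| p oO' _ _ _ _ _ _ _ M.
- exact: ballxx.
- exact: Ck_sub oO' oO sO CV.
- exact: Ck_sub oO' oO sO Cl.
- exact: Ck_sub oO' oO sO CB.
- move=> x /sO Ox; apply: le_trans (VB x Ox) _.
  by rewrite ler_wpM2r// ler_norm.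
- exact: B0.
- exact: dB0.
- exact: normr_ge0.
- by apply: sumr_ge0 => i _; apply: sumr_ge0.
- move=> x i j /Hr[_ h]; apply: le_trans (h (i, j)) _ => /=.
  exact: le_sum2.
exists d => //; exists gs => t /H[[Og s0] dg ds Bg dBg].
by split => //; split => //; exact: sO.
Qed.

(** * Minors of the adjugate matrix *)

Section Jacobi.

Lemma sum_ord_max (A : nmodType) n (F : 'I_n.+1 -> A) :
  \sum_i F i = \sum_i F (lift ord_max i) + F ord_max.
Proof. by rewrite (bigD1_ord ord_max)//= addrC. Qed.

(** Let [Q] be the matrix of the right-hand sides. Since [K *m \adj K] is
    scalar, [S *m Q] is the scalar matrix [\det S * \det K]; multiply by
    [\adj S] and cancel [\det S]. *)
Lemma jacobi_minor_regular (A : idomainType) n (K : 'M[A]_n.+1) :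
  let S := row' ord_max (col' ord_max K) in \det S != 0 ->
  forall i j, \det K * (\adj S) i j =
    (\adj K) ord_max ord_max * (\adj K) (lift ord_max i) (lift ord_max j) -
    (\adj K) (lift ord_max i) ord_max * (\adj K) ord_max (lift ord_max j).
Proof.
move=> S S0 i j; pose m : 'I_n.+1 := ord_max.
pose Q : 'M[A]_n := \matrix_(k, l) ((\adj K) m m * (\adj K) (lift m k) (lift m l) -
    (\adj K) (lift m k) m * (\adj K) m (lift m l)).
have Smm : (\adj K) m m = \det S.
  by rewrite mxE /cofactor -signr_odd oddD addbb mul1r.
have KK a b : \sum_k K a k * (\adj K) k b = \det K *+ (a == b).
  by have /matrixP/(_ a b) := mul_mx_adj K; rewrite !mxE.
have SQ : S *m Q = (\det S * \det K)%:M.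
  apply/matrixP => k l; rewrite !mxE.
  have h1 := KK (lift m k) (lift m l); have h2 := KK (lift m k) m.
  rewrite !sum_ord_max in h1 h2; rewrite (inj_eq lift_inj) in h1.
  rewrite eq_sym (negPf (neq_lift _ _)) mulr0n in h2.
  transitivity ((\adj K) m m * \sum_a K (lift m k) (lift m a) *
      (\adj K) (lift m a) (lift m l) -
     (\sum_a K (lift m k) (lift m a) * (\adj K) (lift m a) m) * (\adj K) m (lift m l)).
    rewrite mulr_sumr mulr_suml -sumrB; apply: eq_bigr => a _; rewrite !mxE; ring.
  have -> : \sum_a K (lift m k) (lift m a) * (\adj K) (lift m a) (lift m l) =
    \det K *+ (k == l) - K (lift m k) m * (\adj K) m (lift m l) by rewrite -h1 addrK.
  have -> : \sum_a K (lift m k) (lift m a) * (\adj K) (lift m a) m =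
    - (K (lift m k) m * (\adj K) m m) by apply/eqP; rewrite -addr_eq0 h2.
  by rewrite Smm; case: (k == l) => /=; rewrite ?mulr1n ?mulr0n; ring.
have : \adj S *m (S *m Q) = \adj S *m (\det S * \det K)%:M by rewrite SQ.
rewrite mulmxA mul_adj_mx mul_scalar_mx mul_mx_scalar -scalerA.
move=> /matrixP/(_ i j); rewrite [LHS]mxE [RHS]mxE => /(mulfI S0).
by rewrite [LHS]mxE [RHS]mxE.
Qed.

(** To drop the condition [\det S != 0], add an indeterminate to the diagonal
    of [S]: its determinant becomes a characteristic polynomial, which is
    monic. Then evaluate at 0. *)
Lemma jacobi_minor (A : idomainType) n (K : 'M[A]_n.+1) :
  let S := row' ord_max (col' ord_max K) in
  forall i j, \det K * (\adj S) i j =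
    (\adj K) ord_max ord_max * (\adj K) (lift ord_max i) (lift ord_max j) -
    (\adj K) (lift ord_max i) ord_max * (\adj K) ord_max (lift ord_max j).
Proof.
move=> S i j; pose m : 'I_n.+1 := ord_max.
pose D : 'M[{poly A}]_n.+1 := \matrix_(a, b) ('X *+ ((a == b) && (a != m))).
pose KX := map_mx polyC K + D.
have SX : row' m (col' m KX) = char_poly_mx (- S).
  apply/matrixP => a b; rewrite !mxE (inj_eq lift_inj).
  rewrite (_ : lift m a != m) ?andbT; last by rewrite eq_sym neq_lift.
  by rewrite polyCN opprK addrC.
have h0 : \det (row' m (col' m KX)) != 0.
  by rewrite SX; apply: monic_neq0; exact: char_poly_monic.
pose f : {rmorphism {poly A} -> A} := horner_eval 0.
have := jacobi_minor_regular h0 i j; move=> /(congr1 f).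
have ev : map_mx f KX = K.
  apply/matrixP => a b; rewrite !mxE /f /= /horner_eval hornerD hornerC hornerMn
      hornerX.
  by rewrite mul0rn addr0.
have evS : map_mx f (row' m (col' m KX)) = S.
  by rewrite map_row' map_col' ev.
rewrite rmorphB !rmorphM -det_map_mx ev.
have adjE k (Z : 'M[{poly A}]_k) a b :
    f ((\adj Z) a b) = (\adj (map_mx f Z)) a b.
  by rewrite -map_mx_adj [RHS]mxE.
by rewrite !adjE ev evS.
Qed.

End Jacobi.

(** * Bilinear forms given by a matrix *)

Section InnerProduct.
Context {R : realType} {d : nat}.
Implicit Types (g : 'M[R]_d) (u v w : 'rV[R]_d).

Definition ip g u v : R := (u *m g *m v^T) 0 0.

Lemma ipE g u v : ip g u v = \sum_i \sum_j u 0 i * g i j * v 0 j.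
Proof.
rewrite /ip mxE exchange_big/=; apply: eq_bigr => j _.
by rewrite !mxE mulr_suml.
Qed.

Lemma ipC g u v : g^T = g -> ip g u v = ip g v u.
Proof.
move=> gT; rewrite /ip; have -> : u *m g *m v^T = (v *m g *m u^T)^T.
  by rewrite !trmx_mul trmxK gT mulmxA.
by rewrite mxE.
Qed.

Lemma ipDl g u u' v : ip g (u + u') v = ip g u v + ip g u' v.
Proof. by rewrite /ip !mulmxDl mxE. Qed.

Lemma ipDr g u v v' : ip g u (v + v') = ip g u v + ip g u v'.
Proof. by rewrite /ip linearD mulmxDr mxE. Qed.

Lemma ipZl g a u v : ip g (a *: u) v = a * ip g u v.
Proof. by rewrite /ip -!scalemxAl mxE. Qed.

Lemma ipZr g a u v : ip g u (a *: v) = a * ip g u v.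
Proof. by rewrite /ip linearZ -scalemxAr mxE. Qed.

Lemma ipNl g u v : ip g (- u) v = - ip g u v.
Proof. by rewrite -scaleN1r ipZl mulN1r. Qed.

Lemma ip_suml g (I : Type) (r : seq I) (F : I -> 'rV[R]_d) v :
  ip g (\sum_(i <- r) F i) v = \sum_(i <- r) ip g (F i) v.
Proof. by rewrite /ip !mulmx_suml summxE. Qed.

Lemma ip_sumr g (I : Type) (r : seq I) (F : I -> 'rV[R]_d) u :
  ip g u (\sum_(i <- r) F i) = \sum_(i <- r) ip g u (F i).
Proof. by rewrite /ip linear_sum mulmx_sumr summxE. Qed.

Lemma ip_delta g u k : ip g u (delta_mx 0 k) = (u *m g) 0 k.
Proof. by rewrite /ip trmx_delta -colE mxE. Qed.

Lemma ip_congr g (J : 'M[R]_d) u v : ip (J *m g *m J^T) u v = ip g (u *m J) (v *m J).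
Proof. by rewrite /ip trmx_mul !mulmxA. Qed.

End InnerProduct.

(** * The Levi-Civita connection in coordinates *)

Section Connection.
Context {R : realType} {d : nat}.
Implicit Types (G : 'rV[R]_d -> 'M[R]_d) (x u v w : 'rV[R]_d).

(** For [G := metric a] this is convertible to [christoffel a]. *)
Definition christoffel_of G x (k p q : 'I_d) : R :=
  2^-1 * \sum_(l < d) invmx (G x) k l *
    ('D_(delta_mx 0 p) (fun y => G y q l) x +
     'D_(delta_mx 0 q) (fun y => G y p l) x -
     'D_(delta_mx 0 l) (fun y => G y p q) x).

Definition Gamma G x u v : 'rV[R]_d :=
  \row_(k < d) \sum_(p < d) \sum_(q < d) christoffel_of G x k p q * u 0 p * v 0 q.

Definition christoffel_lower G x (p q l : 'I_d) : R := 2^-1 *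
    ('D_(delta_mx 0 p) (fun y => G y q l) x +
     'D_(delta_mx 0 q) (fun y => G y p l) x -
     'D_(delta_mx 0 l) (fun y => G y p q) x).

Lemma GammaE G x u v : Gamma G x u v =
  \sum_p \sum_q (u 0 p * v 0 q) *: \row_k christoffel_of G x k p q.
Proof.
apply/rowP => k; rewrite mxE summxE; apply: eq_bigr => p _.
rewrite summxE; apply: eq_bigr => q _; rewrite !mxE; ring.
Qed.

Lemma christoffel_lowerE G x p q r : G x \in unitmx -> (G x)^T = G x ->
  ((\row_k christoffel_of G x k p q) *m G x) 0 r = christoffel_lower G x p q r.
Proof.
move=> Gu Gs.
have -> : \row_k christoffel_of G x k p q =
    (\row_l christoffel_lower G x p q l) *m invmx (G x).
  apply/rowP => k; rewrite !mxE /christoffel_of mulr_sumr; apply: eq_bigr => l _.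
  have E : invmx (G x) l k = invmx (G x) k l by rewrite -[in LHS]Gs -trmx_inv mxE.
  by rewrite mxE /christoffel_lower E; ring.
by rewrite mulmxKV// mxE.
Qed.

Section AtPoint.
Variables (G : 'rV[R]_d -> 'M[R]_d) (W : set 'rV[R]_d).
Hypotheses (oW : open W) (CG : Ck 1 W G).
Hypotheses (Gu : forall x, W x -> G x \in unitmx) (Gs : forall x, W x -> (G x)^T = G x).

Lemma dG_sym v x p q : W x -> 'D_v (fun y => G y p q) x = 'D_v (fun y => G y q p) x.
Proof.
move=> Wx; apply: near_eq_derive; apply: (open_near oW Wx) => y /Gs Gy.
by rewrite -[in LHS]Gy mxE.
Qed.

Lemma Gamma_sym x u v : W x -> Gamma G x u v = Gamma G x v u.
Proof.
move=> Wx; rewrite !GammaE exchange_big/=; apply: eq_bigr => q _; apply: eq_bigr => p _.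
rewrite mulrC; congr (_ *: _); apply/rowP => k; rewrite !mxE /christoffel_of;
    congr (_ * _).
apply: eq_bigr => l _; rewrite (dG_sym _ p q Wx); congr (_ * _); ring.
Qed.

Lemma ip_Gamma x u z w : W x -> ip (G x) (Gamma G x u z) w =
  \sum_p \sum_q \sum_l christoffel_lower G x p q l * u 0 p * z 0 q * w 0 l.
Proof.
move=> Wx; rewrite GammaE ip_suml; apply: eq_bigr => p _.
rewrite ip_suml; apply: eq_bigr => q _; rewrite ipZl.
rewrite {1}(row_sum_delta w) ip_sumr mulr_sumr; apply: eq_bigr => l _.
by rewrite ipZr ip_delta christoffel_lowerE ?Gu ?Gs//; ring.
Qed.

(** For [Z := 'D_w y] and [G] the metric in a chart, this is [cov_deriv]
    computed in that chart. *)
Definition nabla (V : normedModType R) (y Z : V -> 'rV[R]_d) (v t : V) : 'rV[R]_d :=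
  'D_v Z t + Gamma G (y t) ('D_v y t) (Z t).

Section Along.
Context {V : normedModType R}.
Variables (y : V -> 'rV[R]_d) (t : V).
Hypotheses (Wy : W (y t)) (dy : differentiable y t).

(** In the derivative of the product, the terms with the derivative of [G]
    match the Christoffel terms because the lowered symbols satisfy
    [Gamma_{pq,l} + Gamma_{pl,q} = d_p G_{ql}]. *)
Lemma metric_compatible (Z1 Z2 : V -> 'rV[R]_d) (v : V) :
  differentiable Z1 t -> differentiable Z2 t ->
  'D_v (fun t => ip (G (y t)) (Z1 t) (Z2 t)) t =
  ip (G (y t)) (nabla y Z1 v t) (Z2 t) + ip (G (y t)) (Z1 t) (nabla y Z2 v t).
Proof.
move=> d1 d2.
have dG i j : differentiable (fun x => G x i j) (y t).
  by apply: differentiable_entry; exact: Ck_diff CG Wy.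
have dGy i j : differentiable (fun t => G (y t) i j) t.
  exact: (differentiable_comp dy (dG i j)).
have dZ1 i : differentiable (fun t => Z1 t 0 i) t by exact: differentiable_entry.
have dZ2 i : differentiable (fun t => Z2 t 0 i) t by exact: differentiable_entry.
have -> : (fun t => ip (G (y t)) (Z1 t) (Z2 t)) =
    \sum_i \sum_j (fun t => Z1 t 0 i * G (y t) i j * Z2 t 0 j).
  apply/funext => s; rewrite ipE fct_sumE; apply: eq_bigr => i _.
  by rewrite fct_sumE.
have chain i j : 'D_v (fun t => G (y t) i j) t =
    \sum_p ('D_v y t) 0 p * 'D_(delta_mx 0 p) (fun x => G x i j) (y t).
  exact: (derive_chain_row v dy (dG i j)).
have dterm i j : differentiable (fun t => Z1 t 0 i * G (y t) i j * Z2 t 0 j) t.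
  by apply: differentiableM => //; exact: differentiableM.
rewrite derive_sum; last first.
  by move=> i; apply: diff_derivable; apply: differentiable_sum => j.
have E i : 'D_v (\sum_j (fun t => Z1 t 0 i * G (y t) i j * Z2 t 0 j)) t =
  \sum_j (('D_v Z1 t) 0 i * G (y t) i j * Z2 t 0 j +
    Z1 t 0 i * G (y t) i j * ('D_v Z2 t) 0 j +
    \sum_p ('D_v y t) 0 p * 'D_(delta_mx 0 p) (fun x => G x i j) (y t) * Z1 t 0 i *
        Z2 t 0 j).
  rewrite derive_sum; last by move=> j; exact: diff_derivable.
  apply: eq_bigr => j _.
  rewrite deriveM; [|by apply: diff_derivable;
      apply: differentiableM|exact: diff_derivable].
  rewrite deriveM; [|exact: diff_derivable|exact: diff_derivable].
  rewrite chain -(derive_mxE v 0 i d1) -(derive_mxE v 0 j d2).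
  rewrite /GRing.scale /= mulrDr [X in _ = _ + X](_ : _ =
    Z2 t 0 j * (Z1 t 0 i * \sum_p ('D_v y t) 0 p *
        'D_(delta_mx 0 p) (fun x => G x i j) (y t))).
    rewrite /GRing.scale /=; ring.
  by rewrite !mulr_sumr; apply: eq_bigr => p _; ring.
rewrite (eq_bigr _ (fun i _ => E i)).
rewrite /nabla ipDl ipDr [ip _ _ (Gamma _ _ _ _)]ipC ?Gs// !ip_Gamma// !ipE.
under eq_bigr do rewrite !big_split/=.
rewrite !big_split/= -!addrA; congr (_ + _); rewrite addrCA; congr (_ + _).
rewrite [X in _ = _ + X](_ : _ = \sum_p \sum_q \sum_l
    christoffel_lower G (y t) p l q * ('D_v y t) 0 p * Z1 t 0 q * Z2 t 0 l); last first.
  apply: eq_bigr => p _; rewrite exchange_big/=; apply: eq_bigr => q _.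
  by apply: eq_bigr => l _; ring.
rewrite -big_split/=.
transitivity (\sum_p \sum_q \sum_l ('D_v y t) 0 p *
    'D_(delta_mx 0 p) (fun x => G x q l) (y t) * Z1 t 0 q * Z2 t 0 l).
  rewrite [RHS]exchange_big/=; apply: eq_bigr => i _.
  by rewrite [RHS]exchange_big.
apply: eq_bigr => p _; rewrite -big_split/=; apply: eq_bigr => q _.
rewrite -big_split/=; apply: eq_bigr => l _.
by rewrite /christoffel_lower (dG_sym _ l q Wy) (dG_sym _ p l Wy) (dG_sym _ p q Wy);
    field.
Qed.

End Along.
End AtPoint.
End Connection.

Section ChristoffelBilinear.
Context {R : realType} {d : nat}.
Implicit Types (G : 'rV[R]_d -> 'M[R]_d) (x u v w : 'rV[R]_d).

Lemma GammaDl G x u u' v : Gamma G x (u + u') v = Gamma G x u v + Gamma G x u' v.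
Proof.
rewrite !GammaE -big_split; apply: eq_bigr => p _; rewrite -big_split.
by apply: eq_bigr => q _; rewrite mxE mulrDl scalerDl.
Qed.

Lemma GammaZl G x a u v : Gamma G x (a *: u) v = a *: Gamma G x u v.
Proof.
rewrite !GammaE scaler_sumr; apply: eq_bigr => p _; rewrite scaler_sumr.
by apply: eq_bigr => q _; rewrite mxE -mulrA scalerA.
Qed.

Lemma GammaDr G x u v v' : Gamma G x u (v + v') = Gamma G x u v + Gamma G x u v'.
Proof.
rewrite !GammaE -big_split; apply: eq_bigr => p _; rewrite -big_split.
by apply: eq_bigr => q _; rewrite mxE mulrDr scalerDl.
Qed.

Lemma GammaZr G x a u v : Gamma G x u (a *: v) = a *: Gamma G x u v.
Proof.
rewrite !GammaE scaler_sumr; apply: eq_bigr => p _; rewrite scaler_sumr.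
by apply: eq_bigr => q _; rewrite mxE mulrCA scalerA.
Qed.

Lemma Gamma0l G x v : Gamma G x 0 v = 0.
Proof. by have := GammaZl G x 0 0 v; rewrite !scale0r. Qed.

Lemma Gamma0r G x u : Gamma G x u 0 = 0.
Proof. by have := GammaZr G x 0 u 0; rewrite !scale0r. Qed.

Lemma Gamma_suml G x (I : Type) (r : seq I) (F : I -> 'rV[R]_d) v :
  Gamma G x (\sum_(i <- r) F i) v = \sum_(i <- r) Gamma G x (F i) v.
Proof.
apply: (big_morph (fun u => Gamma G x u v)) => [u u'|]; [exact: GammaDl|exact: Gamma0l].
Qed.

Lemma Gamma_sumr G x (I : Type) (r : seq I) (F : I -> 'rV[R]_d) u :
  Gamma G x u (\sum_(i <- r) F i) = \sum_(i <- r) Gamma G x u (F i).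
Proof.
apply: (big_morph (Gamma G x u)) => [v v'|]; [exact: GammaDr|exact: Gamma0r].
Qed.

End ChristoffelBilinear.

Lemma Schwarz_row (R : realType) (V : normedModType R) d (f : V -> 'rV[R]_d)
    (O : set V) x v w : open O -> Ck 2 O f -> O x ->
  'D_v ('D_w f) x = 'D_w ('D_v f) x.
Proof.
move=> oO Cf Ox; apply/rowP => j.
have Cj := (Ck_mxP _ _ oO).1 Cf 0 j.
have E a b : ('D_a ('D_b f) x) 0 j = 'D_a ('D_b (fun y => f y 0 j)) x.
  apply: (etrans (derive_mxE a 0 j (Ck_diff (Ck_derive b Cf) Ox))).
  apply: near_eq_derive; apply: (open_near oO Ox) => z Oz.
  exact: derive_mxE (Ck_diff Cf Oz).
exact: (etrans (E v w) (etrans (Schwarz v w oO Cj Ox) (esym (E w v)))).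
Qed.

(** * The Koszul formula and changes of coordinates *)

Section Koszul.
Context {R : realType} {d : nat} {V : normedModType R}.
Variables (G : 'rV[R]_d -> 'M[R]_d) (W : set 'rV[R]_d).
Hypotheses (oW : open W) (CG : Ck 1 W G).
Hypotheses (Gu : forall x, W x -> G x \in unitmx) (Gs : forall x, W x -> (G x)^T = G x).
Variables (O : set V) (y : V -> 'rV[R]_d).
Hypotheses (oO : open O) (Cy : Ck 2 O y) (OW : forall t, O t -> W (y t)).

Lemma torsion_free t v w : O t -> nabla G y ('D_w y) v t = nabla G y ('D_v y) w t.
Proof.
move=> Ot; rewrite /nabla (Schwarz_row _ _ oO Cy Ot).
by rewrite (Gamma_sym oW Gs _ _ (OW Ot)).
Qed.

Definition pullback_metric (v w t : V) := ip (G (y t)) ('D_v y t) ('D_w y t).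

(** Three instances of [metric_compatible] are combined, and four of the six
    resulting terms cancel in pairs by [torsion_free]. The right-hand side
    only depends on the metric induced on the source, and not on the
    coordinates in which [y] is read. *)
Lemma Koszul t u v w : O t ->
  2 * ip (G (y t)) (nabla G y ('D_v y) u t) ('D_w y t) =
  'D_u (pullback_metric v w) t + 'D_v (pullback_metric u w) t -
  'D_w (pullback_metric u v) t.
Proof.
move=> Ot; have dy := Ck_diff Cy Ot; have dD z := Ck_diff (Ck_derive z Cy) Ot.
have mc a b c := metric_compatible oW CG Gu Gs (OW Ot) dy c (dD a) (dD b).
have arith (A B C a1 a2 b1 b2 c1 c2 : R) : A = a1 + a2 -> B = b1 + b2 ->
    C = c1 + c2 -> b1 = a1 -> c1 = a2 -> c2 = b2 -> 2 * a1 = A + B - C.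
  by move=> -> -> -> -> -> ->; ring.
apply: (arith _ _ _ _ _ _ _ _ _ (mc v w u) (mc u w v) (mc u v w)).
- exact: (congr1 (fun z => ip _ z _) (torsion_free v u Ot)).
- rewrite (ipC _ _ (Gs (OW Ot))).
  exact: (congr1 (fun z => ip _ _ z) (torsion_free w u Ot)).
- exact: (congr1 (fun z => ip _ _ z) (torsion_free w v Ot)).
Qed.

End Koszul.

Section ChartChange.
Context {R : realType} {d : nat}.
Variables (Ga Gb : 'rV[R]_d -> 'M[R]_d) (Wa Wb : set 'rV[R]_d).
Hypotheses (oWa : open Wa) (oWb : open Wb).
Hypotheses (CGb : Ck 1 Wb Gb).
Hypotheses (Gau : forall x, Wa x -> Ga x \in unitmx)
    (Gas : forall x, Wa x -> (Ga x)^T = Ga x).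
Hypotheses (Gbu : forall x, Wb x -> Gb x \in unitmx)
    (Gbs : forall x, Wb x -> (Gb x)^T = Gb x).
Variable phi : 'rV[R]_d -> 'rV[R]_d.
Hypotheses (Cphi : Ck 2 Wa phi) (phiW : forall x, Wa x -> Wb (phi x)).
Hypotheses (Ju : forall x, Wa x -> 'J phi x \in unitmx).
Hypotheses (GJ : forall x, Wa x -> Ga x = 'J phi x *m Gb (phi x) *m ('J phi x)^T).

Lemma deriveJ x v : Wa x -> 'D_v phi x = v *m 'J phi x.
Proof. by move=> Wx; rewrite deriveEjacobian//; exact: Ck_diff Cphi Wx. Qed.

Lemma pullback_chart x v w : Wa x -> pullback_metric Gb phi v w x = ip (Ga x) v w.
Proof. by move=> Wx; rewrite /pullback_metric !deriveJ// GJ// ip_congr. Qed.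

(** Paired with the tangent vectors of [phi], both sides become the lowered
    Christoffel symbols of [Ga]: the left-hand side by the Koszul formula for
    [phi], whose induced metric is [Ga]. *)
Lemma christoffel_change x p q : Wa x ->
  nabla Gb phi ('D_(delta_mx 0 q) phi) (delta_mx 0 p) x =
  (\row_k christoffel_of Ga x k p q) *m 'J phi x.
Proof.
move=> Wx; set X := LHS; set Y := _ *m _.
have Gbx := Gbu (phiW Wx).
suff E : X *m (Gb (phi x) *m ('J phi x)^T) = Y *m (Gb (phi x) *m ('J phi x)^T).
  have u : Gb (phi x) *m ('J phi x)^T \in unitmx by rewrite unitmx_mul Gbx unitmx_tr Ju.
  by rewrite -[X](mulmxK u) E mulmxK.
apply/rowP => r.
have K := Koszul oWb CGb Gbu Gbs oWa Cphi phiW (delta_mx 0 p) (delta_mx 0 q)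
    (delta_mx 0 r) Wx.
have pE i j l : 'D_(delta_mx 0 l)
    (pullback_metric Gb phi (delta_mx 0 i) (delta_mx 0 j)) x =
    'D_(delta_mx 0 l) (fun z => Ga z i j) x.
  apply: near_eq_derive; apply: (open_near oWa Wx) => z Wz.
  by rewrite pullback_chart// ip_delta -rowE mxE.
have {}K : 2 * ip (Gb (phi x)) X (delta_mx 0 r *m 'J phi x) =
    'D_(delta_mx 0 p) (fun z => Ga z q r) x + 'D_(delta_mx 0 q) (fun z => Ga z p r) x -
    'D_(delta_mx 0 r) (fun z => Ga z p q) x.
  rewrite -deriveJ//; apply: (etrans K).
  exact: (congr2 (fun a b => a - b) (congr2 +%R (pE q r p) (pE p r q)) (pE p q r)).
have XE : (X *m (Gb (phi x) *m ('J phi x)^T)) 0 r =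
    ip (Gb (phi x)) X (delta_mx 0 r *m 'J phi x).
  by rewrite /ip trmx_mul trmx_delta !mulmxA -colE [RHS]mxE.
have YE : (Y *m (Gb (phi x) *m ('J phi x)^T)) 0 r = christoffel_lower Ga x p q r.
  by rewrite -(christoffel_lowerE p q r (Gau Wx) (Gas Wx)) GJ// /Y !mulmxA.
by rewrite XE YE /christoffel_lower -K mulrA mulVf ?mul1r.
Qed.

Section AlongMap.
Context {V : normedModType R}.
Variables (O : set V) (ya yb : V -> 'rV[R]_d).
Hypotheses (oO : open O) (Cya : Ck 2 O ya) (OW : forall t, O t -> Wa (ya t)).
Hypothesis (ybE : forall t, O t -> yb t = phi (ya t)).

Lemma tangent_change t v : O t -> 'D_v yb t = 'D_v ya t *m 'J phi (ya t).
Proof.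
move=> Ot; rewrite -deriveJ; last exact: OW.
rewrite -derive_chain; [|exact: Ck_diff Cya Ot|exact: Ck_diff Cphi (OW Ot)].
exact/near_eq_derive/(open_near oO Ot).
Qed.

(** The second derivatives of [phi] brought in by the product and chain rules
    are those of [christoffel_change]. *)
Lemma nabla_change t v w : O t ->
  nabla Gb yb ('D_w yb) v t = nabla Ga ya ('D_w ya) v t *m 'J phi (ya t).
Proof.
move=> Ot; have Wt := OW Ot.
have dya := Ck_diff Cya Ot; have dD := Ck_diff (Ck_derive w Cya) Ot.
have dphik k := Ck_diff (Ck_derive (delta_mx 0 k) Cphi) Wt.
have E s : O s -> 'D_w yb s = \sum_k ('D_w ya s) 0 k *: 'D_(delta_mx 0 k) phi (ya s).
  move=> Os; rewrite tangent_change// -deriveJ ?derive_row//; last exact: OW.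
  exact: Ck_diff Cphi (OW Os).
have rJ k : 'D_(delta_mx 0 k) phi (ya t) = row k ('J phi (ya t)).
  by rewrite deriveJ// rowE.
have DD : 'D_v ('D_w yb) t = 'D_v ('D_w ya) t *m 'J phi (ya t) +
   \sum_k \sum_p (('D_w ya t) 0 k * ('D_v ya t) 0 p) *:
      'D_(delta_mx 0 p) ('D_(delta_mx 0 k) phi) (ya t).
  apply/rowP => j.
  have dk k : differentiable (fun s => ('D_w ya s) 0 k) t
      by exact: differentiable_entry.
  have dpk k : differentiable (fun z => ('D_(delta_mx 0 k) phi z) 0 j) (ya t).
    exact: differentiable_entry.
  have dpkt k : differentiable (fun s => ('D_(delta_mx 0 k) phi (ya s)) 0 j) t.
    exact: (differentiable_comp dya (dpk k)).
  have EE : \near t, ('D_w yb t) =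
      \sum_k ('D_w ya t) 0 k *: 'D_(delta_mx 0 k) phi (ya t).
    exact: (open_near oO Ot).
  rewrite (near_eq_derive _ EE) derive_mxE; last first.
    apply: differentiable_mx => i l.
    rewrite (_ : (fun _ => _) =
        \sum_k (fun s => ('D_w ya s) 0 k * ('D_(delta_mx 0 k) phi (ya s)) i l)).
      apply: differentiable_sum => k; apply: differentiableM => //.
      apply: (@differentiable_comp _ _ _ _ ya
          (fun z => ('D_(delta_mx 0 k) phi z) i l)) => //.
      exact: differentiable_entry.
    by apply/funext => s; rewrite summxE fct_sumE; apply: eq_bigr => k _; rewrite mxE.
  rewrite (_ : (fun _ => _) =
      \sum_k (fun s => ('D_w ya s) 0 k * ('D_(delta_mx 0 k) phi (ya s)) 0 j));
      last first.
    by apply/funext => s; rewrite summxE fct_sumE; apply: eq_bigr => k _; rewrite mxE.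
  rewrite derive_sum; last by move=> k; apply: diff_derivable; exact: differentiableM.
  rewrite [RHS]mxE summxE [X in _ = X + _]mxE -big_split/=; apply: eq_bigr => k _.
  rewrite deriveM; [|exact: diff_derivable|exact: diff_derivable].
  rewrite -(derive_mxE v 0 k dD) [LHS]addrC; congr (_ + _).
    by rewrite rJ mxE [LHS]mulrC.
  rewrite summxE [X in _ *: X = _](derive_chain_row v dya (dpk k)) scaler_sumr.
  apply: eq_bigr => p _.
  rewrite [RHS]mxE scalerA.
  exact: (congr1 (fun z => _ * z) (esym (derive_mxE _ 0 j (dphik k)))).
rewrite {1}/nabla DD ybE// !tangent_change// /nabla mulmxDl -addrA; congr (_ + _).
rewrite mulmx_sum_row Gamma_suml.
under [X in _ + X]eq_bigr do rewrite GammaZl [in X in Gamma _ _ _ X]mulmx_sum_row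
    Gamma_sumr scaler_sumr.
rewrite [X in X + _]exchange_big/= -big_split/= [Gamma Ga _ _ _]GammaE mulmx_suml.
apply: eq_bigr => p _; rewrite -big_split/= mulmx_suml; apply: eq_bigr => q _.
rewrite GammaZr scalerA -scalemxAl -christoffel_change// /nabla scalerDr
    [in X in X + _]mulrC.
by rewrite -!rJ.
Qed.

End AlongMap.
End ChartChange.

(** * The normal field in a moving frame *)

Section MovingFrame.
Context {R : realType} {n : nat}.
Variables (G : 'rV[R]_n.+1 -> 'M[R]_n.+1) (W : set 'rV[R]_n.+1).
Hypotheses (oW : open W) (CG : Ck 4 W G).
Hypotheses (Gneg : forall x, W x -> \det (G x) < 0)
    (Gs : forall x, W x -> (G x)^T = G x).
Variables (O : set 'rV[R]_n) (y : 'rV[R]_n -> 'rV[R]_n.+1) (N : 'rV[R]_n.+1).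
Hypotheses (oO : open O) (Cy : Ck 4 O y) (OW : forall u, O u -> W (y u)).
Implicit Types (u : 'rV[R]_n) (i j : 'I_n).

Notation e i := (delta_mx 0 i).

(** The last vector is a fixed transversal [N] and not the normal, which is
    tangent to the hypersurface at light-like points and so cannot complete a
    frame there. *)
Definition frame_mx u : 'M[R]_n.+1 :=
  \matrix_(k < n.+1) (if unlift ord_max k is Some i then 'D_(e i) y u else N).

Hypothesis Eu : forall u, O u -> \det (frame_mx u) != 0.

(** The Lorentzian volume of the frame, called [omega] below; the determinant
    of the metric is negative. *)
Definition frame_vol u := Num.sqrt (- \det (G (y u))) * \det (frame_mx u).

(** The solution of [g(nu, F_{u_i}) = 0] and [g(nu, N) = omega]. *)
Definition chart_nu u : 'rV[R]_n.+1 :=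
  (frame_vol u *: delta_mx 0 ord_max) *m invmx (G (y u) *m (frame_mx u)^T).
Definition frame_gram u := frame_mx u *m G (y u) *m (frame_mx u)^T.

(** The components of [nu] on the [F_{u_i}], see [chart_nu_coord]. *)
Definition nu_tan u : 'rV[R]_n :=
    \row_i (frame_vol u * invmx (frame_gram u) ord_max (lift ord_max i)).
Definition chart_SF u : 'M[R]_n :=
    \matrix_(i, j) ip (G (y u)) ('D_(e i) y u) ('D_(e j) y u).
Definition chart_BF u := \det (chart_SF u).
Definition chart_hF u i j := ip (G (y u)) (nabla G y ('D_(e j) y) (e i) u) (chart_nu u).
Definition chart_AF u := \sum_i \sum_j cofactor (chart_SF u) i j * chart_hF u i j.

(** The part of the derivatives of [nu] that its orthogonality to the
    hypersurface does not determine. *)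
Definition nu_drift u i := ip (G (y u)) N (nabla G y chart_nu (e i) u).

(** The factor [lambda] in [D_V nu = lambda nu], see [nu_autoparallel]. *)
Definition nu_accel u := (\sum_i nu_tan u 0 i * nu_drift u i) / frame_vol u.

(** The coefficient of [B] in [BF_along_nu]. *)
Definition BF_rate u := 2 *
    (nu_accel u - \sum_i \sum_j invmx (frame_gram u) (lift ord_max i)
    (lift ord_max j) * chart_hF u i j).

Lemma frame_mx_lift u i : row (lift ord_max i) (frame_mx u) = 'D_(e i) y u.
Proof. by apply/rowP => k; rewrite !mxE liftK. Qed.

Lemma frame_mx_max u : row ord_max (frame_mx u) = N.
Proof. by apply/rowP => k; rewrite !mxE unlift_none. Qed.

Let Gu x : W x -> G x \in unitmx.
Proof. by move=> /Gneg h; rewrite unitmxE unitfE lt_eqF. Qed.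

Let Eunit u : O u -> frame_mx u \in unitmx.
Proof. by move=> /Eu; rewrite unitmxE unitfE. Qed.

Lemma frame_vol_neq0 u : O u -> frame_vol u != 0.
Proof.
move=> Ou; rewrite mulf_neq0 ?Eu// gt_eqF// sqrtr_gt0 oppr_gt0.
exact/Gneg/OW.
Qed.

Let GEu u : O u -> G (y u) *m (frame_mx u)^T \in unitmx.
Proof. by move=> Ou; rewrite unitmx_mul unitmx_tr Eunit// Gu//; exact: OW. Qed.

Lemma chart_nuE u : O u ->
    chart_nu u *m (G (y u) *m (frame_mx u)^T) = frame_vol u *: delta_mx 0 ord_max.
Proof. by move=> Ou; rewrite /chart_nu mulmxKV// GEu. Qed.

Lemma ip_row (x : 'rV[R]_n.+1) u k :
  ip (G (y u)) x (row k (frame_mx u)) = (x *m (G (y u) *m (frame_mx u)^T)) 0 k.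
Proof. by rewrite /ip rowE trmx_mul trmx_delta !mulmxA -colE [LHS]mxE. Qed.

Lemma ip_nu_tangent u i : O u -> ip (G (y u)) (chart_nu u) ('D_(e i) y u) = 0.
Proof.
by move=> Ou; rewrite -frame_mx_lift ip_row chart_nuE// !mxE eq_sym
    (negPf (neq_lift _ _)) mulr0.
Qed.

Lemma ip_nu_N u : O u -> ip (G (y u)) (chart_nu u) N = frame_vol u.
Proof. by move=> Ou; rewrite -(frame_mx_max u) ip_row chart_nuE// !mxE !eqxx mulr1. Qed.

Lemma frame_ext u (x x' : 'rV[R]_n.+1) : O u ->
  (forall i, ip (G (y u)) x ('D_(e i) y u) = ip (G (y u)) x' ('D_(e i) y u)) ->
  ip (G (y u)) x N = ip (G (y u)) x' N -> x = x'.
Proof.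
move=> Ou ht hN; rewrite -[x](mulmxK (GEu Ou)) -[x'](mulmxK (GEu Ou)); congr (_ *m _).
apply/rowP => k; rewrite -!ip_row.
have [i ->|->] := unliftP ord_max k; first by rewrite frame_mx_lift ht.
by rewrite frame_mx_max hN.
Qed.

Lemma frame_gram_unit u : O u -> frame_gram u \in unitmx.
Proof. by move=> Ou; rewrite /frame_gram -mulmxA unitmx_mul Eunit// GEu. Qed.

Lemma frame_gram_sym u : O u -> (frame_gram u)^T = frame_gram u.
Proof. by move=> Ou; rewrite /frame_gram !trmx_mul trmxK Gs ?mulmxA//; exact: OW. Qed.

Lemma frame_gram_det u : O u -> \det (frame_gram u) = - frame_vol u ^+ 2.
Proof.
move=> Ou; rewrite /frame_gram !det_mulmx det_tr /frame_vol exprMn sqr_sqrtr;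
    first by ring.
by rewrite oppr_ge0 ltW// Gneg//; exact: OW.
Qed.

Lemma frame_gram_minor u : row' ord_max (col' ord_max (frame_gram u)) = chart_SF u.
Proof.
apply/matrixP => i j.
transitivity (frame_gram u (lift ord_max i) (lift ord_max j)); first by rewrite !mxE.
rewrite [RHS]mxE -!frame_mx_lift ip_row /frame_gram -mulmxA.
by rewrite -row_mul [RHS]mxE.
Qed.

Lemma adj_frame_gram u : O u ->
    \adj (frame_gram u) = \det (frame_gram u) *: invmx (frame_gram u).
Proof. by move=> Ou; rewrite /invmx frame_gram_unit// scalerA mulfV ?scale1r// -unitfE
    -unitmxE frame_gram_unit. Qed.

Lemma inv_frame_gram_max u : O u ->
    invmx (frame_gram u) ord_max ord_max = - chart_BF u / frame_vol u ^+ 2.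
Proof.
move=> Ou; have h : (\adj (frame_gram u)) ord_max ord_max = chart_BF u.
  rewrite mxE /cofactor -signr_odd oddD addbb mul1r /chart_BF -frame_gram_minor.
  by [].
move: h; rewrite adj_frame_gram// mxE frame_gram_det// => <-.
have := frame_vol_neq0 Ou; set a := frame_vol u; set b := invmx _ _ _ => a0.
by field.
Qed.

(** The frame coordinates of [nu] are [omega] times the last row of the
    inverse Gram matrix, the last entry of which is
    [B / \det K = - B / omega ^+ 2]. *)
Lemma chart_nu_coord u : O u ->
  chart_nu u = \sum_i nu_tan u 0 i *: 'D_(e i) y u + (- chart_BF u / frame_vol u) *: N.
Proof.
move=> Ou.
have -> : chart_nu u = (frame_vol u *: row ord_max (invmx (frame_gram u))) *m
    frame_mx u.
  apply: (can_inj (mulmxK (GEu Ou))); rewrite chart_nuE//.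
  by rewrite -scalemxAl -scalemxAl -mulmxA [frame_mx u *m _]mulmxA -/(frame_gram u)
      -row_mul mulVmx ?frame_gram_unit// row1.
rewrite mulmx_sum_row sum_ord_max frame_mx_max; congr (_ + _).
  by apply: eq_bigr => i _; rewrite frame_mx_lift !mxE.
rewrite !mxE inv_frame_gram_max//; congr (_ *: _).
by have := frame_vol_neq0 Ou; set a := frame_vol u => a0; field.
Qed.

Lemma ip_nu_nu u : O u -> ip (G (y u)) (chart_nu u) (chart_nu u) = - chart_BF u.
Proof.
move=> Ou; rewrite {2}chart_nu_coord// ipDr ip_sumr big1 ?add0r; last first.
  by move=> i _; rewrite ipZr ip_nu_tangent// mulr0.
by rewrite ipZr ip_nu_N// divfK ?frame_vol_neq0.
Qed.

Lemma inv_frame_gram_sym u a b : O u ->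
    invmx (frame_gram u) a b = invmx (frame_gram u) b a.
Proof. by move=> Ou; rewrite -{1}(frame_gram_sym Ou) -trmx_inv mxE. Qed.

Lemma chart_SF_sym u : O u -> (chart_SF u)^T = chart_SF u.
Proof. by move=> Ou; apply/matrixP => i j; rewrite !mxE ipC// Gs//; exact: OW. Qed.

(** Jacobi's identity divided by [\det K = - omega ^+ 2]. At light-like points
    the cofactor matrix has rank at most one. *)
Lemma cofactor_chart_SF u i j : O u -> cofactor (chart_SF u) i j =
  chart_BF u * invmx (frame_gram u) (lift ord_max i) (lift ord_max j) +
      nu_tan u 0 i * nu_tan u 0 j.
Proof.
move=> Ou.
have -> : cofactor (chart_SF u) i j = (\adj (chart_SF u)) i j.
  by rewrite mxE -[in RHS](chart_SF_sym Ou) cofactor_tr.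
have dK : \det (frame_gram u) != 0 by rewrite -unitfE -unitmxE frame_gram_unit.
apply: (mulfI dK); rewrite -frame_gram_minor jacobi_minor adj_frame_gram//.
rewrite [in LHS]mxE [X in _ * X - _]mxE [X in _ - X * _]mxE [X in _ - _ * X]mxE.
rewrite inv_frame_gram_max// !mxE frame_gram_det//.
rewrite (inv_frame_gram_sym (lift ord_max i) ord_max Ou).
have := frame_vol_neq0 Ou; set a := frame_vol u; set b := invmx _ _ _;
    set c := invmx _ _ _; set d := invmx _ _ _ => a0.
by field.
Qed.

End MovingFrame.

(** * Derivatives of the normal field *)

Section MovingFrameCalculus.
Context {R : realType} {n : nat}.
Variables (G : 'rV[R]_n.+1 -> 'M[R]_n.+1) (W : set 'rV[R]_n.+1).
Hypotheses (oW : open W) (CG : Ck 4 W G).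
Hypotheses (Gneg : forall x, W x -> \det (G x) < 0)
    (Gs : forall x, W x -> (G x)^T = G x).
Variables (O : set 'rV[R]_n) (y : 'rV[R]_n -> 'rV[R]_n.+1) (N : 'rV[R]_n.+1).
Hypotheses (oO : open O) (Cy : Ck 4 O y) (OW : forall u, O u -> W (y u)).
Implicit Types (u : 'rV[R]_n) (i j : 'I_n).
Hypothesis Eu : forall u, O u -> \det (frame_mx y N u) != 0.

Notation e i := (delta_mx 0 i).
Notation frame_vol := (frame_vol G y N).
Notation chart_nu := (chart_nu G y N).
Notation frame_gram := (frame_gram G y N).
Notation nu_tan := (nu_tan G y N).
Notation chart_SF := (chart_SF G y).
Notation chart_BF := (chart_BF G y).
Notation chart_hF := (chart_hF G y N).
Notation chart_AF := (chart_AF G y N).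
Notation nu_drift := (nu_drift G y N).
Notation nu_accel := (nu_accel G y N).
Notation BF_rate := (BF_rate G y N).

Let Gu x : W x -> G x \in unitmx.
Proof. by move=> /Gneg h; rewrite unitmxE unitfE lt_eqF. Qed.

Let CG1 : Ck 1 W G. Proof. exact: Ck_le oW _ CG. Qed.

Lemma Ck_ip k (a b : 'rV[R]_n -> 'rV[R]_n.+1) (g : 'rV[R]_n -> 'M[R]_n.+1) :
  Ck k O g -> Ck k O a -> Ck k O b -> Ck k O (fun u => ip (g u) (a u) (b u)).
Proof.
move=> Cg Ca Cb; have := Ck_mulmx oO (Ck_mulmx oO Ca Cg) (Ck_trmx oO Cb).
by move=> /(Ck_mxP _ _ oO)/(_ 0 0).
Qed.

Lemma Ck_comp_mx k a b (g : 'rV[R]_n.+1 -> 'M[R]_(a, b)) :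
  (k <= 4)%N -> Ck k W g -> Ck k O (g \o y).
Proof.
move=> k4 Cg; apply/(Ck_mxP _ _ oO) => i j.
exact: (@Ck_comp _ _ _ _ O W y (fun x => g x i j)) oO oW OW (Ck_le oO k4 Cy)
    ((Ck_mxP _ _ oW).1 Cg i j).
Qed.

Lemma Ck_Gy k : (k <= 4)%N -> Ck k O (fun u => G (y u)).
Proof. by move=> k4; apply: Ck_comp_mx => //; exact: Ck_le oW k4 CG. Qed.

Lemma Ck_frame : Ck 3 O (frame_mx y N).
Proof.
apply/(Ck_mxP _ _ oO) => a b; rewrite /frame_mx.
have [i ai|ai] := unliftP ord_max a.
  have := (Ck_mxP _ _ oO).1 (Ck_derive (e i) Cy) 0 b.
  by apply: eq_Ck => // u _; rewrite mxE ai liftK.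
by apply: eq_Ck (Ck_cst 3 (N 0 b) oO) => // u _; rewrite mxE ai unlift_none.
Qed.

Lemma Ck_frame_vol : Ck 3 O frame_vol.
Proof.
apply: CkM => //; last exact: Ck_det Ck_frame.
apply: Ck_sqrt => //; first by move=> u /OW/Gneg; rewrite oppr_gt0.
by apply: CkN => //; apply: Ck_det => //; exact: Ck_Gy.
Qed.

Lemma Ck_chart_nu : Ck 3 O chart_nu.
Proof.
apply: Ck_mulmx => //.
  apply/(Ck_mxP _ _ oO) => a b.
  apply: eq_Ck (CkM oO Ck_frame_vol
      (Ck_cst 3 ((delta_mx 0 ord_max : 'rV[R]_n.+1) a b) oO)) => // u _.
  by rewrite [RHS]mxE.
apply: Ck_invmx => //.
  move=> u Ou; rewrite unitmx_mul unitmx_tr Gu; last exact: OW.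
  by rewrite unitmxE unitfE Eu.
by apply: Ck_mulmx => //; [exact: Ck_Gy|exact: Ck_trmx Ck_frame].
Qed.

Lemma Ck_inv_frame_gram : Ck 3 O (fun u => invmx (frame_gram u)).
Proof.
apply: Ck_invmx => //; first by move=> u Ou; exact: (frame_gram_unit Gneg OW Eu Ou).
apply: Ck_mulmx => //; last exact: Ck_trmx Ck_frame.
by apply: Ck_mulmx => //; [exact: Ck_frame|exact: Ck_Gy].
Qed.

Lemma Ck_nu_tan : Ck 3 O nu_tan.
Proof.
apply/(Ck_mxP _ _ oO) => a i.
have := CkM oO Ck_frame_vol
    ((Ck_mxP _ _ oO).1 Ck_inv_frame_gram ord_max (lift ord_max i)).
by apply: eq_Ck => // u _; rewrite mxE.
Qed.

Lemma Ck_chart_SF : Ck 3 O chart_SF.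
Proof.
apply/(Ck_mxP _ _ oO) => i j.
have := Ck_ip (Ck_Gy (isT : (3 <= 4)%N)) (Ck_derive (e i) Cy) (Ck_derive (e j) Cy).
by apply: eq_Ck => // u _; rewrite mxE.
Qed.

Lemma Ck_chart_BF : Ck 3 O chart_BF.
Proof. exact: Ck_det Ck_chart_SF. Qed.

Lemma Ck_christoffel_of a p q : Ck 3 W (fun x => christoffel_of G x a p q).
Proof.
have dG v (i j : 'I_n.+1) : Ck 3 W ('D_v (fun x => G x i j)).
  by apply: Ck_derive; exact: (Ck_mxP _ _ oW).1 CG i j.
apply: CkM => //; first exact: Ck_cst.
apply: Ck_sum => // l; apply: CkM => //; last by apply: CkB => //; apply: CkD.
have := Ck_invmx oW Gu CG => /(Ck_mxP _ _ oW)/(_ a l).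
exact: Ck_le.
Qed.

Lemma Ck_nabla k (Z : 'rV[R]_n -> 'rV[R]_n.+1) v : (k <= 3)%N ->
  Ck k.+1 O Z -> Ck k O (nabla G y Z v).
Proof.
move=> k3 CZ; apply: CkD => //; first exact: Ck_derive.
have Cdy : Ck k O ('D_v y) by apply: Ck_le oO k3 (Ck_derive v Cy).
have CZ' : Ck k O Z by exact: CkS.
apply/(Ck_mxP _ _ oO) => a b.
apply: (@eq_Ck _ _ _ _ _ (fun u =>
    \sum_p \sum_q christoffel_of G (y u) b p q * ('D_v y u) 0 p * Z u 0 q)) => //.
  by move=> u _; rewrite mxE.
apply: Ck_sum => // p; apply: Ck_sum => // q; apply: CkM => //; last first.
  exact: (Ck_mxP _ _ oO).1 CZ' 0 q.
apply: CkM => //; last exact: (Ck_mxP _ _ oO).1 Cdy 0 p.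
apply: (@Ck_comp _ _ _ _ O W y (fun x => christoffel_of G x b p q)) => //.
  by apply: Ck_le Cy => //; exact: leq_trans k3 _.
exact: Ck_le oW k3 (Ck_christoffel_of b p q).
Qed.

Lemma Ck_chart_hF i j : Ck 2 O (fun u => chart_hF u i j).
Proof.
apply: Ck_ip; first exact: Ck_Gy.
  by apply: Ck_nabla => //; exact: Ck_derive.
exact: Ck_le oO _ Ck_chart_nu.
Qed.

Lemma Ck_chart_AF : Ck 2 O chart_AF.
Proof.
apply: Ck_sum => // i; apply: Ck_sum => // j; apply: CkM => //; last exact: Ck_chart_hF.
by apply: Ck_cofactor => //; exact: Ck_le oO _ Ck_chart_SF.
Qed.

Lemma Ck_nu_accel : Ck 2 O nu_accel.
Proof.
apply: CkM => //; last first.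
  apply: CkV => //; first by move=> u Ou; exact: (frame_vol_neq0 Gneg OW Eu).
  exact: Ck_le oO _ Ck_frame_vol.
apply: Ck_sum => // i; apply: CkM => //.
  by have /(Ck_mxP _ _ oO)/(_ 0 i) := Ck_nu_tan; exact: Ck_le.
apply: Ck_ip; [exact: Ck_Gy|exact: Ck_cst|].
by apply: Ck_nabla => //; exact: Ck_chart_nu.
Qed.

Lemma Ck_BF_rate : Ck 2 O BF_rate.
Proof.
apply: CkM => //; first exact: Ck_cst.
apply: CkB => //; first exact: Ck_nu_accel.
apply: Ck_sum => // i; apply: Ck_sum => // j; apply: CkM => //; last exact: Ck_chart_hF.
by have /(Ck_mxP _ _ oO)/(_ (lift ord_max i) (lift ord_max j)) := Ck_inv_frame_gram;
    exact: Ck_le.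
Qed.

Let dnu u : O u -> differentiable chart_nu u. Proof. exact: Ck_diff Ck_chart_nu. Qed.
Let dy u : O u -> differentiable y u. Proof. exact: Ck_diff Cy. Qed.
Let ddy u v : O u -> differentiable ('D_v y) u. Proof. exact: Ck_diff
    (Ck_derive v Cy). Qed.

Lemma chart_hF_nu u i j : O u ->
    chart_hF u i j = - ip (G (y u)) ('D_(e j) y u) (nabla G y chart_nu (e i) u).
Proof.
move=> Ou.
have mc := metric_compatible oW CG1 Gu Gs (OW Ou) (dy Ou) (e i) (ddy (e j) Ou) (dnu Ou).
have z : 'D_(e i) (fun t => ip (G (y t)) ('D_(e j) y t) (chart_nu t)) u = 0.
  rewrite (@near_eq_derive _ _ _ _ (cst 0)) ?derive_cst//.
  apply: (open_near oO Ou) => t Ot; rewrite (ipC _ _ (Gs (OW Ot))).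
  exact: (ip_nu_tangent Gneg OW Eu).
by apply/eqP; rewrite -addr_eq0; apply/eqP; exact: (etrans (esym mc) z).
Qed.

Lemma derive_chart_BF u i : O u ->
    'D_(e i) chart_BF u =
    - (2 * ip (G (y u)) (chart_nu u) (nabla G y chart_nu (e i) u)).
Proof.
move=> Ou.
have mc := metric_compatible oW CG1 Gu Gs (OW Ou) (dy Ou) (e i) (dnu Ou) (dnu Ou).
have z : 'D_(e i) (fun t => ip (G (y t)) (chart_nu t) (chart_nu t)) u =
    - 'D_(e i) chart_BF u.
  rewrite -deriveN; last exact/diff_derivable/(Ck_diff Ck_chart_BF Ou).
  apply: near_eq_derive; apply: (open_near oO Ou) => t Ot.
  by rewrite (ip_nu_nu Gneg OW Eu Ot).
apply/eqP; rewrite -eqr_oppLR -z mc; apply/eqP.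
by rewrite (ipC _ (chart_nu u) (Gs (OW Ou))); ring.
Qed.

(** One has [h(., F_{u_j}) = - g(F_{u_j}, D nu)]. Summing against [V] replaces
    [F_{u_j}] by [nu + (B / omega) N], and [g(nu, D nu) = - dB / 2]. *)
Lemma nu_tan_hF u i : O u -> \sum_j nu_tan u 0 j * chart_hF u i j =
  2^-1 * 'D_(e i) chart_BF u - chart_BF u / frame_vol u * nu_drift u i.
Proof.
move=> Ou.
transitivity (- ip (G (y u)) (\sum_j nu_tan u 0 j *: 'D_(e j) y u)
    (nabla G y chart_nu (e i) u)).
  rewrite ip_suml -sumrN; apply: eq_bigr => j _.
  by rewrite chart_hF_nu// ipZl mulrN.
have -> : \sum_j nu_tan u 0 j *: 'D_(e j) y u = chart_nu u -
    (- chart_BF u / frame_vol u) *: N.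
  by rewrite {1}(chart_nu_coord Gneg OW Eu Ou) addrK.
rewrite ipDl ipNl ipZl derive_chart_BF// /nu_drift; field.
exact: (frame_vol_neq0 Gneg OW Eu).
Qed.

Lemma chart_hF_sym u i j : O u -> chart_hF u i j = chart_hF u j i.
Proof.
move=> Ou; have Cy2 : Ck 2 O y by exact: Ck_le Cy.
exact: (congr1 (fun z => ip _ z _) (torsion_free oW Gs oO Cy2 OW (e i) (e j) Ou)).
Qed.

(** By [cofactor_chart_SF], the mean curvature [A] is [B tr(H h) + h(V, V)]
    with [H] the tangential block of [K^-1]; [nu_tan_hF] expresses [h(V, V)]
    by [V(B)]. *)
Lemma BF_along_nu u : O u ->
    'D_(nu_tan u) chart_BF u = 2 * chart_AF u + BF_rate u * chart_BF u.
Proof.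
move=> Ou; rewrite derive_row; last exact: Ck_diff Ck_chart_BF Ou.
have AE : chart_AF u = chart_BF u *
    (\sum_i \sum_j invmx (frame_gram u) (lift ord_max i) (lift ord_max j) *
    chart_hF u i j) +
    \sum_i nu_tan u 0 i * \sum_j nu_tan u 0 j * chart_hF u i j.
  rewrite /chart_AF mulr_sumr -big_split/=; apply: eq_bigr => i _.
  rewrite mulr_sumr mulr_sumr -big_split/=; apply: eq_bigr => j _.
  by rewrite (cofactor_chart_SF Gneg Gs OW Eu)//; ring.
have E2 : \sum_i nu_tan u 0 i * \sum_j nu_tan u 0 j * chart_hF u i j =
    2^-1 * (\sum_i nu_tan u 0 i * 'D_(e i) chart_BF u) - chart_BF u * nu_accel u.
  rewrite /nu_accel mulr_sumr mulr_suml mulr_sumr -sumrB; apply: eq_bigr => i _.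
  by rewrite nu_tan_hF//; ring.
rewrite /BF_rate AE E2.
set T := \sum_i \sum_j _; set D := \sum_i nu_tan u 0 i * _.
by field.
Qed.

(** The two sides have the same products with the frame: with [F_{u_j}], the
    left-hand side gives [- h(V, F_{u_j})], which vanishes with [B] and [dB]
    by [nu_tan_hF]; with [N], this is the definition of [nu_accel]. *)
Lemma nu_autoparallel u : O u -> chart_BF u = 0 ->
    (forall i, 'D_(e i) chart_BF u = 0) ->
  \sum_i nu_tan u 0 i *: nabla G y chart_nu (e i) u = nu_accel u *: chart_nu u.
Proof.
move=> Ou B0 dB0; apply: (frame_ext Gneg OW Eu Ou) => [j|].
  rewrite ipZl (ip_nu_tangent Gneg OW Eu _ Ou) mulr0 ip_suml.
  transitivity (- \sum_i nu_tan u 0 i * chart_hF u j i).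
    rewrite -sumrN; apply: eq_bigr => i _.
    by rewrite ipZl ipC ?Gs//;
        [rewrite chart_hF_sym// chart_hF_nu// mulrN opprK|exact: OW].
  by rewrite nu_tan_hF// B0 dB0 !mul0r mulr0 subr0 oppr0.
rewrite ipZl (ip_nu_N Gneg OW Eu Ou) /nu_accel divfK;
    last exact: (frame_vol_neq0 Gneg OW Eu).
rewrite ip_suml; apply: eq_bigr => i _.
by rewrite ipZl ipC// Gs//; exact: OW.
Qed.

End MovingFrameCalculus.

(** * Critical points forced by nonzero mean curvature *)

Section CMCDegenerate.
Context {R : realType} {V : normedModType R}.

Lemma powR_32_sqr (x : R) : 0 <= x -> (x `^ (3 / 2)) ^+ 2 = x ^+ 3.
Proof.
by move=> x0; rewrite -powR_mulrn ?powR_ge0// -powRrM divfK// powR_mulrn.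
Qed.

(** Being of order [`|B|] to the power 3/2, [A] is small against [B] near the
    zeros of [B]. *)
Lemma cmc_le (A B K e : R) : 0 <= e -> A ^+ 2 = K ^+ 2 * `|B| ^+ 3 ->
    K ^+ 2 * `|B| <= e ^+ 2 ->
  `|A| <= e * `|B|.
Proof.
move=> e0 AE Be; rewrite -(@ler_pXn2r _ 2)// ?nnegrE ?mulr_ge0//.
rewrite real_normK ?num_real// AE exprS mulrA exprMn ler_wpM2r// exprn_ge0//.
Qed.

Lemma derive_small (f : R -> R) (l e : R) : 0 < e -> is_derive (0 : R) 1 f l ->
  \forall h \near (0 : R), `|f h - f 0 - h * l| <= e * `|h|.
Proof.
move=> e0 [df Df]; move: df; rewrite /derivable -[X in _ --> X]/('D_1 f 0) Df.
move=> /cvgrPdist_le/(_ e e0); rewrite near_withinE; apply: filterS => h.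
have [-> _|h0 /(_ isT) /=] := eqVneq h 0;
    first by rewrite subrr mul0r subrr normr0 mulr0.
rewrite addr0 [h *: 1]mulr1 => H;
    rewrite -(ler_pM2l (x := `|h|^-1)) ?invr_gt0 ?normr_gt0//.
rewrite mulrCA mulVf ?normr_eq0// mulr1 -normfV -normrM; apply: le_trans H.
by rewrite distrC mulrBr mulrA mulVf// mul1r.
Qed.

(** Suppose that [B] has nonzero derivative in the direction [v]. By [cmc_le]
    the derivative of [A] in this direction is zero, hence [A (p + t *: v)] is
    of order [t ^+ 2] and its square of order [t ^+ 4], whereas
    [`|B (p + t *: v)| ^+ 3] is at least of order [t ^+ 3]. *)
Lemma cmc_critical (O : set V) (A B : V -> R) (K : R) p : open O -> O p -> K != 0 ->
  Ck 2 O A -> Ck 1 O B -> (forall x, O x -> A x ^+ 2 = K ^+ 2 * `|B x| ^+ 3) ->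
  B p = 0 -> forall v, 'D_v B p = 0.
Proof.
move=> oO Op K0 CA CB AE B0 v; apply/eqP/negPn/negP => bn0.
pose b := `|'D_v B p|; have b0 : 0 < b by rewrite normr_gt0.
have dA x : O x -> differentiable A x by exact: Ck_diff CA.
have dB x : O x -> differentiable B x by exact: Ck_diff CB.
have A0 : A p = 0 by apply/eqP; rewrite -sqrf_eq0 AE// B0 normr0 expr0n mulr0.
have cB : {for p, continuous B} by exact: (Ck_continuous oO CB).
have K2 : 0 < K ^+ 2 by rewrite exprn_even_gt0.
have DA : 'D_v A p = 0.
  apply/eqP; rewrite -normr_le0; apply/ler_addgt0Pr => e e0; rewrite add0r.
  pose e1 := e / b; have e10 : 0 < e1 by rewrite divr_gt0.
  have -> : e = e1 * b by rewrite /e1 divfK ?gt_eqF.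
  apply: derive_dominated => //; [exact/diff_derivable/dA|exact/diff_derivable/dB|].
  have e2 : 0 < e1 ^+ 2 / K ^+ 2 by rewrite divr_gt0// exprn_gt0.
  have N1 : \forall x \near p, `|B x| <= e1 ^+ 2 / K ^+ 2.
    move/cvgrPdist_le: cB => /(_ _ e2); apply: filterS => x.
    by rewrite B0 sub0r normrN.
  have := nbhs_and (open_nbhs_nbhs (conj oO Op)) N1.
  apply: filterS => x [Ox Bx]; apply: (cmc_le (ltW e10) (AE x Ox)).
  by rewrite mulrC -ler_pdivlMr.
have line (f : V -> R) : differentiable f p ->
    is_derive (0 : R) 1 (fun t : R => f (p + t *: v)) ('D_v f p).
  move=> df; have := @is_derive_line R V R f p v 0; rewrite scale0r addr0.
  by apply.
have [d /= d0 Hd] : nbhs_ball (0 : R) (fun h : R => [/\ O (p + h *: v),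
    `|B (p + h *: v) - h * 'D_v B p| <= b / 2 * `|h| &
    `|'D_v A (p + h *: v) - h * 'D_v ('D_v A) p| <= `|h|]).
  apply/nbhs_ballP.
  have N1 : \forall h \near (0 : R), O (p + h *: v).
    have c : {for (0 : R), continuous (fun h : R => p + h *: v)}.
      by apply: cvgD; [exact: cvg_cst|exact: scalel_continuous].
    apply: c; rewrite scale0r addr0; exact: (open_nbhs_nbhs (conj oO Op)).
  have N2 := derive_small (divr_gt0 b0 (ltr0Sn R 1)) (line B (dB p Op)).
  have N3 := derive_small ltr01 (line _ (Ck_diff (Ck_derive v CA) Op)).
  have N := nbhs_and N1 (nbhs_and N2 N3); apply: filterS N => h /=.
  by rewrite scale0r addr0 B0 DA !subr0 mul1r => -[? [? ?]]; split.
pose l := 'D_v ('D_v A) p; pose C := `|l| + 1.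
have C0 : 0 < C by rewrite ltr_wpDl.
have C2 : 0 < C ^+ 2 by rewrite exprn_gt0.
have X0 : 0 < K ^+ 2 * b ^+ 3 by rewrite mulr_gt0// exprn_gt0.
(* For this [t] the lower bound [K ^+ 2 * (b / 2 * t) ^+ 3] for [A ^+ 2]
   exceeds the upper bound [(C * t ^+ 2) ^+ 2]. *)
pose t := Num.min (d / 2) (K ^+ 2 * b ^+ 3 / (16 * C ^+ 2)).
have t0 : 0 < t.
  by rewrite lt_min !divr_gt0// mulr_gt0.
have td : t < d.
  apply: (@le_lt_trans _ _ (d / 2)); first by rewrite ge_min lexx.
  by rewrite ltr_pdivrMr// ltr_pMr// ltr1n.
have Hs s : 0 <= s <= t -> ball (0 : R) d s.
  move=> /andP[s0 st]; rewrite -ball_normE /= sub0r normrN ger0_norm//.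
  exact: le_lt_trans td.
have lt_t : 0 <= t <= t by rewrite lexx ltW.
have [Ot Bt _] := Hd _ (Hs t lt_t).
have Bbig : b / 2 * t <= `|B (p + t *: v)|.
  rewrite (ger0_norm (ltW t0)) in Bt.
  have h1 : `|t * 'D_v B p| = t * b by rewrite normrM (ger0_norm (ltW t0)).
  have := ler_normB (B (p + t *: v)) (B (p + t *: v) - t * 'D_v B p).
  by rewrite subKr h1; lra.
have [|s /andP[s0 st] As] := @mvt_line R V A p v t t0.
  by move=> s /Hs/Hd[Os _ _]; exact: dA.
have st' : 0 <= s <= t by rewrite !ltW.
have [_ _ As'] := Hd _ (Hs s st').
have Asmall : `|A (p + t *: v)| <= C * t ^+ 2.
  rewrite -[A _]subr0 -A0 As normrM (ger0_norm (ltW t0)) expr2 mulrCA ler_pM2l//.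
  have h1 : `|s * l| <= t * `|l|.
    by rewrite normrM (ger0_norm (ltW s0)) ler_wpM2r// ltW.
  rewrite (ger0_norm (ltW s0)) in As'.
  rewrite -[X in `|X|](subrK (s * l)); apply: (le_trans (ler_normD _ _)).
  have -> : C * t = t + t * `|l| by rewrite /C; ring.
  by apply: lerD => //; exact: le_trans As' (ltW st).
have h1 : K ^+ 2 * (b / 2 * t) ^+ 3 <= (C * t ^+ 2) ^+ 2.
  apply: (@le_trans _ _ (K ^+ 2 * `|B (p + t *: v)| ^+ 3)).
    rewrite ler_pM2l// lerXn2r// nnegrE// mulr_ge0// ?divr_ge0// ltW//.
  rewrite -AE// -(real_normK (num_real (A _))) lerXn2r// nnegrE// mulr_ge0
      ?exprn_ge0// ltW//.
have h2 : K ^+ 2 * b ^+ 3 <= 8 * C ^+ 2 * t.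
  have t3 : 0 < t ^+ 3 by rewrite exprn_gt0.
  rewrite -(ler_pM2r t3).
  have -> : K ^+ 2 * b ^+ 3 * t ^+ 3 = 8 * (K ^+ 2 * (b / 2 * t) ^+ 3) by field.
  have -> : 8 * C ^+ 2 * t * t ^+ 3 = 8 * (C * t ^+ 2) ^+ 2 by ring.
  by rewrite ler_pM2l.
have h3 : t <= K ^+ 2 * b ^+ 3 / (16 * C ^+ 2) by rewrite /t ge_min lexx orbT.
move: h3; rewrite ler_pdivlMr ?mulr_gt0// => h3.
suff : K ^+ 2 * b ^+ 3 <= 2^-1 * (K ^+ 2 * b ^+ 3) by lra.
by apply: (le_trans h2); rewrite -[X in _ <= 2^-1 * X]/(_); lra.
Qed.

End CMCDegenerate.

(** * The null geodesic in a chart *)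

Section CurveRegularity.
Context {R : realType}.

Lemma Ck_of_derive1 m k (J : set R) (f g : R -> 'rV[R]_m) : open J ->
  (forall t, J t -> is_derive t 1 f (g t)) -> Ck k J g -> Ck k.+1 J f.
Proof.
move=> oJ dfg Cg.
have df t : J t -> differentiable f t.
  by move=> Jt; apply/derivable1_diffP; have [] := dfg t Jt.
split=> // v.
have Cv : Ck k J (fun t => v *: g t).
  apply/(Ck_mxP _ _ oJ) => i j.
  have := CkM oJ (Ck_cst k v oJ) ((Ck_mxP _ _ oJ).1 Cg i j).
  by apply: eq_Ck => // t _; rewrite [RHS]mxE.
apply: eq_Ck Cv => // t Jt.
by rewrite -[X in 'D_X f t]mulr1 (@deriveZv _ _ _ f t v 1 (df t Jt))
    (@derive_val _ _ _ _ _ _ _ (dfg t Jt)).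
Qed.

Lemma Ck_of_derive1_scalar k (J : set R) (f g : R -> R) : open J ->
  (forall t, J t -> is_derive t 1 f (g t)) -> Ck k J g -> Ck k.+1 J f.
Proof.
move=> oJ dfg Cg.
have df t : J t -> differentiable f t.
  by move=> Jt; apply/derivable1_diffP; have [] := dfg t Jt.
split=> // v.
apply: eq_Ck (CkM oJ (Ck_cst k v oJ) Cg) => // t Jt.
by rewrite -[X in 'D_X f t]mulr1 (@deriveZv _ _ _ f t v 1 (df t Jt))
    (@derive_val _ _ _ _ _ _ _ (dfg t Jt)).
Qed.

(** A solution of class C^k has derivatives of class C^k as long as the
    right-hand sides are, here for [k <= 1]. *)
Lemma flow_C2 n (O : set 'rV[R]_n) (J : set R) (V : 'rV[R]_n -> 'rV[R]_n)
    (lam : 'rV[R]_n -> R) (g : R -> 'rV[R]_n) (s : R -> R) :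
  open O -> open J -> Ck 1 O V -> Ck 1 O lam ->
  (forall t, J t -> [/\ O (g t), is_derive t 1 g (s t *: V (g t)) &
     is_derive t 1 s (- (lam (g t) * s t ^+ 2))]) -> Ck 2 J g.
Proof.
move=> oO oJ CV Cl H.
have OJ t : J t -> O (g t) by move=> /H[].
have dg t : J t -> is_derive t 1 g (s t *: V (g t)) by move=> /H[].
have ds t : J t -> is_derive t 1 s (- (lam (g t) * s t ^+ 2)) by move=> /H[].
have step k : (k <= 1)%N -> Ck k J g -> Ck k J s -> Ck k.+1 J g /\ Ck k.+1 J s.
  move=> k1 Cg Cs; split.
    apply: (Ck_of_derive1 oJ dg); apply/(Ck_mxP _ _ oJ) => i j; rewrite (ord1 i).
    have CVj := (Ck_mxP _ _ oO).1 (Ck_le oO k1 CV) 0 j.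
    have := CkM oJ Cs (Ck_comp oJ oO OJ Cg CVj).
    by apply: eq_Ck => // t _; rewrite [RHS]mxE.
  apply: (Ck_of_derive1_scalar oJ ds).
  have := CkN oJ (CkM oJ (Ck_comp oJ oO OJ Cg (Ck_le oO k1 Cl)) (CkM oJ Cs Cs)).
  by apply: eq_Ck => // t _.
have Cg0 : Ck 0 J g.
  apply: Ck0P => // t Jt; apply/differentiable_continuous/derivable1_diffP.
  by have [] := dg t Jt.
have Cs0 : Ck 0 J s.
  apply: Ck0P => // t Jt; apply/differentiable_continuous/derivable1_diffP.
  by have [] := ds t Jt.
have [Cg1 Cs1] := step 0%N isT Cg0 Cs0.
by have [] := step 1%N isT Cg1 Cs1.
Qed.

End CurveRegularity.

Section ChartGeodesic.
Context {R : realType} {n : nat}.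
Variables (G : 'rV[R]_n.+1 -> 'M[R]_n.+1) (W : set 'rV[R]_n.+1).
Hypotheses (oW : open W) (CG : Ck 4 W G).
Hypotheses (Gneg : forall x, W x -> \det (G x) < 0)
    (Gs : forall x, W x -> (G x)^T = G x).
Variables (O : set 'rV[R]_n) (y : 'rV[R]_n -> 'rV[R]_n.+1) (N : 'rV[R]_n.+1).
Hypotheses (oO : open O) (Cy : Ck 4 O y) (OW : forall u, O u -> W (y u)).
Hypothesis Eu : forall u, O u -> \det (frame_mx y N u) != 0.
Notation e i := (delta_mx 0 i).
Notation chart_nu := (chart_nu G y N).
Notation nu_tan := (nu_tan G y N).
Notation chart_BF := (chart_BF G y).
Notation chart_AF := (chart_AF G y N).
Notation nu_accel := (nu_accel G y N).
Notation BF_rate := (BF_rate G y N).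

Variables (K : R) (p : 'rV[R]_n).
Hypotheses (Op : O p) (AK : forall u, O u ->
    chart_AF u ^+ 2 = K ^+ 2 * `|chart_BF u| ^+ 3).
Hypotheses (B0 : chart_BF p = 0) (dB0 : forall v, 'D_v chart_BF p = 0).

Let CB : Ck 3 O chart_BF. Proof. exact: (Ck_chart_BF oW CG oO Cy OW). Qed.
Let CV : Ck 3 O nu_tan. Proof. exact: (Ck_nu_tan oW CG Gneg oO Cy OW Eu). Qed.
Let Cl : Ck 2 O nu_accel. Proof. exact: (Ck_nu_accel oW CG Gneg oO Cy OW Eu). Qed.
Let Ckk : Ck 2 O BF_rate. Proof. exact: (Ck_BF_rate oW CG Gneg oO Cy OW Eu). Qed.
Let Cnu : Ck 3 O chart_nu. Proof. exact: (Ck_chart_nu oW CG Gneg oO Cy OW Eu). Qed.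

(** Where [`|B| <= 1] the relation between [A] and [B] gives
    [`|A| <= `|K| * `|B|], and [BF_rate] is locally bounded. *)
Lemma BF_along_nu_bound : exists2 r : R, 0 < r & ball p r `<=` O /\
  exists C : R, forall u, ball p r u ->
      `|'D_(nu_tan u) chart_BF u| <= C * `|chart_BF u|.
Proof.
have N1 : \forall u \near p, `|chart_BF u| <= 1.
  have /continuous_near_bounded := Ck_continuous oO CB Op.
  by rewrite B0 normr0 add0r.
have N2 := continuous_near_bounded (Ck_continuous oO Ckk Op).
have N3 := nbhs_and (open_nbhs_nbhs (conj oO Op)) (nbhs_and N1 N2).
have [r /= r0 Hr] := (nbhs_ballP _ _).1 N3.
exists r => //; split; first by move=> u /Hr[].
exists (2 * `|K| + (`|BF_rate p| + 1)) => u /Hr[Ou [Bu ku]].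
rewrite (BF_along_nu oW CG Gneg Gs oO Cy OW Eu Ou).
have h := AK Ou; move: (chart_AF u) (chart_BF u) (BF_rate u) (BF_rate p) Bu ku h =>
    a b k kp Bu ku h.
apply: (le_trans (ler_normD _ _)); rewrite !normrM ger0_norm// [leRHS]mulrDl;
    apply: lerD; last first.
  by rewrite ler_wpM2r.
rewrite -mulrA ler_pM2l//; apply: cmc_le h _ => //.
by rewrite real_normK ?num_real// ler_piMr// sqr_ge0.
Qed.

(** Along the curve of [null_curve] the normal is tangent to the hypersurface,
    so the velocity is [s nu]; the acceleration is
    [(s' + s ^+ 2 * lambda) nu], which is zero by the choice of [s]. *)
Theorem chart_null_geodesic : exists2 d : R, 0 < d & exists2 g : R -> 'rV[R]_n,
  Ck 2 (`]0, d[%classic : set R) g & forall t : R, 0 < t < d ->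
  [/\ O (g t) /\ chart_BF (g t) = 0, forall v, 'D_v chart_BF (g t) = 0,
     'D_1 (y \o g) t != 0,
     ip (G (y (g t))) ('D_1 (y \o g) t) ('D_1 (y \o g) t) = 0 &
     nabla G (y \o g) ('D_1 (y \o g)) (1 : R) t = 0].
Proof.
have [r r0 [rO [C HC]]] := BF_along_nu_bound.
pose Or := ball p r; have oOr : open Or by exact: ball_open.
have [d d0 [[g s] /= H]] := null_curve oOr (ballxx p r0)
  (Ck_sub oOr oO rO (Ck_le oO (isT : (1 <= 3)%N) CV))
  (Ck_sub oOr oO rO (Ck_le oO (isT : (1 <= 2)%N) Cl))
  (Ck_sub oOr oO rO (Ck_le oO (isT : (2 <= 3)%N) CB)) HC B0 dB0.
exists d => //; exists g.
  have oJ : open (`]0, d[%classic : set R) by exact: interval_open.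
  apply: (@flow_C2 R n O _ nu_tan nu_accel g s oO oJ).
  - exact: Ck_le oO _ CV.
  - exact: Ck_le oO _ Cl.
  - by move=> t /=; rewrite in_itv/= => /H[[/rO Og _] dg ds _ _].
have Yd (t : R) : 0 < t < d -> is_derive t 1 (y \o g) (s t *: chart_nu (g t)).
  move=> /H[[/rO Og _] dg _ Bg _].
  have dgt : differentiable g t by apply/derivable1_diffP; have [] := dg.
  have dyt : differentiable y (g t) by exact: Ck_diff Cy Og.
  apply: DeriveDef; first exact/diff_derivable/differentiable_comp.
  rewrite derive_chain// (@derive_val _ _ _ _ _ _ _ dg) deriveZv//; congr (_ *: _).
  rewrite derive_row// [RHS](chart_nu_coord Gneg OW Eu Og) Bg oppr0 mul0r scale0r addr0.
  by [].
have YE (t : R) : 0 < t < d -> 'D_1 (y \o g) t = s t *: chart_nu (g t).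
  by move=> /Yd h; exact: (@derive_val _ _ _ _ _ _ _ h).
move=> t td; have [[/rO Og s0] dg ds Bg dBg] := H t td.
have dgt : differentiable g t by apply/derivable1_diffP; have [] := dg.
have dst : differentiable s t by apply/derivable1_diffP; have [] := ds.
split => //.
- rewrite YE// scaler_eq0 (negPf s0) /=; apply/eqP => nu0.
  have := ip_nu_N Gneg OW Eu Og; rewrite nu0 /ip !mul0mx mxE => /esym/eqP.
  by apply/negP; exact: (frame_vol_neq0 Gneg OW Eu).
- by rewrite YE// ipZl ipZr (ip_nu_nu Gneg OW Eu Og) Bg oppr0 !mulr0.
have dnug : differentiable (chart_nu \o g) t.
  by apply: differentiable_comp => //; exact: Ck_diff Cnu Og.
have D2 : 'D_1 ('D_1 (y \o g)) t =
    (- (nu_accel (g t) * s t ^+ 2)) *: chart_nu (g t) +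
        s t *: 'D_(s t *: nu_tan (g t)) chart_nu (g t).
  have near_t : \forall u \near t, 'D_1 (y \o g) u = s u *: chart_nu (g u).
    have : \forall u \near t, u \in `]0, d[ by apply: near_in_itvoo; rewrite in_itv.
    by apply: filterS => u; rewrite in_itv => /YE.
  rewrite (near_eq_derive _ near_t); apply/rowP => j.
  have dsn : differentiable (fun u => s u *: chart_nu (g u)) t.
    apply: differentiable_mx => a b.
    rewrite (_ : (fun _ => _) = (fun u => s u * chart_nu (g u) a b)).
      by apply: differentiableM => //; exact: differentiable_entry dnug.
    by apply/funext => u; rewrite mxE.
  rewrite derive_mxE// (_ : (fun _ => _) = s * (fun u => chart_nu (g u) 0 j));
      last first.
    by apply/funext => u; rewrite mxE.
  have dnj := differentiable_entry 0 j dnug.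
  rewrite deriveM; [|exact: diff_derivable|exact: diff_derivable].
  have Ej : 'D_1 (fun u => chart_nu (g u) 0 j) t =
      ('D_(s t *: nu_tan (g t)) chart_nu (g t)) 0 j.
    apply: (etrans (esym (derive_mxE (1 : R) 0 j dnug))).
    have dc := derive_chain (1 : R) dgt (Ck_diff Cnu Og).
    rewrite (@derive_val _ _ _ _ _ _ _ dg) in dc.
    exact: (congr1 (fun z : 'rV[R]_n.+1 => z 0 j) dc).
  rewrite Ej (@derive_val _ _ _ _ _ _ _ ds) [RHS]mxE addrC; congr (_ + _);
      rewrite [RHS]mxE.
    by [].
  exact: mulrC.
rewrite /nabla D2 YE// GammaZl GammaZr deriveZv; last exact: Ck_diff Cnu Og.
rewrite !scalerA -expr2.
have aut := nu_autoparallel oW CG Gneg Gs oO Cy OW Eu Og Bg (fun i => dBg (e i)).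
have sumE : \sum_i nu_tan (g t) 0 i *: nabla G y chart_nu (e i) (g t) =
    'D_(nu_tan (g t)) chart_nu (g t) +
        Gamma G (y (g t)) (chart_nu (g t)) (chart_nu (g t)).
  rewrite derive_row; last exact: Ck_diff Cnu Og.
  rewrite {1}(chart_nu_coord Gneg OW Eu Og) Bg oppr0 mul0r scale0r addr0 Gamma_suml
      -big_split.
  by apply: eq_bigr => i _; rewrite /nabla scalerDr GammaZl.
rewrite sumE in aut.
by rewrite -addrA -scalerDr aut scalerA -scalerDl mulrC addNr scale0r.
Qed.

End ChartGeodesic.

(** * Lorentzian matrices and transversal vectors *)

Section LorentzAlgebra.
Context {R : realType}.

Lemma lorentzian_det d (g : 'M[R]_d.+1) : lorentzian_mx g -> \det g < 0.
Proof.
case=> P Pu ->; rewrite !det_mulmx det_tr det_diag.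
rewrite big_ord_recl mxE /= big1 ?mulr1 => [|i _]; last by rewrite mxE.
rewrite mulrN1 mulNr oppr_lt0 -expr2 exprn_even_gt0//=.
by rewrite -unitfE -unitmxE.
Qed.

Lemma lorentzian_sym d (g : 'M[R]_d) : lorentzian_mx g -> g^T = g.
Proof. by case=> P _ ->; rewrite !trmx_mul trmxK tr_diag_mx mulmxA. Qed.

Lemma open_preimage_in (T S : topologicalType) (U : set T) (D : set S) (f : T -> S) :
  open U -> open D -> {within U, continuous f} -> open (U `&` f @^-1` D).
Proof.
move=> oU oD; rewrite continuous_open_subspace// => cf.
rewrite openE => x [Ux Dx]; apply: filterI; first exact: open_nbhs_nbhs.
apply: (cf x (mem_set Ux)); exact: open_nbhs_nbhs.
Qed.

(** Some vector of the standard basis lies outside the hyperplane spanned by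
    the rows of [A]. *)
Lemma complete_frame n (A : 'M[R]_(n, n.+1)) : row_free A ->
  exists N : 'rV[R]_n.+1,
  \det (\matrix_(k < n.+1) (if unlift ord_max k is Some i then row i A else N)) != 0.
Proof.
move=> Af.
have [k Nk] : exists k, ~~ (row k (1%:M : 'M[R]_n.+1) <= A)%MS.
  apply/existsP; rewrite -negb_forall; apply/negP => /forallP h.
  have /mxrankS : ((1%:M : 'M[R]_n.+1) <= A)%MS by apply/row_subP.
  by rewrite mxrank1 (eqP Af) ltnn.
exists (row k 1%:M); set M := \matrix_(_ < _) _.
rewrite -unitfE -unitmxE -row_free_unit -kermx_eq0; apply/rowV0P => v.
move=> /sub_kermxP vM.
have Mi i : row (lift ord_max i) M = row i A by rewrite rowK liftK.
have Mm : row ord_max M = row k 1%:M by rewrite rowK unlift_none.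
rewrite mulmx_sum_row sum_ord_max Mm in vM.
have v1 : v 0 ord_max = 0.
  apply: contraNeq Nk => v0.
  have -> : row k (1%:M : 'M[R]_n.+1) =
      - (v 0 ord_max)^-1 *: \sum_i v 0 (lift ord_max i) *: row i A.
    move/eqP: vM; rewrite addrC addr_eq0 => /eqP E.
    rewrite scaleNr -scalerN (_ : - _ = v 0 ord_max *: row k 1%:M) ?scalerA ?mulVf
        ?scale1r//.
    by rewrite E; congr (- _); apply: eq_bigr => i _; rewrite Mi.
  apply: scalemx_sub; apply: summx_sub => i _; apply: scalemx_sub.
  exact: row_sub.
rewrite v1 scale0r addr0 in vM.
have v2 : \row_i v 0 (lift ord_max i) = 0.
  apply/eqP; rewrite -(mulmx_free_eq0 _ Af) mulmx_sum_row; apply/eqP.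
  by rewrite -[RHS]vM; apply: eq_bigr => i _; rewrite mxE Mi.
apply/rowP => j; rewrite [RHS]mxE; have [i ->|->//] := unliftP ord_max j.
by move/rowP/(_ i): v2; rewrite !mxE.
Qed.

End LorentzAlgebra.

(** * Tangent vectors and covariant derivatives in a fixed chart *)

Section Transitions.
Context {R : realType} {d : nat} {M : topologicalType}.
Variable X : oriented_lorentz_manifold R d M.
Implicit Types a b : chart_index X.
Notation ch := (@charts R d M X).

Lemma metric_unit a x : cimg (ch a) x -> metric a x \in unitmx.
Proof.
move=> /metric_lorentzian[P Pu ->].
rewrite !unitmx_mul Pu unitmx_tr Pu andbT /= unitmxE det_diag unitfE.
by apply/prodf_neq0 => i _; rewrite mxE; case: ifP; rewrite ?oppr_eq0 oner_neq0.
Qed.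

Lemma transition_dom_sub a b : transition_dom (ch a) (ch b) `<=` cimg (ch a).
Proof. by move=> _ [q [aq _] <-]; exists q. Qed.

Lemma transition_img a b x : transition_dom (ch a) (ch b) x ->
  cimg (ch b) (transition (ch a) (ch b) x).
Proof. by move=> [q [aq bq] <-]; exists q => //; rewrite /transition /= cmapK. Qed.

Lemma transition_domE a b : transition_dom (ch a) (ch b) =
  cimg (ch a) `&` cinv (ch a) @^-1` cdom (ch b).
Proof.
apply/seteqP; split => x.
  by move=> [q [aq bq] <-]; split; [exists q|rewrite /= cmapK].
by move=> [[q aq <-]] /=; rewrite cmapK// => bq; exists q.
Qed.

Lemma transition_dom_open a b : open (transition_dom (ch a) (ch b)).
Proof.
rewrite transition_domE; apply: open_preimage_in.
- exact: cimg_open.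
- exact: cdom_open.
- exact: cinv_continuous.
Qed.

Lemma transition_Ck a b k :
  Ck k (transition_dom (ch a) (ch b)) (transition (ch a) (ch b)).
Proof.
have oW : open (transition_dom (ch a) (ch b)) by exact: transition_dom_open.
apply/(Ck_mxP _ _ oW) => i j; rewrite (ord1 i); apply: analytic_Ck => //.
exact: transition_analytic.
Qed.

Lemma transition_unit a b x : transition_dom (ch a) (ch b) x ->
  'J (transition (ch a) (ch b)) x \in unitmx.
Proof. by move=> /transition_oriented h; rewrite unitmxE unitfE gt_eqF. Qed.

Lemma cmap_dom a b q : cdom (ch a) q -> cdom (ch b) q ->
  transition_dom (ch a) (ch b) (cmap (ch a) q).
Proof. by move=> aq bq; exists q. Qed.

Lemma transition_cmap a b q : cdom (ch a) q ->
  transition (ch a) (ch b) (cmap (ch a) q) = cmap (ch b) q.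
Proof. by move=> aq; rewrite /transition /= cmapK. Qed.

(** The matrix that takes components in the chart [a] to components in the
    chart in which tangent vectors at [q] are represented. *)
Definition jac a q := 'J (transition (ch a) (ch (chart_at X q))) (cmap (ch a) q).

Lemma jac_unit a q : cdom (ch a) q -> jac a q \in unitmx.
Proof. by move=> aq; apply: transition_unit; apply: cmap_dom => //;
    exact: chart_atP. Qed.

Lemma jac_det a q : cdom (ch a) q -> 0 < \det (jac a q).
Proof. by move=> aq; apply: transition_oriented; apply: cmap_dom => //;
    exact: chart_atP. Qed.

Lemma gram_change a q : cdom (ch a) q ->
  metric a (cmap (ch a) q) = jac a q *m gram_at X q *m (jac a q)^T.
Proof.
move=> aq; rewrite (metricJ (cmap_dom aq (chart_atP X q))).
by rewrite /gram_at transition_cmap.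
Qed.

Lemma metric_at_change a q v w : cdom (ch a) q ->
  metric_at X q (v *m jac a q) (w *m jac a q) = ip (metric a (cmap (ch a) q)) v w.
Proof. by move=> aq; rewrite gram_change// ip_congr. Qed.

Section Maps.
Context {V : normedModType R}.
Variables (O : set V) (f : V -> M) (a : chart_index X).
Hypotheses (oO : open O) (cf : {within O, continuous f}).
Hypotheses (Oa : forall t, O t -> cdom (ch a) (f t)).
Let y := cmap (ch a) \o f.
Hypothesis Cy : Ck 2 O y.
Hypothesis Cmetric : metric_Ck X 1.

Let Ob b := O `&` f @^-1` cdom (ch b).
Let oOb b : open (Ob b).
Proof. by apply: open_preimage_in => //; exact: cdom_open. Qed.

(** Near [t] the map [f] takes values in the domain of the chart chosen at
    [f t] as well, where [tangent_change] applies. *)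
Lemma tangent_chart t v : O t -> tangent X f v t = 'D_v y t *m jac a (f t).
Proof.
move=> Ot; pose b := chart_at X (f t).
have Obt : Ob b t by split => //; exact: chart_atP.
have CyO := Ck_sub (oOb b) oO (@subIsetl _ _ _) Cy.
apply: (tangent_change (transition_Ck a b 2) (oOb b) CyO _ _ v Obt).
- by move=> s [Os bs]; apply: cmap_dom => //; exact: Oa.
- by move=> s [Os bs]; rewrite /y /= transition_cmap//; exact: Oa.
Qed.

Lemma cov_deriv_chart t v w : O t ->
  cov_deriv X f v w t = nabla (metric a) y ('D_w y) v t *m jac a (f t).
Proof.
move=> Ot; pose b := chart_at X (f t).
have Obt : Ob b t by split => //; exact: chart_atP.
have CyO := Ck_sub (oOb b) oO (@subIsetl _ _ _) Cy.
have oWb : open (cimg (ch b)) by exact: cimg_open.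
apply: (nabla_change (@transition_dom_open a b) oWb (Cmetric b) _ _ _ _
  (transition_Ck a b 2) _ _ _ (oOb b) CyO _ _ v w Obt).
- by move=> x /transition_dom_sub; exact: metric_unit.
- by move=> x /transition_dom_sub /metric_lorentzian/lorentzian_sym.
- by move=> x; exact: metric_unit.
- by move=> x /metric_lorentzian/lorentzian_sym.
- by move=> x; exact: transition_img.
- by move=> x; exact: transition_unit.
- by move=> x; exact: metricJ.
- by move=> s [Os bs]; apply: cmap_dom => //; exact: Oa.
- by move=> s [Os bs]; rewrite /y /= transition_cmap//; exact: Oa.
Qed.

End Maps.
End Transitions.

(** A form of Cramer's rule: the determinant reads off the last coordinate of
    a vector in the basis of the rows of [E]. *)
Lemma det_replace_row (R : comPzRingType) n (E : 'M[R]_n.+1) (c : 'rV[R]_n.+1) :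
  \det (\matrix_(k < n.+1) (if unlift ord_max k is Some _ then row k E else c *m E)) =
  c 0 ord_max * \det E.
Proof.
pose T : 'M[R]_n.+1 := \matrix_(k < n.+1)
    (if unlift ord_max k is Some _ then delta_mx 0 k else c).
have -> : \matrix_(k < n.+1)
    (if unlift ord_max k is Some _ then row k E else c *m E) = T *m E.
  apply/row_matrixP => k; rewrite row_mul !rowK.
  by case: (unlift _ k) => // i; rewrite -rowE.
rewrite det_mulmx; congr (_ * _);
    rewrite (expand_det_row _ ord_max) (bigD1 ord_max)//= big1 ?addr0.
  rewrite mxE unlift_none /cofactor -signr_odd oddD addbb mul1r.
  rewrite (_ : row' _ _ = 1%:M) ?det1 ?mulr1//.
  apply/matrixP => i j; rewrite !mxE liftK mxE eqxx (inj_eq lift_inj) /=.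
  by rewrite eq_sym.
move=> k kn; rewrite /cofactor (_ : \det _ = 0) ?mulr0//.
have [k' kk'|kk'] := unliftP ord_max k; last by rewrite kk' eqxx in kn.
rewrite (expand_det_row _ k') big1// => j _; rewrite !mxE liftK mxE /=.
by rewrite -kk' eq_sym (negPf (neq_lift _ _)) mul0r.
Qed.

(** * The hypersurface in a chart *)

Section ChartHypersurface.
Context {R : realType} {n : nat} {M : topologicalType}.
Variables (X : oriented_lorentz_manifold R n.+1 M) (F : 'rV[R]_n -> M).
Variables (a : chart_index X) (O : set 'rV[R]_n) (N : 'rV[R]_n.+1).
Notation ch := (@charts R n.+1 M X).
Let y := cmap (ch a) \o F.
Notation G := (@metric R n.+1 M X a).
Notation e i := (delta_mx 0 i).
Hypotheses (Cmetric : metric_Ck X 4) (oO : open O) (cF : {within O, continuous F}).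
Hypotheses (Oa : forall u, O u -> cdom (ch a) (F u)) (Cy : Ck 4 O y).
Hypothesis Eu : forall u, O u -> \det (frame_mx y N u) != 0.

Let W := cimg (ch a).
Let oW : open W. Proof. exact: cimg_open. Qed.
Let CG : Ck 4 W G. Proof. exact: Cmetric. Qed.
Let Gneg x : W x -> \det (G x) < 0.
Proof. by move=> /metric_lorentzian/lorentzian_det. Qed.
Let Gs x : W x -> (G x)^T = G x.
Proof. by move=> /metric_lorentzian/lorentzian_sym. Qed.
Let OW u : O u -> W (y u).
Proof. by move=> /Oa h; exists (F u). Qed.
Let Cmetric1 : metric_Ck X 1.
Proof. by move=> b; apply: Ck_le (Cmetric b) => //; exact: cimg_open. Qed.
Let Cy2 : Ck 2 O y. Proof. exact: Ck_le oO _ Cy. Qed.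

Lemma pd_chart u i : O u -> pd X F i u = 'D_(e i) y u *m jac a (F u).
Proof. by move=> Ou; exact: (tangent_chart oO cF Oa Cy2). Qed.

Lemma SF_chart u : O u -> SF X F u = chart_SF G y u.
Proof.
move=> Ou; apply/matrixP => i j; rewrite [LHS]mxE [RHS]mxE !pd_chart//.
exact: (metric_at_change _ _ (Oa Ou)).
Qed.

Lemma BF_chart u : O u -> BF X F u = chart_BF G y u.
Proof. by move=> Ou; rewrite /BF SF_chart. Qed.

Lemma sqrt_gram u : O u -> Num.sqrt `|\det (gram_at X (F u))| * \det (jac a (F u)) =
  Num.sqrt (- \det (G (y u))).
Proof.
move=> Ou; have J0 := jac_det (Oa Ou).
have E : \det (G (y u)) = \det (jac a (F u)) ^+ 2 * \det (gram_at X (F u)).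
  by rewrite (gram_change (Oa Ou)) !det_mulmx det_tr; ring.
have g0 : \det (gram_at X (F u)) < 0.
  have := Gneg (OW Ou); rewrite E pmulr_rlt0// exprn_gt0//.
rewrite E ltr0_norm// -mulrN sqrtrM ?exprn_ge0 ?ltW//.
by rewrite sqrtr_sqr gtr0_norm// mulrC.
Qed.

(** Replacing the transversal in the frame by [w] multiplies the volume by the
    last frame coordinate of [w], by [det_replace_row]. Pairing with [nu]
    multiplies this coordinate by [omega] too, as [nu] is orthogonal to the
    other vectors of the frame. *)
Lemma chart_nu_is_normal u : O u -> is_normal X F u (chart_nu G y N u *m jac a (F u)).
Proof.
move=> Ou w; set J := jac a (F u).
have Ju : J \in unitmx by exact: jac_unit (Oa Ou).
have Eunit : frame_mx y N u \in unitmx by rewrite unitmxE unitfE Eu.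
rewrite -[w](mulmxKV Ju); set w' := w *m invmx J.
rewrite metric_at_change; last exact: Oa.
rewrite /volume_at.
have -> : \matrix_i frame X F u (w' *m J) i =
   (\matrix_(k < n.+1) (if unlift ord_max k is Some _ then row k (frame_mx y N u)
      else (w' *m invmx (frame_mx y N u)) *m frame_mx y N u)) *m J.
  apply/row_matrixP => k; rewrite row_mul !rowK /frame.
  have [i _|_] := unliftP ord_max k.
    by rewrite pd_chart.
  by rewrite (mulmxKV Eunit).
rewrite det_mulmx det_replace_row [X in _ * X]mulrC mulrA sqrt_gram//.
rewrite [X in _ = _ * X]mulrC mulrA -/(frame_vol G y N u).
rewrite {1}(_ : w' = (w' *m invmx (frame_mx y N u)) *m frame_mx y N u); last first.
  by rewrite (mulmxKV Eunit).
set c := w' *m _; rewrite /ip trmx_mul mulmxA -[_ *m G _ *m _]mulmxA.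
rewrite (chart_nuE Gneg OW Eu Ou) -scalemxAl mxE; congr (_ * _).
by rewrite -rowE !mxE.
Qed.

Lemma normal_chart u : O u -> normal X F u = chart_nu G y N u *m jac a (F u).
Proof. by move=> Ou; rewrite -(proj2 (Defs.normalP X F u) _ (chart_nu_is_normal Ou)).
    Qed.

Lemma hF_chart u i j : O u -> hF X F u i j = chart_hF G y N u i j.
Proof.
move=> Ou; rewrite /hF normal_chart//.
rewrite (cov_deriv_chart oO cF Oa Cy2 Cmetric1 _ _ Ou).
by rewrite metric_at_change//; exact: Oa.
Qed.

Lemma AF_chart u : O u -> AF X F u = chart_AF G y N u.
Proof.
move=> Ou; apply: eq_bigr => i _; apply: eq_bigr => j _.
by rewrite SF_chart// hF_chart.
Qed.

Lemma degenerate_pointP (U : set 'rV[R]_n) u : O u -> U u ->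
  degenerate_point X F U u <-> chart_BF G y u = 0 /\ forall v, 'D_v (chart_BF G y) u =
      0.
Proof.
move=> Ou Uu; have CB := Ck_chart_BF oW CG oO Cy OW.
have nearB : \near u, chart_BF G y u = BF X F u.
  by apply: (open_near oO Ou) => t Ot; exact: (esym (BF_chart Ot)).
have dcB : differentiable (chart_BF G y) u by exact: Ck_diff CB Ou.
have dBF : differentiable (BF X F) u by exact: near_eq_differentiable nearB dcB.
have DE v : 'D_v (chart_BF G y) u = 'd (BF X F) u v.
  by rewrite (near_eq_derive _ nearB) deriveE.
split=> [[[_ B0] [_ d0]]|[B0 D0]].
  split=> [|v]; first exact: (etrans (esym (BF_chart Ou)) B0).
  by rewrite DE d0.
split; first by split; [exact: Uu|exact: (etrans (BF_chart Ou) B0)].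
by split; [exact: dBF|apply/funext => v; rewrite -DE D0].
Qed.

Variables (U : set 'rV[R]_n) (K : R) (p : 'rV[R]_n).
Hypotheses (OU : O `<=` U) (CF : Ck_map X 4 U F) (oU : open U).
Hypotheses (Op : O p) (AK : forall u, O u -> AF X F u ^+ 2 = K ^+ 2 * `|BF X F u| ^+ 3).

Let AK_chart u : O u -> chart_AF G y N u ^+ 2 = K ^+ 2 * `|chart_BF G y u| ^+ 3.
Proof.
move=> Ou; have := AK Ou; have := AF_chart Ou; have := BF_chart Ou.
by move: (chart_AF _ _ _ _) (chart_BF _ _ _) => A B -> ->.
Qed.

Lemma lightlike_is_degenerate : K != 0 -> lightlike_point X F U p ->
    degenerate_point X F U p.
Proof.
move=> K0 [Up B0]; apply/(degenerate_pointP Op Up).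
have CB := Ck_chart_BF oW CG oO Cy OW.
have CA := Ck_chart_AF oW CG Gneg oO Cy OW Eu.
have B0' := etrans (esym (BF_chart Op)) B0; split; first exact: B0'.
exact: (cmc_critical oO Op K0 CA (Ck_le oO (isT : (1 <= 3)%N) CB) AK_chart B0').
Qed.

Lemma geodesic_through_degenerate : degenerate_point X F U p ->
  exists2 L : set M, lightlike_geodesic_segment X L &
    L `<=` F @` [set p | degenerate_point X F U p].
Proof.
move=> dp; have [B0 dB0] := (degenerate_pointP Op (OU Op)).1 dp.
have [d d0 [g Cg Hg]] := chart_null_geodesic oW CG Gneg Gs oO Cy OW Eu Op AK_chart B0
    dB0.
pose J := `]0, d[%classic : set R.
have oJ : open J by exact: interval_open.
have Jd t : J t -> 0 < t < d by rewrite /J /= in_itv.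
have JO t : J t -> O (g t) by move=> /Jd/Hg[[]].
have cg : {in J, continuous g} by move=> t /set_mem; exact: (Ck_continuous oJ Cg).
have cU : {within U, continuous F} by case: CF.
pose sigma := F \o g.
have csigma : {within J, continuous sigma}.
  rewrite continuous_open_subspace// => t tJ; apply: continuous_comp; first exact: cg.
  move: cU; rewrite continuous_open_subspace// => cU'; apply: cU'; apply/mem_set.
  exact/OU/JO/set_mem.
have Ja t : J t -> cdom (ch a) (sigma t) by move=> /JO/Oa.
have Cys : Ck 2 J (cmap (ch a) \o sigma) by exact: (Ck_comp_row oJ oO JO Cg Cy2).
exists (sigma @` J); last first.
  move=> _ [t Jt <-]; have [[Og Bg] dBg _ _ _] := Hg t (Jd t Jt).
  have Ug := OU Og.
  by exists (g t); [exact: (proj2 (degenerate_pointP Og Ug) (conj Bg dBg))|].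
exists J, sigma; split.
  split; [exact: interval_is_interval|exact: oJ|].
  by exists (d / 2); rewrite /J /= in_itv/= divr_gt0//= ltr_pdivrMr// ltr_pMr// ltr1n.
have tE t : J t -> tangent X sigma (1 : R) t = 'D_1 (y \o g) t *m jac a (sigma t).
  by move=> Jt; exact: (tangent_chart oJ csigma Ja Cys (1 : R) Jt).
split.
- split.
    split; first exact: csigma.
    move=> b; have oJb : open (J `&` sigma @^-1` cdom (ch b)).
      by apply: open_preimage_in => //; exact: cdom_open.
    have oUb : open (U `&` F @^-1` cdom (ch b)).
      by apply: open_preimage_in => //; exact: cdom_open.
    have CFb : Ck 2 (U `&` F @^-1` cdom (ch b)) (cmap (ch b) \o F).
      by apply: Ck_le (proj2 CF b).
    apply: (Ck_comp_row oJb oUb _ _ CFb).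
      by move=> t [/JO/OU Ug bg]; split.
    exact: Ck_sub oJb oJ (@subIsetl _ _ _) Cg.
  move=> t Jt; have [_ _ _ _ acc0] := Hg t (Jd t Jt).
  apply: (etrans (cov_deriv_chart oJ csigma Ja Cys Cmetric1 (1 : R) (1 : R) Jt)).
  exact: (etrans (congr1 (fun z => z *m _) acc0) (mul0mx _ _)).
- move=> t Jt; have [_ _ nz _ _] := Hg t (Jd t Jt).
  apply: contra_neq nz => z; have := tE t Jt.
  rewrite z => /(congr1 (mulmx^~ (invmx (jac a (sigma t))))).
  by rewrite mul0mx mulmxK ?jac_unit//; exact: Ja.
- move=> t Jt; have [_ _ _ null _] := Hg t (Jd t Jt).
  by rewrite tE// metric_at_change//; exact: Ja.
- by [].
Qed.

End ChartHypersurface.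

(** * Charts and transversals adapted to a point *)

Section AdaptedChart.
Context {R : realType} {n : nat} {M : topologicalType}.
Variables (X : oriented_lorentz_manifold R n.+1 M) (F : 'rV[R]_n -> M).
Variables (U : set 'rV[R]_n) (p : 'rV[R]_n).
Notation a := (chart_at X (F p)).
Notation y := (cmap (charts a) \o F).

(** A vector that completes the tangent frame at [p] still does so at nearby
    points. *)
Lemma adapted_chart : open U -> immersion X F U -> Ck_map X 4 U F -> U p ->
  exists N (O : set 'rV[R]_n), [/\ open O, O p & O `<=` U] /\
   [/\ forall u, O u -> cdom (charts a) (F u), Ck 4 O y &
      forall u, O u -> \det (frame_mx y N u) != 0].
Proof.
move=> oU [_ imm] [cF CF] Up.
pose O0 := U `&` F @^-1` cdom (charts a).
have oO0 : open O0 by apply: open_preimage_in => //; exact: cdom_open.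
have O0p : O0 p by split => //; exact: chart_atP.
have [N HN] := complete_frame (imm p Up).
have HN' : \det (frame_mx y N p) != 0.
  suff -> : frame_mx y N p = \matrix_(k < n.+1) (if unlift ord_max k is Some i
    then row i (\matrix_(i < n) pd X F i p) else N) by [].
  by apply/row_matrixP => k; rewrite !rowK; case: (unlift _ _) => // i; rewrite rowK.
pose O := O0 `&` (fun u => \det (frame_mx y N u)) @^-1` [set r | r != 0].
have oO : open O.
  apply: open_preimage_in; [exact: oO0|exact: open_neq|].
  have := Ck_det oO0 (Ck_frame N oO0 (CF a)).
  by move=> /(Ck_le oO0 (isT : (0 <= 3)%N)).
exists N, O; split; first by split => // u [[]].
split=> [u [[]]||u []]//.
by apply: Ck_sub (CF a) => // u [].
Qed.

End AdaptedChart.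

Lemma analytic_map_Ck (R : realType) n (M : topologicalType)
    (X : oriented_lorentz_manifold R n.+1 M) (F : 'rV[R]_n -> M) U k :
  open U -> analytic_map X U F -> Ck_map X k U F.
Proof.
move=> oU [cF HF]; split=> // a.
have oUa : open (U `&` F @^-1` cdom (charts a)).
  by apply: open_preimage_in => //; exact: cdom_open.
apply/(Ck_mxP _ _ oUa) => i j; rewrite (ord1 i).
exact: analytic_Ck oUa (HF a j).
Qed.

Lemma metric_analytic_Ck (R : realType) d (M : topologicalType)
    (X : oriented_lorentz_manifold R d M) k : metric_analytic X -> metric_Ck X k.
Proof.
move=> HX a; have oW : open (cimg (charts a)) by exact: cimg_open.
by apply/(Ck_mxP _ _ oW) => i j; apply: analytic_Ck.
Qed.

Theorem theoremE (R : realType) (n : nat) (hn : (2 <= n)%N)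
    (M : topologicalType) (X : oriented_lorentz_manifold R n.+1 M)
    (U : set 'rV[R]_n) (U_dom : domain U)
    (F : 'rV[R]_n -> M) (F_imm : immersion X F U)
    (h : [/\ metric_analytic X, analytic_map X U F,
             exists2 c : R, c != 0 & constant_mean_curvature X F U c &
             exists p, lightlike_point X F U p]
      \/ [/\ exists2 r : nat, (4 <= r)%N & metric_Ck X r, Ck_map X 4 U F,
             zero_mean_curvature X F U &
             exists p, degenerate_point X F U p]) :
  exists2 L : set M, lightlike_geodesic_segment X L &
    L `<=` F @` [set p | degenerate_point X F U p].
Proof.
case: U_dom => oU _ _.
have cmcE c : constant_mean_curvature X F U c -> forall u, U u ->
    AF X F u ^+ 2 = (n%:R * c) ^+ 2 * `|BF X F u| ^+ 3.
  move=> H u /H /eqP; rewrite subr_eq0 => /eqP ->.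
  by rewrite exprMn powR_32_sqr.
(* Both cases are instances of one situation, in which [c] is [n] times the
   mean curvature; it may vanish if the given point is degenerate. *)
have [CX [CF [c [AK [p [Up dp]]]]]] : metric_Ck X 4 /\ Ck_map X 4 U F /\ exists c,
    (forall u, U u -> AF X F u ^+ 2 = c ^+ 2 * `|BF X F u| ^+ 3) /\
    exists p, U p /\ (degenerate_point X F U p \/ c != 0 /\ lightlike_point X F U p).
  case: h => [[aX aF [c c0 H] [p lp]]|[[r r4 CX] CF H [p dp]]].
    split; first exact: metric_analytic_Ck.
    split; first exact: analytic_map_Ck.
    exists (n%:R * c); split; first exact: cmcE.
    exists p; split; first by case: lp.
    by right; rewrite mulf_neq0// pnatr_eq0 -lt0n (leq_trans _ hn).
  split.
    by move=> a; apply: Ck_le (CX a) => //; exact: cimg_open.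
  split=> //; exists (n%:R * 0); split; first exact: cmcE.
  by exists p; split; [case: dp => -[]|left].
have [N [W [[oW Wp WU] [Wa Cy Eu]]]] := adapted_chart oU F_imm CF Up.
have cF : {within W, continuous F}.
  apply: continuous_subspaceW WU _; exact: (proj1 CF).
have AKW u : W u -> AF X F u ^+ 2 = c ^+ 2 * `|BF X F u| ^+ 3.
  by move=> /WU; exact: AK.
have {}dp : degenerate_point X F U p.
  case: dp => [//|[c0]].
  exact: (lightlike_is_degenerate CX oW cF Wa Cy Eu Wp AKW c0).
exact: (geodesic_through_degenerate CX oW cF Wa Cy Eu WU CF oU Wp AKW dp).
Qed.
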